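(* Equivariant algebraic K-theory $K(G,-)$ does not satisfy descent with respect to the $H$-Nisnevich topology.
   Context: Let $k$ be a field of characteristic $0$ and $G$ a finite group, regarded as a finite constant group scheme over $k$. $G\mathrm{Sm}/k$ is the category of $G$-equivariant separated smooth $k$-schemes with $G$-equivariant morphisms, and $\mathrm{Sm}/k$ is the category of smooth $k$-schemes. For a subgroup $H\le G$, the fixed-point scheme $X^H$ of $X\in G\mathrm{Sm}/k$ is the closed subscheme representing the functor that sends a $k$-scheme $Y$ to the set of $H$-equivariant morphisms $Y_{\mathrm{tr}}\to X$, where $Y_{\mathrm{tr}}$ is $Y$ with trivial $H$-action; it is a smooth $k$-scheme. The $H$-Nisnevich (fixed-point Nisnevich) topology on $G\mathrm{Sm}/k$: a morphism $f:X\to Y$ in $G\mathrm{Sm}/k$ is a covering if $f^H:X^H\to Y^H$ is an ordinary Nisnevich covering in $\mathrm{Sm}/k$ for all subgroups $H\le G$. Equivariant algebraic K-theory: for $X\in G\mathrm{Sm}/k$ with action $\alpha_X:G\times X\to X$, a quasi-coherent $G$-module on $X$ is a quasi-coherent $\mathcal{O}_X$-module $F$ together with an isomorphism $\varphi:\alpha_X^*F\to pr_2^*F$ of $\mathcal{O}_{G\times X}$-modules satisfying the cocycle condition $(pr_{23}^*\varphi)\circ((\mathrm{id}\times\alpha_X)^*\varphi)=(m\times\mathrm{id})^*\varphi$, where $m$ is the multiplication of $G$ and $pr_2$, $pr_{23}$ are the projections. It is called coherent (resp. locally free) if $F$ is so as an $\mathcal{O}_X$-module. $P(G,X)$ is the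 exact category of locally free coherent $G$-modules on $X$ ($G$-equivariant vector bundles), $BQP(G,X)$ is the simplicial nerve of Quillen's $Q$-construction on it, and $K(G,X)=\Omega BQP(G,X)$ is the associated K-theory spectrum (or infinite loop space). $K(G,-)$ is considered as a simplicial presheaf on $G\mathrm{Sm}/k$. Descent is considered here in the form of Čech descent, which is weaker than hypercover descent: an objectwise fibrant simplicial presheaf $F$ on a site $\mathcal{C}$ satisfies Čech descent if for any covering family $\{U_i\to X\}_i$ in $\mathcal{C}$ the morphism $$F(X)\to\operatorname{holim}\Bigl(\prod_iF(U_i)\rightrightarrows\prod_{i,j}F(U_i\times_XU_j)\;\substack{\to\\ \to\\ \to}\;\cdots\Bigr)$$ is a weak equivalence of simplicial sets; an arbitrary simplicial presheaf is said to satisfy Čech descent if an objectwise fibrant replacement of it does.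
   Formalization: The finite group G is assumed to be nontrivial: for trivial G the H-Nisnevich topology is the ordinary Nisnevich topology, for which algebraic K-theory does satisfy descent, so the claim fails there. *)

(* Defs.v *)
From HB Require Import structures.
From mathcomp Require Import all_boot all_order all_algebra all_fingroup.
From mathcomp Require Import boolp.

Set Implicit Arguments.
Unset Strict Implicit.
Unset Printing Implicit Defensive.
Set Primitive Projections.

(* Conventions.
   - Schemes over k are taken in their functor-of-points form: a k-functor is a
     functor from commutative k-algebras to types, and a scheme is a k-functor
     that is a Zariski sheaf and is covered by affine open subfunctors.
   - A quasi-coherent module on X is a cartesian family of modules indexed by
     the points of X with values in all k-algebras.  Inverse images are then
     strictly functorial, so that K(G,-) is a presheaf on the nose.
   - Several structure maps take their target point as a separate argument with
     a proof that it is the expected one.  Together with primitive projections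
     this makes inverse images functorial up to conversion. *)

Record cat := Cat {
  obj :> Type;
  hom : obj -> obj -> Type;
  idm : forall a, hom a a;
  comp : forall a b c, hom b c -> hom a b -> hom a c;
  comp_idl : forall a b (f : hom a b), comp (idm b) f = f;
  comp_idr : forall a b (f : hom a b), comp f (idm a) = f;
  comp_assoc : forall a b c d (f : hom c d) (g : hom b c) (h : hom a b),
    comp f (comp g h) = comp (comp f g) h }.

Arguments hom {_} _ _.
Arguments idm {_} _.
Arguments comp {_ a b c} _ _.

Record mono (m n : nat) := Mono {
  mfun :> 'I_m.+1 -> 'I_n.+1;
  mono_le : forall i j : 'I_m.+1, i <= j -> mfun i <= mfun j }.

Definition mono_id n : mono n n := Mono (fun i j (e : i <= j) => e).

Definition mono_comp m n p (f : mono n p) (g : mono m n) : mono m p :=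
  Mono (fun i j e => mono_le f (mono_le g e)).

Definition mono_const m n (i : 'I_n.+1) : mono m n :=
  Mono (fun (_ _ : 'I_m.+1) _ => leqnn i).

(* The object n of Delta is the ordinal [n] = {0 < ... < n}. *)
Definition Delta : cat := @Cat nat mono mono_id mono_comp
  (fun _ _ _ => erefl) (fun _ _ _ => erefl) (fun _ _ _ _ _ _ _ => erefl).

Record sset := SSet {
  simp :> nat -> Type;
  sop : forall m n, mono m n -> simp n -> simp m;
  sop_id : forall n (x : simp n), sop (mono_id n) x = x;
  sop_comp : forall m n p (f : mono n p) (g : mono m n) (x : simp p),
    sop (mono_comp f g) x = sop g (sop f x) }.

Arguments sop {s m n} _ _.

Record smap (X Y : sset) := SMap {
  sfun :> forall n, X n -> Y n;
  sfun_nat : forall m n (t : mono m n) (x : X n),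
    sfun (sop t x) = sop t (sfun x) }.

Arguments sfun {X Y} _ {n} _.

Lemma smap_eq X Y (f g : smap X Y) : (forall n (x : X n), f n x = g n x) -> f = g.
Proof.
case: f g => [f fn] [g gn] /= e.
have {}e : f = g by apply: functional_extensionality_dep => n; apply: funext.
by case: _ / e gn => gn; congr SMap; apply: Prop_irrelevance.
Qed.

Definition smap_comp X Y Z (g : smap Y Z) (f : smap X Y) : smap X Z.
Proof.
exists (fun n x => g n (f n x)).
by move=> m n t x; rewrite !sfun_nat.
Defined.

Definition std (n : nat) : sset :=
  @SSet (fun m => mono m n) (fun _ _ t x => mono_comp x t)
    (fun _ _ => erefl) (fun _ _ _ _ _ _ => erefl).

Definition sprod (X Y : sset) : sset.
Proof.
exists (fun n => (X n * Y n)%type) (fun m n t x => (sop t x.1, sop t x.2)).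
- by move=> n [x y]; rewrite !sop_id.
- by move=> m n p f g [x y]; rewrite !sop_comp.
Defined.

Definition sprod_fam (I : Type) (X : I -> sset) : sset.
Proof.
exists (fun n => forall i, X i n) (fun m n t x i => sop t (x i)).
- by move=> n x; apply: functional_extensionality_dep => i; rewrite sop_id.
- by move=> m n p f g x; apply: functional_extensionality_dep => i; rewrite sop_comp.
Defined.

Definition std_map m n (t : mono m n) : smap (std m) (std n) :=
  @SMap (std m) (std n) (fun _ x => mono_comp t x) (fun _ _ _ _ => erefl).

Definition in_horn n (k : 'I_n.+1) m (t : mono m n) : Prop :=
  exists2 j, j <> k & forall i, t i <> j.

Lemma in_horn_comp n (k : 'I_n.+1) m p (x : mono m n) (t : mono p m) :
  in_horn k x -> in_horn k (mono_comp x t).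
Proof. by case=> j jk h; exists j => // i; apply: h. Qed.

Definition horn n (k : 'I_n.+1) : sset.
Proof.
exists (fun m => {t : mono m n | in_horn k t})
  (fun m p t x => exist _ (mono_comp (sval x) t) (in_horn_comp t (svalP x))).
- by move=> m [x h]; apply: eq_exist.
- by move=> m p q f g [x h]; apply: eq_exist.
Defined.

Definition kan (X : sset) : Prop :=
  forall n (k : 'I_n.+2) (h : smap (horn k) X),
  exists x : X n.+1, forall m (t : horn k m), sop (sval t) x = h m t.

Definition homotopic X Y (f g : smap X Y) : Prop :=
  exists H : smap (sprod X (std 1)) Y, forall n (x : X n),
    H n (x, mono_const n ord0) = f n x /\ H n (x, mono_const n ord_max) = g n x.

(* [Y, Z] -> [X, Z] is bijective for every Kan complex Z, i.e. f is inverted in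
   the homotopy category of simplicial sets. *)
Definition weak_equiv X Y (f : smap X Y) : Prop :=
  forall Z : sset, kan Z ->
    (forall u : smap X Z, exists v : smap Y Z, homotopic (smap_comp v f) u) /\
    (forall v w : smap Y Z,
       homotopic (smap_comp v f) (smap_comp w f) -> homotopic v w).

(* n-simplices: maps Delta^n x Delta^1 -> Z carrying Delta^n x {0,1} to z. *)
Definition loop_cond (Z : sset) (z : Z 0) n (l : smap (sprod (std n) (std 1)) Z) :=
  forall m (x : std n m) (e : 'I_2),
    l m (x, mono_const m e) = sop (mono_const m ord0) z.

Definition sprod_std_map m n (t : mono m n) (Y : sset) :
  smap (sprod Y (std m)) (sprod Y (std n)) :=
  @SMap (sprod Y (std m)) (sprod Y (std n))
    (fun _ x => (x.1, mono_comp t x.2)) (fun _ _ _ _ => erefl).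

Definition std_sprod_map m n (t : mono m n) (Y : sset) :
  smap (sprod (std m) Y) (sprod (std n) Y) :=
  @SMap (sprod (std m) Y) (sprod (std n) Y)
    (fun _ x => (mono_comp t x.1, x.2)) (fun _ _ _ _ => erefl).

Lemma loop_cond_comp (Z : sset) (z : Z 0) m n (t : mono m n)
    (l : smap (sprod (std n) (std 1)) Z) :
  loop_cond z l -> loop_cond z (smap_comp l (std_sprod_map t (std 1))).
Proof. by move=> h p x e; apply: h. Qed.

Definition loops (Z : sset) (z : Z 0) : sset.
Proof.
exists (fun n => {l : smap (sprod (std n) (std 1)) Z | loop_cond z l})
  (fun m n t l => exist _ _ (loop_cond_comp t (svalP l))).
- by move=> n [l h]; apply: eq_exist; apply: smap_eq => m [x y].
- by move=> m n p f g [l h]; apply: eq_exist; apply: smap_eq.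
Defined.

Record sdiagram (C : cat) := SDiagram {
  dobj :> C -> sset;
  dmap : forall a b, hom a b -> smap (dobj a) (dobj b);
  dmap_id : forall a n (x : dobj a n), dmap (idm a) n x = x;
  dmap_comp : forall a b c (f : hom b c) (g : hom a b) n (x : dobj a n),
    dmap (comp f g) n x = dmap f n (dmap g n x) }.

Arguments dmap {C} s {a b} _.

(* The p-simplices of the nerve of C/c: functors [p] -> C/c. *)
Record over_chain (C : cat) (c : C) (p : nat) := OverChain {
  och_ob : 'I_p.+1 -> C;
  och_str : forall i, hom (och_ob i) c;
  och_tr : forall i j : 'I_p.+1, i <= j -> hom (och_ob i) (och_ob j);
  och_trstr : forall (i j : 'I_p.+1) (e : i <= j), comp (och_str j) (och_tr e) = och_str i;
  och_tr_id : forall (i : 'I_p.+1) (e : i <= i), och_tr e = idm (och_ob i);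
  och_tr_comp : forall (i j l : 'I_p.+1) (e1 : i <= j) (e2 : j <= l) (e3 : i <= l),
    och_tr e3 = comp (och_tr e2) (och_tr e1) }.

Definition over_nerve (C : cat) (c : C) : sset :=
  @SSet (over_chain c)
    (fun m n t x => @OverChain C c m (fun i => och_ob x (t i))
       (fun i => och_str x (t i))
       (fun i j e => och_tr x (mono_le t e))
       (fun i j e => och_trstr x (mono_le t e))
       (fun i e => och_tr_id x (mono_le t e))
       (fun i j l e1 e2 e3 =>
          och_tr_comp x (mono_le t e1) (mono_le t e2) (mono_le t e3)))
    (fun _ _ => erefl) (fun _ _ _ _ _ _ => erefl).

Definition over_push (C : cat) (c d : C) (u : hom c d) p (x : over_chain c p) :
  over_chain d p :=
  @OverChain C d p (och_ob x) (fun i => comp u (och_str x i)) (@och_tr _ _ _ x)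
    (fun i j e => etrans (esym (comp_assoc u (och_str x j) (och_tr x e)))
                         (congr1 (comp u) (och_trstr x e)))
    (@och_tr_id _ _ _ x) (@och_tr_comp _ _ _ x).

(* The Bousfield-Kan homotopy limit hom(N(C/-), D). *)
Definition holim_cond (C : cat) (D : sdiagram C) m
    (t : forall c, smap (sprod (over_nerve c) (std m)) (D c)) : Prop :=
  forall (a b : C) (u : hom a b) n (z : over_nerve a n) (d : std m n),
    t b n (over_push u z, d) = dmap D u n (t a n (z, d)).

Lemma holim_cond_comp (C : cat) (D : sdiagram C) m n (s : mono m n)
    (t : forall c, smap (sprod (over_nerve c) (std n)) (D c)) :
  holim_cond t ->
  holim_cond (fun c => smap_comp (t c) (sprod_std_map s (over_nerve c))).
Proof. by move=> h a b u p z d; apply: h. Qed.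

Definition holim (C : cat) (D : sdiagram C) : sset.
Proof.
exists (fun m => {t : forall c, smap (sprod (over_nerve c) (std m)) (D c) | holim_cond t})
  (fun m n s t => exist _ _ (holim_cond_comp s (svalP t))).
- move=> n [t h]; apply: eq_exist; apply: functional_extensionality_dep => c /=.
  by apply: smap_eq => m [x y].
- move=> m n p f g [t h]; apply: eq_exist; apply: functional_extensionality_dep => c /=.
  exact: smap_eq.
Defined.

(* The map to the homotopy limit induced by a cone with vertex X. *)
Definition to_holim (C : cat) (D : sdiagram C) (X : sset)
  (t : forall c, smap X (D c))
  (tn : forall a b (u : hom a b) n (x : X n), t b n x = dmap D u n (t a n x)) :
  smap X (holim D).
Proof.
unshelve eexists.
- move=> m x.
  unshelve eexists.
  + move=> c; exists (fun n zd => t c n (sop (zd.2 : mono n m) x)) => p q s [z d] /=.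
    by rewrite -sfun_nat -sop_comp.
  + by move=> a b u n z d /=; apply: tn.
- move=> m n s x; apply: eq_exist; apply: functional_extensionality_dep => c.
  by apply: smap_eq => p [z d] /=; rewrite -sop_comp.
Defined.

Record psh (C : cat) := Psh {
  pobj :> C -> sset;
  pres : forall U V : C, hom U V -> smap (pobj V) (pobj U);
  pres_id : forall U n (x : pobj U n), pres (idm U) n x = x;
  pres_comp : forall U V W (f : hom V W) (g : hom U V) n (x : pobj W n),
    pres (comp f g) n x = pres g n (pres f n x) }.

Arguments pres {C} p {U V} _.

Record psh_map (C : cat) (F F' : psh C) := PshMap {
  pfun :> forall U, smap (F U) (F' U);
  pfun_nat : forall U V (f : hom U V) n (x : F V n),
    pfun U n (pres F f n x) = pres F' f n (pfun V n x) }.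

Definition obj_fibrant (C : cat) (F : psh C) : Prop := forall U, kan (F U).

Definition fibrant_replacement (C : cat) (F F' : psh C) (h : psh_map F F') : Prop :=
  obj_fibrant F' /\ forall U, weak_equiv (h U).

Definition loop_psh (C : cat) (F : psh C) (z : forall U, F U 0)
  (zn : forall U V (f : hom U V), pres F f 0 (z V) = z U) : psh C.
Proof.
unshelve eexists.
- exact: (fun U => loops (z U)).
- move=> U V f; unshelve eexists.
  + move=> n l; exists (smap_comp (pres F f) (sval l)).
    by move=> m x e /=; rewrite (svalP l) sfun_nat zn.
  + by move=> m n t l; apply: eq_exist; apply: smap_eq.
- by move=> U n [l h]; apply: eq_exist; apply: smap_eq => m x /=; rewrite pres_id.
- by move=> U V W f g n [l h]; apply: eq_exist; apply: smap_eq => m x /=; rewrite pres_comp.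
Defined.

Record site := Site {
  site_cat :> cat;
  covering : forall (X : site_cat) (I : Type) (U : I -> site_cat),
    (forall i, hom (U i) X) -> Prop }.

Section Cech.
Variables (C : cat) (X : C) (I : Type) (U : I -> C) (f : forall i, hom (U i) X).

(* A choice of the fibre products U_{i_0} x_X ... x_X U_{i_n}. *)
Record cech_nerve := CechNerve {
  cn : forall n, ('I_n.+1 -> I) -> C;
  cn_pr : forall n (i : 'I_n.+1 -> I) a, hom (cn i) (U (i a));
  cn_pr_eq : forall n (i : 'I_n.+1 -> I) a b,
    comp (f (i a)) (cn_pr i a) = comp (f (i b)) (cn_pr i b);
  cn_lift : forall n (i : 'I_n.+1 -> I) (T : C) (t : forall a, hom T (U (i a))),
    (forall a b, comp (f (i a)) (t a) = comp (f (i b)) (t b)) -> hom T (cn i);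
  cn_lift_pr : forall n (i : 'I_n.+1 -> I) T t e a,
    comp (cn_pr i a) (@cn_lift n i T t e) = t a;
  cn_uniq : forall n (i : 'I_n.+1 -> I) T (u v : hom T (cn i)),
    (forall a, comp (cn_pr i a) u = comp (cn_pr i a) v) -> u = v }.

Variable N : cech_nerve.

Definition cn_op m n (t : mono m n) (i : 'I_n.+1 -> I) :
    hom (cn N i) (cn N (fun a => i (t a))) :=
  @cn_lift N m (fun a => i (t a)) (cn N i) (fun a => cn_pr N i (t a))
    (fun a b => cn_pr_eq N i (t a) (t b)).

Definition cn_aug n (i : 'I_n.+1 -> I) : hom (cn N i) X :=
  comp (f (i ord0)) (cn_pr N i ord0).

Lemma cn_op_id n (i : 'I_n.+1 -> I) : cn_op (mono_id n) i = idm (cn N i).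
Proof.
apply: (@cn_uniq N n i) => a.
by rewrite comp_idr; apply: (@cn_lift_pr N n (fun a => i (mono_id n a))).
Qed.

Lemma cn_op_comp m n p (g : mono n p) (h : mono m n) (i : 'I_p.+1 -> I) :
  cn_op (mono_comp g h) i = comp (cn_op h (fun a => i (g a))) (cn_op g i).
Proof.
apply: (@cn_uniq N m (fun a => i (g (h a)))) => a.
rewrite comp_assoc.
rewrite (@cn_lift_pr N m (fun a => i (g (h a))) _ (fun a => cn_pr N (fun a => i (g a)) (h a))).
rewrite (@cn_lift_pr N m (fun a => i (mono_comp g h a))).
by rewrite (@cn_lift_pr N n (fun a => i (g a))).
Qed.

Lemma cn_aug_op m n (t : mono m n) (i : 'I_n.+1 -> I) :
  comp (cn_aug (fun a => i (t a))) (cn_op t i) = cn_aug i.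
Proof.
rewrite /cn_aug -comp_assoc (@cn_lift_pr N m (fun a => i (t a))).
exact: cn_pr_eq.
Qed.

Variable F : psh C.

Definition cech_diagram : sdiagram Delta.
Proof.
unshelve eexists.
- exact: (fun n : nat => sprod_fam (fun i : 'I_n.+1 -> I => F (cn N i))).
- move=> m n t; unshelve eexists.
  + exact: (fun p x i => pres F (cn_op t i) p (x (fun a => i (t a)))).
  + move=> p q s x; apply: functional_extensionality_dep => i /=.
    by rewrite sfun_nat.
- move=> n p x; apply: functional_extensionality_dep => i /=.
  by rewrite cn_op_id pres_id.
- move=> m n q g h p x; apply: functional_extensionality_dep => i /=.
  by rewrite cn_op_comp pres_comp.
Defined.

Definition cech_aug (n : nat) : smap (F X) (cech_diagram n).
Proof.
exists (fun p x i => pres F (cn_aug i) p x).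
by move=> p q s x; apply: functional_extensionality_dep => i /=; rewrite sfun_nat.
Defined.

Lemma cech_aug_nat (m n : Delta) (t : hom m n) p (x : F X p) :
  cech_aug n p x = dmap cech_diagram t p (cech_aug m p x).
Proof.
apply: functional_extensionality_dep => i /=.
by rewrite -pres_comp cn_aug_op.
Qed.

Definition cech_map : smap (F X) (holim cech_diagram) := to_holim cech_aug_nat.

End Cech.

Definition cech_descent_fibrant (S : site) (F : psh S) : Prop :=
  forall (X : S) (I : Type) (U : I -> S) (f : forall i, hom (U i) X),
    covering f -> forall N : cech_nerve f, weak_equiv (cech_map N F).

Definition cech_descent (S : site) (F : psh S) : Prop :=
  exists (F' : psh S) (h : psh_map F F'),
    fibrant_replacement h /\ cech_descent_fibrant F'.

Import GRing.Theory.
Local Open Scope ring_scope.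

(* Commutative k-algebras, the zero ring included. *)
Record kalg (k : fieldType) := KAlg {
  kring :> comPzRingType;
  kstr : {rmorphism k -> kring} }.

Record khom (k : fieldType) (A B : kalg k) := KHom {
  kfun :> {rmorphism A -> B};
  kfun_str : forall c, kfun (kstr A c) = kstr B c }.

Definition khom_id (k : fieldType) (A : kalg k) : khom A A :=
  @KHom k A A idfun (fun _ => erefl).

Definition khom_comp (k : fieldType) (A B C : kalg k) (g : khom B C) (f : khom A B) :
    khom A C :=
  @KHom k A C (g \o f)%FUN
    (fun c => etrans (congr1 g (kfun_str f c)) (kfun_str g c)).

Record kfunctor (k : fieldType) := KFunctor {
  pt :> kalg k -> Type;
  ap : forall A B, khom A B -> pt A -> pt B;
  ap_id : forall A (x : pt A), ap (khom_id A) x = x;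
  ap_comp : forall A B C (g : khom B C) (f : khom A B) (x : pt A),
    ap (khom_comp g f) x = ap g (ap f x) }.

Arguments ap {k} X {A B} _ _ : rename.

Record kmap (k : fieldType) (X Y : kfunctor k) := KMap {
  kmfun :> forall A, X A -> Y A;
  kmnat : forall A B (h : khom A B) (x : X A) (y : X B),
    ap X h x = y -> ap Y h (kmfun x) = kmfun y }.

Arguments kmfun {k X Y} _ {A} _.

Section Schemes.
Variable k : fieldType.
Implicit Types (A B R K L : kalg k) (X Y : kfunctor k).

Definition unit_ideal A (S : A -> Prop) : Prop :=
  exists n (s c : 'I_n -> A), (forall i, S (s i)) /\ \sum_i c i * s i = 1.

(* l exhibits B as the localization A_f. *)
Definition is_localization A B (l : khom A B) (f : A) : Prop :=
  [/\ exists b, l f * b = 1,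
      forall b, exists n a, l f ^+ n * b = l a
    & forall a, l a = 0 -> exists n, f ^+ n * a = 0].

(* The sheaf condition for the coverings Spec A = U_i D(f_i).  Compatibility on
   D(f_i) \cap D(f_j) is tested on all D-points over it. *)
Definition zariski_sheaf X : Prop :=
  forall A n (f : 'I_n -> A), unit_ideal (fun a => exists i, a = f i) ->
  forall (B : 'I_n -> kalg k) (l : forall i, khom A (B i)),
    (forall i, is_localization (l i) (f i)) ->
  forall x : forall i, X (B i),
    (forall i j D (u : khom (B i) D) (v : khom (B j) D),
       (forall a, u (l i a) = v (l j a)) -> ap X u (x i) = ap X v (x j)) ->
  exists! x0 : X A, forall i, ap X (l i) x0 = x i.

(* The preimage of U under every Spec A -> X is an open D(S) in Spec A. *)
Definition open_subfunctor X (U : forall A, X A -> Prop) : Prop :=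
  forall A (x : X A), exists S : A -> Prop, forall B (h : khom A B),
    U B (ap X h x) <-> unit_ideal (fun b => exists2 a, S a & b = h a).

(* U is isomorphic to Spec R, with universal point u. *)
Definition represented_by X (U : forall A, X A -> Prop) R (u : X R) : Prop :=
  U R u /\ forall A (x : X A), U A x -> exists! h : khom R A, ap X h u = x.

Definition is_field K : Prop :=
  (0 : K) <> 1 /\ forall a : K, a <> 0 -> exists b, a * b = 1.

Definition covered_by_affines (P : kalg k -> Prop) X : Prop :=
  forall K (x : X K), is_field K ->
  exists (U : forall A, X A -> Prop) R (u : X R),
    [/\ open_subfunctor U, represented_by U u, P R & U K x].

Definition is_scheme X : Prop :=
  zariski_sheaf X /\ covered_by_affines (fun _ => True) X.

Definition finitely_generated R : Prop :=
  exists n (g : 'I_n -> R), forall P : R -> Prop,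
    (forall c, P (kstr R c)) -> (forall i, P (g i)) ->
    (forall a b, P a -> P b -> P (a + b)) ->
    (forall a b, P a -> P b -> P (a * b)) -> forall a, P a.

(* The diagonal of X is a closed immersion. *)
Definition separated X : Prop :=
  forall A (x y : X A), exists S : A -> Prop, forall B (h : khom A B),
    ap X h x = ap X h y <-> (forall a, S a -> h a = 0).

(* Spec B -> Spec A is a closed immersion with ideal of square zero. *)
Definition thickening A B (h : khom A B) : Prop :=
  (forall b, exists a, h a = b) /\
  (forall a a' : A, h a = 0 -> h a' = 0 -> a * a' = 0).

Definition formally_smooth X : Prop :=
  forall A B (h : khom A B), thickening h ->
  forall y : X B, exists x : X A, ap X h x = y.

(* Locally of finite presentation is locally of finite type over a field. *)
Definition smooth X : Prop :=
  covered_by_affines finitely_generated X /\ formally_smooth X.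

(* Morphisms of schemes locally of finite type over k are locally of finite
   presentation; for them etale means formally etale. *)
Definition etale X Y (f : kmap X Y) : Prop :=
  forall A B (h : khom A B), thickening h ->
  forall (x : X B) (y : Y A), ap Y h y = f B x ->
  exists! z : X A, f A z = y /\ ap X h z = x.

(* The field-valued points x and y have the same underlying point of |X|. *)
Definition same_point X K (x : X K) L (y : X L) : Prop :=
  exists M (u : khom K M) (v : khom L M), is_field M /\ ap X u x = ap X v y.

(* x is the canonical map Spec kappa(p) -> X of its underlying point p. *)
Definition residue_point X K (x : X K) : Prop :=
  is_field K /\ forall L (y : X L), is_field L -> same_point x y ->
    exists! h : khom K L, ap X h x = y.

(* Etale, and every point p of Y is the image of a point of some U_i with the
   same residue field. *)
Definition nisnevich_covering Y (I : Type) (U : I -> kfunctor k)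
    (f : forall i, kmap (U i) Y) : Prop :=
  (forall i, etale (f i)) /\
  forall K (y : Y K), residue_point y ->
    exists i (x : U i K), residue_point x /\ f i K x = y.

End Schemes.

(* An action of the constant group scheme of G on a scheme is a homomorphism
   from G to its automorphism group. *)
Record gfunctor (k : fieldType) (G : finGroupType) := GFunctor {
  gf :> kfunctor k;
  act : forall A, G -> gf A -> gf A;
  act1 : forall A (x : gf A), act 1%g x = x;
  actM : forall A g h (x : gf A), act (g * h)%g x = act g (act h x);
  act_nat : forall A B (f : khom A B) g (x : gf A),
    ap gf f (act g x) = act g (ap gf f x) }.

Arguments act {k G} X {A} _ _ : rename.

Record gmap (k : fieldType) (G : finGroupType) (X Y : gfunctor k G) := GMap {
  gmf :> kmap X Y;
  gm_act : forall A g (x y : X A), act X g x = y -> act Y g (gmf A x) = gmf A y }.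

Section Equivariant.
Variables (k : fieldType) (G : finGroupType).
Implicit Types (X Y Z : gfunctor k G) (A B : kalg k).

Lemma kmap_eq (X Y : kfunctor k) (f g : kmap X Y) :
  (forall A (x : X A), f A x = g A x) -> f = g.
Proof.
case: f g => [f fn] [g gn] /= e.
have {}e : f = g by apply: functional_extensionality_dep => n; apply: funext.
by case: _ / e gn => gn; congr KMap; apply: Prop_irrelevance.
Qed.

Definition gmap_id X : gmap X X :=
  @GMap _ _ X X (@KMap k X X (fun _ x => x) (fun _ _ _ _ _ e => e))
    (fun _ _ _ _ e => e).

Definition gmap_comp X Y Z (g : gmap Y Z) (f : gmap X Y) : gmap X Z :=
  @GMap _ _ X Z
    (@KMap k X Z (fun A x => g A (f A x)) (fun _ _ _ _ _ e => kmnat g (kmnat f e)))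
    (fun _ _ _ _ e => gm_act g (gm_act f e)).

(* The points x such that Spec A, with trivial H-action, -> X is H-equivariant. *)
Definition fixed_cond X (H : {group G}) A (x : X A) : Prop :=
  forall h, h \in H -> act X h x = x.

Lemma fixed_cond_ap X (H : {group G}) A B (f : khom A B) (x : X A) :
  fixed_cond H x -> fixed_cond H (ap X f x).
Proof. by move=> hx h hH; rewrite -act_nat hx. Qed.

Lemma fixed_cond_map X Y (f : gmap X Y) (H : {group G}) A (x : X A) :
  fixed_cond H x -> fixed_cond H (f A x).
Proof. by move=> hx h hH; apply: gm_act; apply: hx. Qed.

Definition fixed X (H : {group G}) : kfunctor k.
Proof.
exists (fun A => {x : X A | fixed_cond H x})
  (fun A B f x => exist _ (ap X f (sval x)) (fixed_cond_ap f (svalP x))).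
- by move=> A [x h]; apply: eq_exist => /=; rewrite ap_id.
- by move=> A B C g f [x h]; apply: eq_exist => /=; rewrite ap_comp.
Defined.

Definition fixed_map X Y (f : gmap X Y) (H : {group G}) : kmap (fixed X H) (fixed Y H).
Proof.
exists (fun A x => exist _ (f A (sval x)) (fixed_cond_map f (svalP x))).
by move=> A B h x y e; apply: eq_exist => /=; apply: kmnat; rewrite -e.
Defined.

Record gsm := GSm {
  gsm_functor :> gfunctor k G;
  gsm_scheme : is_scheme gsm_functor;
  gsm_separated : separated gsm_functor;
  gsm_smooth : smooth gsm_functor }.

Definition gsm_cat : cat :=
  @Cat gsm (fun S T : gsm => gmap S T) (fun S : gsm => gmap_id S)
    (fun (S T V : gsm) g f => gmap_comp g f)
    (fun _ _ _ => erefl) (fun _ _ _ => erefl) (fun _ _ _ _ _ _ _ => erefl).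

Definition hnis_covering (S : gsm_cat) (I : Type) (U : I -> gsm_cat)
    (f : forall i, hom (U i) S) : Prop :=
  forall H : {group G}, nisnevich_covering (fun i => fixed_map (f i) H).

Definition hnis_site : site := @Site gsm_cat hnis_covering.

End Equivariant.

Definition semilinear (k : fieldType) (A B : kalg k) (h : khom A B)
    (M : lmodType A) (N : lmodType B) (u : M -> N) : Prop :=
  (forall m m', u (m + m') = u m + u m') /\ (forall a m, u (a *: m) = h a *: u m).

(* u induces an isomorphism from the extension of scalars of M along h to N. *)
Definition base_change (k : fieldType) (A B : kalg k) (h : khom A B)
    (M : lmodType A) (N : lmodType B) (u : M -> N) : Prop :=
  semilinear h u /\
  forall (P : lmodType B) (w : M -> P), semilinear h w ->
    exists2 v : {linear N -> P}, (forall m, v (u m) = w m) &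
      forall v' : {linear N -> P}, (forall m, v' (u m) = w m) -> forall n, v' n = v n.

(* qm x is the module of sections of the inverse image along x : Spec A -> X. *)
Record qcoh (k : fieldType) (X : kfunctor k) := QCoh {
  qm :> forall A, X A -> lmodType A;
  res : forall A B (h : khom A B) (x : X A) (y : X B), ap X h x = y -> qm x -> qm y;
  res_base_change : forall A B (h : khom A B) x y (e : ap X h x = y),
    base_change h (res e);
  res_id : forall A (x : X A) (e : ap X (khom_id A) x = x) (s : qm x), res e s = s;
  res_comp : forall A B C (g : khom B C) (f : khom A B) (x : X A) (y : X B) (z : X C)
    (e1 : ap X f x = y) (e2 : ap X g y = z) (e3 : ap X (khom_comp g f) x = z)
    (s : qm x), res e3 s = res e2 (res e1 s) }.

Arguments qm {k X} M {A} x : rename.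
Arguments res {k X} M {A B h x y} e s : rename.

(* G x X is the disjoint union of copies of X indexed by G, so that
   phi : alpha_X^* F -> pr_2^* F has components F(g x) -> F(x). *)
Record gqcoh (k : fieldType) (G : finGroupType) (X : gfunctor k G) := GQCoh {
  gq :> qcoh X;
  phi : forall A g (x y : X A), act X g x = y -> {linear gq A y -> gq A x};
  phi_bij : forall A g (x y : X A) (e : act X g x = y), bijective (phi e);
  phi_res : forall A B (h : khom A B) g (x y : X A) (x' y' : X B)
    (e : act X g x = y) (e' : act X g x' = y')
    (ex : ap X h x = x') (ey : ap X h y = y') (s : gq A y),
    phi e' (res gq ey s) = res gq ex (phi e s);
  phi_cocycle : forall A g h (x y z : X A)
    (e1 : act X h x = y) (e2 : act X g y = z) (e3 : act X (g * h)%g x = z)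
    (s : gq A z), phi e1 (phi e2 s) = phi e3 s }.

Arguments phi {k G X} M {A g x y} e : rename.

(* There are f_i generating the unit ideal such that V_{f_i} is free of finite
   rank over A_{f_i}. *)
Definition module_locally_free (k : fieldType) (A : kalg k) (V : lmodType A) : Prop :=
  exists n (f : 'I_n -> A),
    unit_ideal (fun a => exists i, a = f i) /\
    forall i, exists (B : kalg k) (l : khom A B),
      is_localization l (f i) /\
      exists r (u : V -> 'rV[B]_r), base_change l u.

(* Schemes in gsm are locally noetherian, so that locally free coherent means
   locally free of finite rank. *)
Record bundle (k : fieldType) (G : finGroupType) (X : gfunctor k G) := Bundle {
  bq :> gqcoh X;
  bundle_free : forall A (x : X A), module_locally_free (bq A x) }.

Record bmor (k : fieldType) (G : finGroupType) (X : gfunctor k G) (M N : bundle X) :=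
  BMor {
  bf :> forall A (x : X A), {linear M A x -> N A x};
  bf_res : forall A B (h : khom A B) x y (e : ap X h x = y) s,
    bf y (res M e s) = res N e (bf x s);
  bf_phi : forall A g (x y : X A) (e : act X g x = y) s,
    bf x (phi M e s) = phi N e (bf y s) }.

Arguments bf {k G X M N} _ {A} _.

Section Bundles.
Variables (k : fieldType) (G : finGroupType).
Implicit Types (X Y Z : gfunctor k G).

(* Exactness of sequences of vector bundles is preserved by every base change,
   hence can be read off on all affine points. *)
Definition short_exact X (M' M M'' : bundle X) (i : bmor M' M) (p : bmor M M'') : Prop :=
  forall A (x : X A),
    [/\ injective (i A x), forall t, exists s, p A x s = t
      & forall s, p A x s = 0 <-> exists t, i A x t = s].

Definition adm_mono X (M' M : bundle X) (i : bmor M' M) : Prop :=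
  exists M'' (p : bmor M M''), short_exact i p.

Definition adm_epi X (M M'' : bundle X) (p : bmor M M'') : Prop :=
  exists M' (i : bmor M' M), short_exact i p.

Definition bmor_id X (M : bundle X) : bmor M M :=
  @BMor _ _ _ M M (fun A x => idfun) (fun _ _ _ _ _ _ _ => erefl)
    (fun _ _ _ _ _ _ => erefl).

Lemma zero_base_change A B (h : khom A B) :
  @base_change k A B h 'rV[A]_0 'rV[B]_0 (fun _ => 0).
Proof.
split; first by split=> *; rewrite ?addr0 ?scaler0.
move=> P w [_ wZ]; exists \0%R => [m|v' _ n] /=.
  by rewrite (thinmx0 m); have := wZ 0 0; rewrite scaler0 rmorph0 scale0r.
by rewrite (thinmx0 n) linear0.
Qed.

Definition zero_qcoh X : qcoh X.
Proof.
apply: (@QCoh k X (fun A _ => ('rV[A]_0 : lmodType A))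
  (fun A B h x y e s => (0 : 'rV[B]_0))).
- by move=> *; apply: zero_base_change.
- by move=> A x e s; rewrite (thinmx0 s).
- by [].
Defined.

Definition zero_gqcoh X : gqcoh X.
Proof.
exists (zero_qcoh X) (fun _ _ _ _ _ => idfun) => //=.
by move=> A g x y e; exists id.
Defined.

Lemma zero_free A : @module_locally_free k A 'rV[A]_0.
Proof.
exists 1%N, (fun _ => 1); split.
  exists 1%N, (fun _ => 1), (fun _ => 1); split; first by move=> _; exists ord0.
  by rewrite big_ord1 mulr1.
move=> _; exists A, (khom_id A); split; last first.
  by exists 0%N, (fun _ => 0); apply: zero_base_change.
split.
- by exists 1; rewrite mulr1.
- by move=> b; exists 0%N, b; rewrite mul1r.
- by move=> a e; exists 0%N; rewrite mul1r.
Qed.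

Definition zero_bundle X : bundle X := @Bundle _ _ X (zero_gqcoh X) (fun A _ => zero_free A).

Definition to_zero X (M : bundle X) : bmor M (zero_bundle X) :=
  @BMor _ _ _ M (zero_bundle X) (fun _ _ => \0%R) (fun _ _ _ _ _ _ _ => erefl)
    (fun _ _ _ _ _ _ => erefl).

Definition from_zero X (M : bundle X) : bmor (zero_bundle X) M.
Proof.
exists (fun _ _ => \0%R).
- move=> A B h x y e s /=.
  have [[_ rZ] _] := res_base_change M e.
  by have := rZ 0 0; rewrite scaler0 rmorph0 scale0r.
- by move=> A g x y e s /=; rewrite linear0.
Defined.

Lemma bmor_id_mono X (M : bundle X) : adm_mono (bmor_id M).
Proof.
exists (zero_bundle X), (to_zero M) => A x; split.
- by [].
- by move=> t; exists 0; rewrite (thinmx0 t).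
- by move=> s; split=> // _; exists s.
Qed.

Lemma bmor_id_epi X (M : bundle X) : adm_epi (bmor_id M).
Proof.
exists (zero_bundle X), (from_zero M) => A x; split.
- by move=> s t _; rewrite (thinmx0 s) (thinmx0 t).
- by move=> t; exists t.
- by move=> s /=; split=> [->|[_ <-]]; first exists 0.
Qed.

Record span X (M N : bundle X) := Span {
  apex : bundle X;
  sq : bmor apex M;
  si : bmor apex N;
  sq_adm : adm_epi sq;
  si_adm : adm_mono si }.

Definition span_iso X (M N : bundle X) (s t : span M N) : Prop :=
  exists u : bmor (apex s) (apex t),
    forall A (x : X A),
      [/\ bijective (u A x), forall m, sq t A x (u A x m) = sq s A x m
        & forall m, si t A x (u A x m) = si s A x m].

(* A morphism M -> N of QP(G,X): an isomorphism class of spans. *)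
Definition qmor X (M N : bundle X) :=
  {S : span M N -> Prop | exists s, S = span_iso s}.

Definition span_id X (M : bundle X) : span M M :=
  Span (bmor_id_epi M) (bmor_id_mono M).

Definition qmor_id X (M : bundle X) : qmor M M :=
  exist _ (span_iso (span_id M)) (ex_intro _ _ erefl).

(* R is the composite of T after S: the apex of R is the fibre product of those
   of S and T.  Fibre products along admissible epimorphisms commute with base
   change, hence can be read off on all affine points. *)
Definition qmor_comp X (M N P : bundle X) (T : qmor N P) (S : qmor M N) (R : qmor M P) :
    Prop :=
  exists s t r, [/\ sval S s, sval T t, sval R r
    & exists (a : bmor (apex r) (apex s)) (b : bmor (apex r) (apex t)),
      forall A (x : X A),
      [/\ forall m, si s A x (a A x m) = sq t A x (b A x m),
          forall m n, si s A x m = sq t A x n ->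
            exists! l, a A x l = m /\ b A x l = n,
          forall m, sq r A x m = sq s A x (a A x m)
        & forall m, si r A x m = si t A x (b A x m)]].

(* The n-simplices of the nerve: functors [n] -> QP(G,X). *)
Record qchain X (n : nat) := QChain {
  qo : 'I_n.+1 -> bundle X;
  qarr : forall i j : 'I_n.+1, (i <= j)%N -> qmor (qo i) (qo j);
  qarr_id : forall (i : 'I_n.+1) (e : (i <= i)%N), qarr e = qmor_id (qo i);
  qarr_comp : forall (i j l : 'I_n.+1) (e1 : (i <= j)%N) (e2 : (j <= l)%N) (e3 : (i <= l)%N),
    qmor_comp (qarr e2) (qarr e1) (qarr e3) }.

Definition BQP_obj X : sset :=
  @SSet (qchain X)
    (fun m n t c => @QChain X m (fun i => qo c (t i))
       (fun i j e => qarr c (mono_le t e))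
       (fun i e => qarr_id c (mono_le t e))
       (fun i j l e1 e2 e3 => qarr_comp c (mono_le t e1) (mono_le t e2) (mono_le t e3)))
    (fun _ _ => erefl) (fun _ _ _ _ _ _ => erefl).

Definition pull_qcoh (X Y : kfunctor k) (f : kmap X Y) (M : qcoh Y) : qcoh X :=
  @QCoh k X (fun A x => qm M (f A x))
    (fun A B h x y e => res M (kmnat f e))
    (fun A B h x y e => res_base_change M (kmnat f e))
    (fun A x e => res_id (kmnat f e))
    (fun A B C g h x y z e1 e2 e3 =>
       res_comp (kmnat f e1) (kmnat f e2) (kmnat f e3)).

Definition pull_gqcoh X Y (f : gmap X Y) (M : gqcoh Y) : gqcoh X :=
  @GQCoh k G X (pull_qcoh f M)
    (fun A g x y e => phi M (gm_act f e))
    (fun A g x y e => phi_bij M (gm_act f e))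
    (fun A B h g x y x' y' e e' ex ey =>
       phi_res (gm_act f e) (gm_act f e') (kmnat f ex) (kmnat f ey))
    (fun A g h x y z e1 e2 e3 =>
       phi_cocycle (gm_act f e1) (gm_act f e2) (gm_act f e3)).

Definition pull X Y (f : gmap X Y) (M : bundle Y) : bundle X :=
  @Bundle k G X (pull_gqcoh f M) (fun A x => @bundle_free _ _ _ M A (f A x)).

Definition pull_bmor X Y (f : gmap X Y) (M N : bundle Y) (u : bmor M N) :
    bmor (pull f M) (pull f N) :=
  @BMor k G X (pull f M) (pull f N) (fun A x => u A (f A x))
    (fun A B h x y e => bf_res u (kmnat f e))
    (fun A g x y e => bf_phi u (gm_act f e)).

Lemma pull_mono X Y (f : gmap X Y) (M N : bundle Y) (u : bmor M N) :
  adm_mono u -> adm_mono (pull_bmor f u).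
Proof. by case=> C [p h]; exists (pull f C), (pull_bmor f p) => A x; apply: h. Qed.

Lemma pull_epi X Y (f : gmap X Y) (M N : bundle Y) (u : bmor M N) :
  adm_epi u -> adm_epi (pull_bmor f u).
Proof. by case=> C [p h]; exists (pull f C), (pull_bmor f p) => A x; apply: h. Qed.

Definition pull_span X Y (f : gmap X Y) (M N : bundle Y) (s : span M N) :
    span (pull f M) (pull f N) :=
  Span (pull_epi f (sq_adm s)) (pull_mono f (si_adm s)).

Lemma span_iso_refl X (M N : bundle X) (s : span M N) : span_iso s s.
Proof. by exists (bmor_id _) => A x; split=> //; exists id. Qed.

Lemma span_iso_trans X (M N : bundle X) (s t r : span M N) :
  span_iso s t -> span_iso t r -> span_iso s r.
Proof.
move=> [u hu] [v hv].
unshelve eexists.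
- apply: (@BMor _ _ _ _ _ (fun A x => (v A x \o u A x)%FUN)).
  + by move=> A B h x y e m /=; rewrite !bf_res.
  + by move=> A g x y e m /=; rewrite !bf_phi.
- move=> A x; have [bu u1 u2] := hu A x; have [bv v1 v2] := hv A x.
  split=> [|m|m] /=; first exact: bij_comp.
  + by rewrite v1 u1.
  + by rewrite v2 u2.
Qed.

Lemma pull_span_iso X Y (f : gmap X Y) (M N : bundle Y) (s t : span M N) :
  span_iso s t -> span_iso (pull_span f s) (pull_span f t).
Proof. by case=> u hu; exists (pull_bmor f u) => A x; apply: hu. Qed.

(* The class of the inverse images of the spans in S. *)
Definition pull_class X Y (f : gmap X Y) (M N : bundle Y) (S : span M N -> Prop)
    (t : span (pull f M) (pull f N)) : Prop :=
  exists2 s, S s & span_iso (pull_span f s) t.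

Arguments pull_class {X Y} f {M N} S t.

Lemma pull_classE X Y (f : gmap X Y) (M N : bundle Y) (s : span M N) :
  pull_class f (span_iso s) = span_iso (pull_span f s).
Proof.
apply: funext => t; apply: propext; split=> [[r sr rt]|st].
- exact: span_iso_trans (pull_span_iso f sr) rt.
- by exists s => //; apply: span_iso_refl.
Qed.

Lemma pull_classP X Y (f : gmap X Y) (M N : bundle Y) (S : qmor M N) :
  exists s, pull_class f (sval S) = span_iso s.
Proof. by case: S => S [s e]; rewrite /= e; exists (pull_span f s); apply: pull_classE. Qed.

Definition pull_qmor X Y (f : gmap X Y) (M N : bundle Y) (S : qmor M N) :
    qmor (pull f M) (pull f N) :=
  exist _ (pull_class f (sval S)) (pull_classP f S).

Lemma pull_span_id X Y (f : gmap X Y) (M : bundle Y) :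
  span_iso (pull_span f (span_id M)) = span_iso (span_id (pull f M)).
Proof.
apply: funext => t; apply: propext; split.
- by case=> u hu; exists u.
- by case=> u hu; exists u.
Qed.

Lemma pull_qmor_id X Y (f : gmap X Y) (M : bundle Y) :
  pull_qmor f (qmor_id M) = qmor_id (pull f M).
Proof. by apply: eq_exist; rewrite /= pull_classE pull_span_id. Qed.

Lemma pull_qmor_comp X Y (f : gmap X Y) (M N P : bundle Y)
    (T : qmor N P) (S : qmor M N) (R : qmor M P) :
  qmor_comp T S R -> qmor_comp (pull_qmor f T) (pull_qmor f S) (pull_qmor f R).
Proof.
case=> s [t [r [hs ht hr [a [b h]]]]].
exists (pull_span f s), (pull_span f t), (pull_span f r); split.
- by exists s => //; apply: span_iso_refl.
- by exists t => //; apply: span_iso_refl.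
- by exists r => //; apply: span_iso_refl.
- by exists (pull_bmor f a), (pull_bmor f b) => A x; apply: h.
Qed.

Lemma qmor_eq X (M N : bundle X) (S T : qmor M N) : sval S = sval T -> S = T.
Proof. by case: S T => [S hS] [T hT] /= e; apply: eq_exist. Qed.

Definition pull_qchain X Y (f : gmap X Y) n (c : qchain Y n) : qchain X n :=
  @QChain X n (fun i => pull f (qo c i))
    (fun i j e => pull_qmor f (qarr c e))
    (fun i e => etrans (congr1 (@pull_qmor X Y f _ _) (qarr_id c e)) (pull_qmor_id f (qo c i)))
    (fun i j l e1 e2 e3 => pull_qmor_comp f (qarr_comp c e1 e2 e3)).

Lemma qchain_eq X n (o : 'I_n.+1 -> bundle X)
    (q q' : forall i j : 'I_n.+1, (i <= j)%N -> qmor (o i) (o j)) h1 h2 h1' h2' :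
  (forall i j e, q i j e = q' i j e) ->
  @QChain X n o q h1 h2 = @QChain X n o q' h1' h2'.
Proof.
move=> e; have {}e : q = q'.
  by do 3! (apply: functional_extensionality_dep => ?); apply: e.
by case: _ / e h1' h2' => h1' h2'; congr QChain; apply: Prop_irrelevance.
Qed.

Lemma pull_qchain_id X n (c : qchain X n) : pull_qchain (gmap_id X) c = c.
Proof.
apply: (@qchain_eq X n (qo c)) => i j e; apply: (@qmor_eq X (qo c i) (qo c j)) => /=.
have [s ->] := svalP (qarr c e).
exact: (pull_classE (gmap_id X) s).
Qed.

Lemma pull_qchain_comp X Y Z (g : gmap Y Z) (f : gmap X Y) n (c : qchain Z n) :
  pull_qchain (gmap_comp g f) c = pull_qchain f (pull_qchain g c).
Proof.
apply: (@qchain_eq X n (fun i => pull (gmap_comp g f) (qo c i))) => i j e.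
apply: (@qmor_eq X (pull (gmap_comp g f) (qo c i)) (pull (gmap_comp g f) (qo c j))) => /=.
have [s ->] := svalP (qarr c e).
rewrite (pull_classE g s) (pull_classE f).
exact: (pull_classE (gmap_comp g f) s).
Qed.

Definition pull_nerve X Y (f : gmap X Y) : smap (BQP_obj Y) (BQP_obj X).
Proof.
exists (fun n (c : BQP_obj Y n) => (pull_qchain f c : BQP_obj X n)).
by move=> m n t c; apply: qchain_eq.
Defined.

Definition BQP : psh (gsm_cat k G) :=
  @Psh (gsm_cat k G) (fun S : gsm k G => BQP_obj S)
    (fun S T f => pull_nerve f)
    (fun S n c => pull_qchain_id c)
    (fun S T V g f n c => pull_qchain_comp g f c).

Lemma zero_chain_comp X (M : bundle X) : qmor_comp (qmor_id M) (qmor_id M) (qmor_id M).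
Proof.
exists (span_id M), (span_id M), (span_id M); split; try exact: span_iso_refl.
exists (bmor_id M), (bmor_id M) => A x; split=> //= m n mn.
by exists m; split=> // l [].
Qed.

Definition zero_chain X : qchain X 0 :=
  @QChain X 0 (fun _ => zero_bundle X) (fun _ _ _ => qmor_id (zero_bundle X))
    (fun _ _ => erefl) (fun _ _ _ _ _ _ => zero_chain_comp (zero_bundle X)).

Lemma pull_zero_chain X Y (f : gmap X Y) : pull_qchain f (zero_chain Y) = zero_chain X.
Proof.
apply: (@qchain_eq X 0 (fun _ => zero_bundle X)) => i j e.
apply: eq_exist; rewrite /= pull_classE.
apply: funext => t; apply: propext; split.
- by case=> u hu; exists u.
- by case=> u hu; exists u.
Qed.

Section KTheory.
Variables (F : psh (gsm_cat k G)) (h : psh_map BQP F).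

Definition zero_pt (S : gsm_cat k G) : F S 0 := h S 0 (zero_chain S).

Lemma zero_pt_nat (S T : gsm_cat k G) (f : hom S T) :
  pres F f 0 (zero_pt T) = zero_pt S.
Proof. by rewrite /zero_pt -pfun_nat /= pull_zero_chain. Qed.

(* K(G,-) = Omega BQP(G,-), the loop space being formed at 0 in an objectwise
   fibrant replacement h of BQP(G,-). *)
Definition equivariant_K : psh (gsm_cat k G) := loop_psh zero_pt_nat.

End KTheory.

End Bundles.

Arguments BQP : clear implicits.

(* Main.v *)
(* Schemes in GSm/k need not be quasi-compact, and descent already fails for a
   Zariski covering by infinitely many affine G-schemes.

   Let n = |G| > 1, let s be a generic n x n matrix whose rows are permuted by
   the regular representation of G, and let d(s) = det(s)^2, which is invariant.
   Put U = {(s, y)} and W = {(s, e, c) | d(s) e = 1}, and glue charts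
   f_i : U -> X, i >= 0, along the maps j_i : W -> U, (s, e, c) |-> (s, (c - i) e).
   The origin x0 = (0, 0) of U is fixed by G, and since char k = 0 the number
   dim (M_x0)^G is additive in the bundle M, so it defines a label K_0(G, U) -> Z.

   For a class on X the labels of its inverse images under the f_i are bounded:
   dim (M_{f_i(x0)})^G is at most the rank of M at f_i(x0), and the points f_i(x0)
   are all joined by affine lines to one point of W.

   Let P_m be the trivial bundle of m x n matrices v with G permuting the columns
   of v, and Q_m the same bundle with trivial action.  The class [P_m] - [Q_m] on
   U has label m - m n, but it vanishes on W, where v |-> v s is an equivariant
   isomorphism P_m -> Q_m.  Hence the classes [P_i] - [Q_i] on the i-th charts
   glue to a point of the homotopy limit; its labels are unbounded, so it does not
   come from X.  Labels and their boundedness are maps to discrete simplicial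
   sets, which are Kan complexes, so that weak equivalences respect them. *)

From HB Require Import structures.
From mathcomp Require Import all_boot all_order all_algebra all_fingroup.
From mathcomp Require Import boolp ring zify.
Require Import Defs.

Set Implicit Arguments.
Unset Strict Implicit.
Unset Printing Implicit Defensive.

Import GRing.Theory.

(** * Discrete simplicial sets and nerves of abelian groups *)

(** [equivariant_K] is built from an arbitrary fibrant replacement F of BQP(G,-), whose simplices
    are inaccessible: only maps into Kan complexes carry information from BQP to F. A label of
    bundles is therefore made a map from BQP to the nerve of a group of functions I -> Z. It extends
    to F up to a coboundary, and a coboundary vanishes on loops. The bound that is uniform in the
    chart crosses to F by the same device, with the nerve of the group of bounded sequences. Gluing
    is cheap because all pairwise intersections are the same W: paths from the restrictions of the
    classes to one common vertex leave no higher coherence to be arranged. The shifts c - i are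
    chosen so that m + d(s) y = n + d(s) y' with m <> n makes d(s) a unit, which confines the
    meeting of two charts to W. Characteristic 0 enters twice: the differences m - n are inverted,
    and vectors are averaged over G. *)

Lemma eq_mono m n (s t : mono m n) : (forall i, s i = t i) -> s = t.
Proof.
case: s t => [s hs] [t ht] /= e.
have {}e : s = t by apply: funext.
by case: _ / e ht => ht; congr Mono; apply: Prop_irrelevance.
Qed.

Lemma sop_eq (X : sset) m n (s t : mono m n) (x : X n) :
  (forall i, s i = t i) -> sop s x = sop t x.
Proof. by move=> /eq_mono ->. Qed.

Lemma sop_const (X : sset) m n p (t : mono n p) (a : 'I_n.+1) (x : X p) :
  sop (mono_const m a) (sop t x) = sop (mono_const m (t a)) x.
Proof. by rewrite -sop_comp; apply: sop_eq. Qed.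

Definition face n (j : 'I_n.+2) : mono n n.+1.
Proof.
by exists (fun i => lift j i) => i i' e; rewrite leq_bump2.
Defined.

Lemma face_factor n (j : 'I_n.+2) m (t : mono m n.+1) :
  (forall i, t i <> j) -> exists t' : mono m n, t = mono_comp (face j) t'.
Proof.
move=> h.
have /choice [t' ht'] : forall i, exists i', t i = lift j i'.
  by move=> i; case: (unliftP j (t i)) => [i' ->|/h//]; exists i'.
unshelve eexists.
- by exists t' => i i' e; move: (mono_le t e); rewrite !ht' leq_bump2.
- exact: eq_mono.
Qed.

Lemma in_horn_face n (k j : 'I_n.+2) : j <> k -> in_horn k (face j).
Proof.
move=> jk; exists j => // i /esym/eqP; apply/negP; exact: neq_lift.
Qed.

Definition face_horn n (k j : 'I_n.+2) (jk : j <> k) : horn k n :=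
  exist _ (face j) (in_horn_face jk).

Lemma horn_factor n (k : 'I_n.+2) m (t : horn k m) :
  exists j (jk : j <> k) (u : mono m n), t = sop u (face_horn jk).
Proof.
case: t => t [j jk h]; have [u e] := face_factor h.
by exists j, jk, u; apply: eq_exist.
Qed.

(** There are at least two vertices, so some face omits another vertex than k. This vertex is the
    one at which maps from a horn to a discrete set are read off. *)
Lemma horn_point n (k : 'I_n.+2) : in_horn k (mono_const 0 k).
Proof.
case: (pickP (predC1 k)) => [j /eqP jk|h]; first by exists j => // i /esym.
have /negbFE/eqP <- := h ord_max; have /negbFE/eqP/(congr1 val) := h ord0.
by have /negbFE/eqP <- := h ord_max.
Qed.

Definition mono_pair n (a b : 'I_n.+1) (ab : a <= b) : mono 1 n.
Proof.
exists (fun i : 'I_2 => if i == ord0 then a else b) => i j ij.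
case: eqP => [_|i0]; first by case: eqP.
case: eqP => [j0|//]; case: i0; apply: val_inj.
by move: ij; rewrite j0 leqn0 => /eqP.
Defined.

(** For k = 1 and k = 0 these are the two codegeneracies [2] -> [1]; paired in both orders they give
    the two triangles of the square [1] x [1]. *)
Definition mono_drop (k : nat) : mono 2 1.
Proof. by exists (fun i : 'I_3 => inord (k < i)) => i j ij; rewrite !inordK; lia. Defined.

Definition disc (T : Type) : sset :=
  @SSet (fun _ => T) (fun _ _ _ x => x) (fun _ _ => erefl) (fun _ _ _ _ _ _ => erefl).

(** Every face opposite to some j <> k contains the vertex k, so a map from the horn to a discrete
    set has one value throughout, the one at k. *)
Lemma disc_kan T : kan (disc T).
Proof.
move=> n k h; exists (h 0 (exist _ _ (horn_point k))) => m t /=.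
have [j [jk [u ->]]] := horn_factor t.
have [k' ek] : exists k' : 'I_n.+1, lift j k' = k.
  by case: (unliftP j k) jk => [k' ->|->] // _; exists k'.
rewrite (sfun_nat h) /=.
rewrite -[RHS]/(sop (mono_const 0 k') (h n (face_horn jk))) -(sfun_nat h).
by congr (h 0 _); apply: eq_exist; apply: eq_mono => i /=; rewrite ek.
Qed.

(** Over a single vertex of x the homotopy is an edge of a discrete set, so its two ends agree. *)
Lemma homotopic_disc X T (f g : smap X (disc T)) :
  homotopic f g -> forall n (x : X n), f n x = g n x.
Proof.
move=> [H hH] n x; have [<- _] := hH n x; have [_ <-] := hH n x.
rewrite -[LHS]/(sop (mono_const 0 ord0) (H n (x, mono_const n ord0))).
rewrite -[RHS]/(sop (mono_const 0 ord0) (H n (x, mono_const n ord_max))).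
rewrite -!(sfun_nat H) /=.
set y := sop _ x.
pose E : sprod X (std 1) 1 := (sop (mono_const 1 (ord0 : 'I_1)) y, mono_id 1).
transitivity (H 1 E).
  rewrite -[RHS]/(sop (mono_const 0 (ord0 : 'I_2)) (H 1 E)) -(sfun_nat H) /=.
  by congr (H 0 (_, _)); rewrite -sop_comp -[LHS]sop_id; apply: sop_eq => i; rewrite [i]ord1.
rewrite -[LHS]/(sop (mono_const 0 (ord_max : 'I_2)) (H 1 E)) -(sfun_nat H) /=.
by congr (H 0 (_, _)); rewrite -sop_comp -[RHS]sop_id; apply: sop_eq => i; rewrite [i]ord1.
Qed.

Lemma homotopic_refl X Y (f : smap X Y) : homotopic f f.
Proof.
by exists (@SMap (sprod X (std 1)) Y (fun n x => f n x.1)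
  (fun m n t (x : sprod X (std 1) n) => sfun_nat f t x.1)).
Qed.

Lemma weak_equiv_disc X Y T (f : smap X Y) (v w : smap Y (disc T)) :
  weak_equiv f -> (forall n (x : X n), v n (f n x) = w n (f n x)) ->
  forall n (y : Y n), v n y = w n y.
Proof.
move=> we e; have [_ inj] := we _ (@disc_kan T).
apply: homotopic_disc; apply: inj.
suff -> : smap_comp v f = smap_comp w f by apply: homotopic_refl.
exact: smap_eq.
Qed.

Lemma weak_equiv_disc_ext X Y T (f : smap X Y) (u : smap X (disc T)) :
  weak_equiv f -> exists v : smap Y (disc T), forall n (x : X n), v n (f n x) = u n x.
Proof.
move=> we; have [ext _] := we _ (@disc_kan T).
have [v hv] := ext u; exists v => n x.
exact: (homotopic_disc hv).
Qed.

Ltac ord_cases j := case: j => [[|[|[|//]]] //= ?]; rewrite -?val_eqE /= ?inordK.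

Section AbelianNerve.
Variable I : Type.
Local Open Scope ring_scope.

Definition subgroup_pred (S : (I -> int) -> Prop) : Prop :=
  S (fun=> 0) /\ forall u v, S u -> S v -> S (fun i => u i - v i).

Definition cocycle n (f : 'I_n.+1 -> 'I_n.+1 -> I -> int) : Prop :=
  forall a b c i, f a c i = f a b i + f b c i.

Lemma cocycle_diag n f (a : 'I_n.+1) i : cocycle f -> f a a i = 0.
Proof. by move=> /(_ a a a i) /eqP; rewrite -subr_eq subrr => /eqP. Qed.

Lemma cocycle_opp n f (a b : 'I_n.+1) i : cocycle f -> f b a i = - f a b i.
Proof.
move=> h; apply/eqP; rewrite -addr_eq0 addrC -h; apply/eqP; exact: cocycle_diag.
Qed.

Lemma cocycle_comp (S : (I -> int) -> Prop) m n (t : mono m n) (f : 'I_n.+1 -> 'I_n.+1 -> I -> int) :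
  cocycle f /\ (forall a b, S (f a b)) ->
  cocycle (fun a b => f (t a) (t b)) /\ (forall a b, S (f (t a) (t b))).
Proof. by case=> fc fS; split=> [a b c i|a b]; [apply: fc | apply: fS]. Qed.

(* Edge labels are indexed by all pairs of vertices, so that no order has to be
   respected. *)
Definition abnerve (S : (I -> int) -> Prop) : sset.
Proof.
exists (fun n => {f : 'I_n.+1 -> 'I_n.+1 -> I -> int | cocycle f /\ forall a b, S (f a b)})
  (fun m n (t : mono m n) f =>
     exist _ (fun a b => sval f (t a) (t b)) (cocycle_comp t (svalP f))).
- by move=> n [f h]; apply: eq_exist.
- by move=> m n p t s [f h]; apply: eq_exist.
Defined.

Definition abcell S n (f : 'I_n.+1 -> 'I_n.+1 -> I -> int) (fc : cocycle f)
  (fS : forall a b, S (f a b)) : abnerve S n := exist _ f (conj fc fS).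

Lemma abnerve_eq S n (f g : abnerve S n) :
  (forall a b i, sval f a b i = sval g a b i) -> f = g.
Proof.
case: f g => [f hf] [g hg] /= e; apply: eq_exist.
by apply: funext => a; apply: funext => b; apply: funext => i.
Qed.

(** The two faces share an edge, but it is a 1-simplex of the horn only with its vertices in
    increasing order; antisymmetry of cocycles settles the other orientation. *)
Lemma abnerve_horn_edge S n (k : 'I_n.+2) (h : smap (horn k) (abnerve S))
    l l' (lk : l <> k) (lk' : l' <> k) (a b a' b' : 'I_n.+1) i :
  lift l a = lift l' a' -> lift l b = lift l' b' ->
  sval (h n (face_horn lk)) a b i = sval (h n (face_horn lk')) a' b' i.
Proof.
wlog ab : a b a' b' / (a <= b)%N.
  move=> hw ea eb; have [ab|/ltnW ba] := leqP a b; first exact: hw.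
  rewrite (cocycle_opp b a _ (svalP (h n _)).1) (cocycle_opp b' a' _ (svalP (h n _)).1).
  by rewrite (hw b a b' a').
move=> ea eb; have ab' : (a' <= b')%N by rewrite -(leq_bump2 l') -[bump l' a']/(val (lift l' a')) -ea -[bump l' b']/(val (lift l' b')) -eb leq_bump2.
have e : sop (mono_pair ab) (face_horn lk) = sop (mono_pair ab') (face_horn lk').
  by apply: eq_exist; apply: eq_mono => j /=; case: ifP.
have := congr1 (fun x => sval (h 1 x) ord0 ord_max i) e.
by rewrite !sfun_nat.
Qed.

(** The filler is the coboundary of c, where c j is the label from k to j read in any face of the
    horn containing both vertices. It has values in S because S is closed under differences. *)
Lemma abnerve_kan S : subgroup_pred S -> kan (abnerve S).
Proof.
move=> [S0 SB] n k h.
have /choice [c hc] : forall j, exists v, S v /\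
    forall l (lk : l <> k) k' j', lift l k' = k -> lift l j' = j ->
    forall i, sval (h n (face_horn lk)) k' j' i = v i.
  move=> j; have [[l [lk [k' [j' [ek ej]]]]]|no] :=
    pselect (exists l (lk : l <> k) k' j', lift l k' = k /\ lift l j' = j).
    exists (sval (h n (face_horn lk)) k' j'); split; first exact: (svalP (h n _)).2.
    by move=> l1 lk1 k1 j1 ek1 ej1 i; apply: abnerve_horn_edge; congruence.
  (* This happens only for a horn in Delta^1, whose single face misses j; the label is then a free
     choice. *)
  by exists (fun=> 0); split=> // l lk k' j' ek ej; case: no; exists l, lk, k', j'.
have cc : cocycle (fun (a b : 'I_n.+2) i => c b i - c a i) by move=> a b d i; ring.
have cS a b : S (fun i => c b i - c a i) by apply: SB; [apply: (hc b).1 | apply: (hc a).1].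
exists (abcell cc cS) => m t; apply: abnerve_eq => a b i /=.
have [l [lk [u ->]]] := horn_factor t; rewrite sfun_nat /=.
have [k' ek] : exists k', lift l k' = k.
  by case: (unliftP l k) lk => [k' ->|->] // _; exists k'.
rewrite ((svalP (h n (face_horn lk))).1 _ k') (cocycle_opp _ _ _ (svalP (h n _)).1).
by rewrite ((hc (lift l (u a))).2 l lk k' (u a)) // ((hc (lift l (u b))).2 l lk k' (u b)) // addrC.
Qed.

Section Homotopy.
Variables (S : (I -> int) -> Prop) (X : sset) (H : smap (sprod X (std 1)) (abnerve S)).

Definition track (x : X 0) : I -> int :=
  sval (H 1 (sop (mono_const 1 (ord0 : 'I_1)) x, mono_id 1)) ord0 ord_max.

(** The square swept out by the edge ab of x consists of the triangles [K1] and [K2] with a common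
    diagonal. Equating the two expressions for the label of the diagonal shows that g - f is the
    coboundary of [track]. *)
Lemma homotopy_track (f g : smap X (abnerve S)) :
  (forall n (x : X n), H n (x, mono_const n ord0) = f n x /\ H n (x, mono_const n ord_max) = g n x) ->
  forall n (x : X n) a b i, sval (g n x) a b i = sval (f n x) a b i
    + track (sop (mono_const 0 b) x) i - track (sop (mono_const 0 a) x) i.
Proof.
move=> hH n x a b i; rewrite /track.
wlog ab : a b / (a <= b)%N.
  move=> hw; have [ab|/ltnW ba] := leqP a b; first exact: hw.
  rewrite (cocycle_opp b a _ (svalP (f n x)).1) (cocycle_opp b a _ (svalP (g n x)).1) hw //.
  by ring.
pose e := sop (mono_pair ab) x.
pose K1 : sprod X (std 1) 2 := (sop (mono_drop 0) e, mono_drop 1).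
pose K2 : sprod X (std 1) 2 := (sop (mono_drop 1) e, mono_drop 0).
have edge (K : sprod X (std 1) 2) (p q : 'I_3) (pq : (p <= q)%N) :
    sval (H 2 K) p q i = sval (H 1 (sop (mono_pair pq) K)) ord0 ord_max i.
  by rewrite sfun_nat.
pose v : 'I_3 := inord 1.
have v0 : (@ord0 2 <= v)%N by [].
have v2 : (v <= @ord_max 2)%N by rewrite inordK.
have v02 : (@ord0 2 <= @ord_max 2)%N by [].
have := (svalP (H 2 K1)).1 ord0 v ord_max i; have := (svalP (H 2 K2)).1 ord0 v ord_max i.
rewrite !(edge _ _ _ v0) !(edge _ _ _ v2) !(edge _ _ _ v02).
have pair_eq Y Z (y y' : Y) (z z' : Z) : y = y' -> z = z' -> (y, z) = (y', z') by move=> -> ->.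
have xa : e = sop (mono_pair ab) x by [].
have -> : sop (mono_pair v0) K1 = (e, mono_const 1 ord0).
  apply: pair_eq.
    rewrite -sop_comp -[RHS]sop_id; apply: sop_eq => j; apply: val_inj.
    by ord_cases j.
  by apply: eq_mono => j; apply: val_inj; ord_cases j.
have -> : sop (mono_pair v2) K1 = (sop (mono_const 1 (ord0 : 'I_1)) (sop (mono_const 0 b) x), mono_id 1).
  apply: pair_eq.
    rewrite -!sop_comp; apply: sop_eq => j; apply: val_inj.
    by ord_cases j.
  by apply: eq_mono => j; apply: val_inj; ord_cases j.
have -> : sop (mono_pair v02) K1 = (e, mono_id 1).
  apply: pair_eq.
    rewrite -sop_comp -[RHS]sop_id; apply: sop_eq => j; apply: val_inj.
    by ord_cases j.
  by apply: eq_mono => j; apply: val_inj; ord_cases j.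
have -> : sop (mono_pair v0) K2 = (sop (mono_const 1 (ord0 : 'I_1)) (sop (mono_const 0 a) x), mono_id 1).
  apply: pair_eq.
    rewrite -!sop_comp; apply: sop_eq => j; apply: val_inj.
    by ord_cases j.
  by apply: eq_mono => j; apply: val_inj; ord_cases j.
have -> : sop (mono_pair v2) K2 = (e, mono_const 1 ord_max).
  apply: pair_eq.
    rewrite -sop_comp -[RHS]sop_id; apply: sop_eq => j; apply: val_inj.
    by ord_cases j.
  by apply: eq_mono => j; apply: val_inj; ord_cases j.
have -> : sop (mono_pair v02) K2 = (e, mono_id 1).
  apply: pair_eq.
    rewrite -sop_comp -[RHS]sop_id; apply: sop_eq => j; apply: val_inj.
    by ord_cases j.
  by apply: eq_mono => j; apply: val_inj; ord_cases j.
rewrite (hH 1 e).1 (hH 1 e).2 /e !sfun_nat /= => -> E.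
by apply: (addrI (sval (H 1 (sop (mono_const 1 (ord0 : 'I_1)) (sop (mono_const 0 a) x), mono_id 1)) ord0 ord_max i)); rewrite E; ring.
Qed.

End Homotopy.

Lemma homotopic_coboundary S X (f g : smap X (abnerve S)) : homotopic f g ->
  exists c : X 0 -> I -> int, forall n (x : X n) a b i, sval (g n x) a b i =
    sval (f n x) a b i + c (sop (mono_const 0 b) x) i - c (sop (mono_const 0 a) x) i.
Proof. by case=> H hH; exists (track H) => n x a b i; apply: homotopy_track hH _ _ _ _ _. Qed.

(** The labels of the prism involve c itself, which need not lie in a smaller group S; hence the
    restriction to the full group of functions. The cochain [w] is 0 at the start of the homotopy
    and c at its end. *)
Lemma coboundary_homotopic X (f g : smap X (abnerve (fun=> True))) (c : X 0 -> I -> int) :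
  (forall n (x : X n) a b i, sval (g n x) a b i =
    sval (f n x) a b i + c (sop (mono_const 0 b) x) i - c (sop (mono_const 0 a) x) i) ->
  homotopic f g.
Proof.
move=> e.
pose w n (x : X n) (y : mono n 1) (a : 'I_n.+1) i : int :=
  if y a == ord0 then 0 else c (sop (mono_const 0 a) x) i.
have co n (x : X n) y : cocycle (fun a b i => sval (f n x) a b i + w n x y b i - w n x y a i).
  by move=> p q r i; rewrite ((svalP (f n x)).1 p q r i); ring.
pose cell n (x : sprod X (std 1) n) : abnerve (fun=> True) n :=
  abcell (co n x.1 x.2) (fun _ _ => Logic.I).
have cN m n (t : mono m n) (x : sprod X (std 1) n) : cell m (sop t x) = sop t (cell n x).
  by apply: abnerve_eq => p q i; rewrite /= sfun_nat /w /= !sop_const.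
exists (SMap cN).
move=> n x; split; apply: abnerve_eq => p q i; rewrite /= /w /=; first by ring.
by rewrite e.
Qed.

(** The extension property of a weak equivalence holds only up to homotopy, which for nerves of
    abelian groups means up to the coboundary of some c. *)
Lemma weak_equiv_label S X Y (h : smap X Y) (f : smap X (abnerve S)) :
  subgroup_pred S -> weak_equiv h ->
  exists (g : smap Y (abnerve S)) (c : X 0 -> I -> int),
    forall n (x : X n) a b i, sval (g n (h n x)) a b i =
      sval (f n x) a b i + c (sop (mono_const 0 b) x) i - c (sop (mono_const 0 a) x) i.
Proof.
move=> hS we; have [ext _] := we _ (abnerve_kan hS).
have [g /homotopic_coboundary [c hc]] := ext f.
exists g, (fun x i => - c x i) => n x a b i; rewrite hc /=; ring.
Qed.

(** An n-simplex of [loops z] is a homotopy from the constant map at z to itself. By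
    [homotopy_track] its track takes the same value at all vertices of Delta^n, so the label does
    not depend on the vertex used and is locally constant. *)
Lemma loop_label S (Z : sset) (z : Z 0) (g : smap Z (abnerve S)) :
  exists k : smap (loops z) (disc (I -> int)), forall n (l : loops z n) i,
    k n l i = sval (g 1 (sval l 1 (mono_const 1 ord0, mono_id 1))) ord0 ord_max i.
Proof.
have indep n (l : loops z n) (a : 'I_n.+1) i :
    sval (g 1 (sval l 1 (mono_const 1 a, mono_id 1))) ord0 ord_max i =
    sval (g 1 (sval l 1 (mono_const 1 ord0, mono_id 1))) ord0 ord_max i.
  pose H : smap (sprod (std n) (std 1)) (abnerve S) := smap_comp g (sval l).
  have fN m p (t : mono m p) (x : std n p) :
      g m (sop (mono_const m ord0) z) = sop t (g p (sop (mono_const p ord0) z)).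
    by rewrite -sfun_nat -sop_comp; congr (g m _); apply: sop_eq.
  pose f : smap (std n) (abnerve S) := SMap fN.
  have hH m (x : std n m) :
      H m (x, mono_const m ord0) = f m x /\ H m (x, mono_const m ord_max) = f m x.
    by split; rewrite /H /= (svalP l).
  have := homotopy_track hH (mono_id n : std n n) ord0 a i.
  rewrite /track /H /= => /eqP; rewrite -addrA eq_sym -subr_eq0.
  rewrite addrAC subrr add0r subr_eq0 => /eqP.
  by congr (_ = _); congr (sval (g 1 (sval l 1 (_, _))) _ _ _); apply: eq_mono.
have kN m n (t : mono m n) (l : loops z n) : (fun i =>
    sval (g 1 (sval (sop t l) 1 (mono_const 1 ord0, mono_id 1))) ord0 ord_max i) =
    (fun i => sval (g 1 (sval l 1 (mono_const 1 ord0, mono_id 1))) ord0 ord_max i).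
  apply: funext => i; rewrite -(indep n l (t ord0) i) /=.
  by congr (sval (g 1 (sval l 1 (_, _))) _ _ _); apply: eq_mono.
by exists (@SMap (loops z) (disc (I -> int)) _ kN).
Qed.

End AbelianNerve.

(** * Two-simplices in Kan complexes *)

Section KanFilling.
Variable X : sset.

(** Natural number indices let concrete faces be listed in a sequence; [inord] reads an index out of
    range as 0. *)
Definition dface n (i : nat) (x : X n.+1) : X n := sop (face (inord i)) x.

Lemma lift_lift n (i j : 'I_n.+3) (a b : 'I_n.+2) c :
  lift i a = j -> lift j b = i -> lift i (lift a c) = lift j (lift b c).
Proof.
move=> /(congr1 val) /= e1 /(congr1 val) /= e2; apply: val_inj => /=.
by move: e1 e2; rewrite /bump; lia.
Qed.

Lemma dface_dface n (i j : nat) (x : X n.+2) : i < j <= n.+2 -> dface i (dface j x) = dface j.-1 (dface i x).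
Proof.
move=> ij; rewrite /dface -!sop_comp; apply: sop_eq => a /=.
apply/esym/lift_lift; apply: val_inj; rewrite /= !inordK /bump; lia.
Qed.

(** A horn is given here by its faces, subject to the simplicial identities. A simplex of the horn
    may lie in several faces, and [compat] makes the choice among them immaterial. *)
Lemma kan_fill n (k : 'I_n.+3) (s : nat -> X n.+1) :
  kan X ->
  (forall i j, i < j <= n.+2 -> i <> k -> j <> k -> dface j.-1 (s i) = dface i (s j)) ->
  exists x : X n.+2, forall i, i <= n.+2 -> i <> k -> dface i x = s i.
Proof.
move=> Xk hs.
have compat m (i j : 'I_n.+3) (t u : mono m n.+1) : i <> k -> j <> k ->
    (forall a, lift i (t a) = lift j (u a)) -> sop t (s i) = sop u (s j).
  wlog ij : i j t u / (i <= j).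
    move=> hw ik jk e; have [ij|/ltnW ji] := leqP i j; first exact: hw.
    by apply/esym/hw => // a; rewrite e.
  move=> ik jk e; have [eij|nij] := eqVneq i j.
    by case: _ / eij {ij jk} e => e; apply: sop_eq => a; apply: (lift_inj (e a)).
  have {nij}ij : i < j by move: nij; rewrite -val_eqE ltn_neqAle ij andbT.
  have [a ea] : exists a, lift i a = j.
    by case: (unliftP i j) ij => [a -> _|->]; [exists a|rewrite ltnn].
  have [b eb] : exists b, lift j b = i.
    by case: (unliftP j i) ij => [b -> _|->]; [exists b|rewrite ltnn].
  have [t' et] : exists t', t = mono_comp (face a) t'.
    apply: face_factor => c tc; have := e c; rewrite tc ea => /eqP.
    by apply/negP; apply: neq_lift.
  have [u' eu] : exists u', u = mono_comp (face b) u'.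
    apply: face_factor => c uc; have := e c; rewrite uc eb => /esym/eqP.
    by apply/negP; apply: neq_lift.
  have tu : t' = u'.
    apply: eq_mono => c; have := e c; rewrite et eu /= (lift_lift _ ea eb).
    by move/lift_inj/lift_inj.
  rewrite et eu tu !sop_comp.
  have ha : a = inord j.-1.
    apply: val_inj; move/(congr1 val): ea; rewrite /= inordK ?(leq_trans (leq_pred _)) //.
      by rewrite /bump; lia.
    by have := ltn_ord j; lia.
  have hb : b = inord i.
    apply: val_inj; move/(congr1 val): eb; rewrite /= inordK.
      by rewrite /bump; lia.
    by have := ltn_ord j; lia.
  congr (sop _ _); rewrite ha hb; apply: hs.
  - by rewrite ij -ltnS ltn_ord.
  - by move/val_inj.
  - by move/val_inj.
have hw m (t : horn k m) : exists y, exists j (jk : j <> k) u,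
    t = sop u (face_horn jk) /\ y = sop u (s j).
  by have [j [jk [u e]]] := horn_factor t; exists (sop u (s j)), j, jk, u.
pose w m t := sval (cid (hw m t)).
have wE m (t : horn k m) j (jk : j <> k) u : t = sop u (face_horn jk) -> w m t = sop u (s j).
  move=> e; rewrite /w; case: cid => y /= [j' [jk' [u' [/= e' ->]]]].
  apply: compat => // a.
  by have := congr1 (fun t : horn k m => (sval t : mono _ _) a) (etrans (esym e') e).
have wN m p (t : mono m p) (y : horn k p) : w m (sop t y) = sop t (w p y).
  have [j [jk [u e]]] := horn_factor y.
  by rewrite (wE _ _ _ _ _ e) -sop_comp; apply: (wE _ _ _ jk); rewrite e -sop_comp.
have [x hx] := Xk _ k (@SMap (horn k) X w wN).
exists x => i ile ik.
have ik' : (inord i : 'I_n.+3) <> k by move/(congr1 val); rewrite /= inordK.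
have := hx _ (face_horn ik'); rewrite /= (wE _ _ _ ik' (mono_id _)) ?sop_id.
  by rewrite inordK.
by [].
Qed.

(* a, b, c are the edges 01, 12, 02 of a 2-simplex. *)
Definition tri (a b c : X 1) : Prop :=
  exists s : X 2, [/\ dface 2 s = a, dface 0 s = b & dface 1 s = c].

Lemma tri_degen (q : X 1) : tri (sop (mono_const 1 ord0) (dface 1 q)) q q.
Proof.
exists (sop (mono_drop 1) q); split; rewrite /dface -!sop_comp.
- by apply: sop_eq => j; apply: val_inj; rewrite /= /bump !inordK //; ord_cases j.
- rewrite -[RHS]sop_id.
  by apply: sop_eq => j; apply: val_inj; rewrite /= /bump !inordK //; ord_cases j.
- rewrite -[RHS]sop_id.
  by apply: sop_eq => j; apply: val_inj; rewrite /= /bump !inordK //; ord_cases j.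
Qed.

Hypothesis Xk : kan X.

(** Up to homotopy a is the composite of c with the inverse of b. For two edges with common source
    and common target it is a loop. *)
Lemma tri_fill (b c : X 1) : dface 0 b = dface 0 c ->
  exists a, [/\ tri a b c, dface 1 a = dface 1 c & dface 0 a = dface 1 b].
Proof.
move=> e.
have [|x hx] := @kan_fill 0 ord_max (fun i => if i == 0 then b else c) Xk.
  by move=> [|[|[|i]]] [|[|[|j]]] //=; rewrite andbF.
have e0 : dface 0 x = b by apply: hx.
have e1 : dface 1 x = c by apply: hx.
by exists (dface 2 x); split; [exists x | rewrite dface_dface // e1 | rewrite dface_dface // e0].
Qed.

(** Associativity in the fundamental groupoid: three faces of a 3-simplex are given, and filling the
    horn produces the face opposite to vertex 2. *)
Lemma tri_face2 a01 a02 a03 a12 a13 a23 :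
  tri a01 a12 a02 -> tri a12 a23 a13 -> tri a02 a23 a03 -> tri a01 a13 a03.
Proof.
move=> [s3 [h31 h32 h33]] [s0 [h01 h02 h03]] [s1 [h11 h12 h13]].
have [|x hx] := @kan_fill 1 (inord 2) (fun i => nth s3 [:: s0; s1] i) Xk.
  by rewrite inordK // => -[|[|[|[|i]]]] [|[|[|[|j]]]] //=; rewrite ?andbF // => *; congruence.
have e0 : dface 0 x = s0 by apply: hx; rewrite ?inordK.
have e1 : dface 1 x = s1 by apply: hx; rewrite ?inordK.
have e3 : dface 3 x = s3 by apply: hx; rewrite ?inordK.
exists (dface 2 x); split.
- by rewrite -[2]/(3.-1) -dface_dface // e3.
- by rewrite dface_dface // e0.
- by rewrite dface_dface // e1.
Qed.

Lemma tri_face3 a01 a02 a03 a12 a13 a23 :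
  tri a12 a23 a13 -> tri a02 a23 a03 -> tri a01 a13 a03 -> tri a01 a12 a02.
Proof.
move=> [s0 [h01 h02 h03]] [s1 [h11 h12 h13]] [s2 [h21 h22 h23]].
have [|x hx] := @kan_fill 1 ord_max (fun i => nth s2 [:: s0; s1] i) Xk.
  by move=> [|[|[|[|i]]]] [|[|[|[|j]]]] //=; rewrite ?andbF // => *; congruence.
have e0 : dface 0 x = s0 by apply: hx.
have e1 : dface 1 x = s1 by apply: hx.
have e2 : dface 2 x = s2 by apply: hx.
exists (dface 3 x); split.
- by rewrite dface_dface // e2.
- by rewrite dface_dface // e0.
- by rewrite dface_dface // e1.
Qed.

(* a and a' are the loops p i^-1 and p' i'^-1; an edge t carrying (i, p) to
   (i', p') identifies them, so that their difference b is contractible. *)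
Lemma tri_difference (i p i' p' t a a' b : X 1) :
  tri a i p -> tri a' i' p' -> tri b a' a -> tri i t i' -> tri p t p' ->
  tri b (sop (mono_const 1 ord0) (dface 1 p')) (sop (mono_const 1 ord0) (dface 1 p')).
Proof.
move=> h1 h2 h3 h4 h5.
have h6 := tri_face2 h1 h4 h5.
have h7 := tri_face2 h3 h2 h6.
exact: tri_face3 (tri_degen p') (tri_degen p') h7.
Qed.
End KanFilling.

Lemma tri_map X Y (f : smap X Y) a b c : tri a b c -> tri (f 1 a) (f 1 b) (f 1 c).
Proof. by case=> s [<- <- <-]; exists (f 2 s); rewrite /dface !sfun_nat. Qed.

Lemma dface_source (X : sset) (x : X 1) : dface 1 x = sop (mono_const 0 ord0) x.
Proof. by apply: sop_eq => i; apply: val_inj; rewrite /= /bump !inordK ?ord1. Qed.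

Lemma dface_target (X : sset) (x : X 1) : dface 0 x = sop (mono_const 0 ord_max) x.
Proof. by apply: sop_eq => i; apply: val_inj; rewrite /= /bump !inordK ?ord1. Qed.

(** * Points of the homotopy limit of a Cech diagram *)

(* Gluing a point of the homotopy limit of the Cech diagram from points a n over
   the U n, together with paths over the common pairwise intersection W joining
   all their restrictions to one point b. *)
Section CechGlue.
Variables (C : cat) (X U W : C) (f : nat -> hom U X) (j : nat -> hom W U).
Hypotheses (f_mono : forall n (T : C) (u v : hom T U), comp (f n) u = comp (f n) v -> u = v)
  (fj : forall m n, comp (f m) (j m) = comp (f n) (j n))
  (j_mono : forall n (T : C) (u v : hom T W), comp (j n) u = comp (j n) v -> u = v)
  (fj_pullback : forall m n (T : C) (u v : hom T U), m <> n ->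
     comp (f m) u = comp (f n) v -> exists2 w, comp (j m) w = u & comp (j n) w = v).

Definition const_index n (i : 'I_n.+1 -> nat) : bool := [forall a, i a == i ord0].

Lemma const_indexP n (i : 'I_n.+1 -> nat) : reflect (forall a b, i a = i b) (const_index i).
Proof.
apply: (iffP forallP) => [h a b|h a]; last exact/eqP/h.
by rewrite (eqP (h a)) (eqP (h b)).
Qed.

Lemma const_index_comp m n (i : 'I_n.+1 -> nat) (u : mono m n) :
  const_index i -> const_index (fun a => i (u a)).
Proof. by move=> /const_indexP h; apply/const_indexP. Qed.

(** Two entries with distinct indices determine the map to W. The other coordinates follow because
    all composites of [f m] with [j m] coincide and each [f m] is a monomorphism. *)
Lemma nonconst_lift (T : C) n (i : 'I_n.+1 -> nat) (t : forall a : 'I_n.+1, hom T U) :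
  ~~ const_index i -> (forall a b, comp (f (i a)) (t a) = comp (f (i b)) (t b)) ->
  exists w : hom T W, forall a, comp (j (i a)) w = t a.
Proof.
move=> nc e; have [a [b ab]] : exists a b, i a <> i b.
  by move: nc; rewrite negb_forall => /existsP [a /eqP h]; exists a, ord0.
have [w wa _] := fj_pullback ab (e a b).
by exists w => l; apply: (@f_mono (i l)); rewrite comp_assoc (fj _ (i a)) -comp_assoc wa.
Qed.

(** A fibre product of charts is U when all indices agree and W as soon as two of them differ,
    whatever the number of factors. *)
Lemma cech_nerve_exists : inhabited (cech_nerve f).
Proof.
pose ob (b : bool) := if b then U else W.
pose pr (b : bool) (n : nat) : hom (ob b) U :=
  if b as b0 return hom (ob b0) U then idm U else j n.
have prE n (i : 'I_n.+1 -> nat) a c :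
    comp (f (i a)) (pr (const_index i) (i a)) = comp (f (i c)) (pr (const_index i) (i c)).
  by rewrite /pr; case: const_indexP => [h|_]; [rewrite (h a c)|apply: fj].
have lift n (i : 'I_n.+1 -> nat) (T : C) (t : forall a, hom T U) :
    (forall a b, comp (f (i a)) (t a) = comp (f (i b)) (t b)) ->
    exists w : hom T (ob (const_index i)), forall a, comp (pr (const_index i) (i a)) w = t a.
  rewrite /pr => e; case: const_indexP => [h|/const_indexP/nonconst_lift/(_ e)//].
  by exists (t ord0) => a; rewrite comp_idl; apply: (@f_mono (i a)); have := e ord0 a; rewrite (h ord0 a).
have uniq n (i : 'I_n.+1 -> nat) (T : C) (u v : hom T (ob (const_index i))) :
    (forall a, comp (pr (const_index i) (i a)) u = comp (pr (const_index i) (i a)) v) -> u = v.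
  move: u v; rewrite /pr; case: const_index => u v /(_ ord0); last exact: j_mono.
  by rewrite !comp_idl.
constructor.
exact: (@CechNerve C X nat (fun=> U) f _ (fun n i a => pr (const_index i) (i a)) prE
  (fun n i T t e => sval (cid (lift n i T t e)))
  (fun n i T t e => svalP (cid (lift n i T t e))) uniq).
Qed.

Variables (N : cech_nerve f) (F : psh C).
Variables (a : nat -> F U 0) (p : nat -> F W 1) (b : F W 0).
Hypotheses (p0 : forall n, sop (mono_const 0 ord0) (p n) = pres F (j n) 0 (a n))
  (p1 : forall n, sop (mono_const 0 ord_max) (p n) = b).

Definition wlift n (i : 'I_n.+1 -> nat) (nc : ~ const_index i) : hom (cn N i) W :=
  sval (cid (nonconst_lift (introN idP nc) (cn_pr_eq N i))).

Lemma wliftP n (i : 'I_n.+1 -> nat) (nc : ~ const_index i) l :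
  comp (j (i l)) (wlift nc) = cn_pr N i l.
Proof. by rewrite /wlift; case: cid => w /=. Qed.

Definition sub_index n q (z : over_chain (C := Delta) n q) (i : 'I_n.+1 -> nat) (l : 'I_q.+1) :=
  fun r => i ((och_str z l : mono _ _) r).
Arguments sub_index {n q} z i l _.

(** Along a chain over [n] the restricted multi-indices can only turn from constant to nonconstant,
    since earlier structure maps factor through later ones. The resulting map Delta^q -> Delta^1
    records the passage from the start of a path [p] to its end b. *)
Definition chi n q (z : over_chain (C := Delta) n q) (i : 'I_n.+1 -> nat) : mono q 1.
Proof.
exists (fun l => if const_index (sub_index z i l) then ord0 else ord_max) => l l' ll'.
case: (boolP (const_index (sub_index z i l'))) => [h|]; last by case: ifP.
suff -> : const_index (sub_index z i l) by [].
have /const_indexP e := h; apply/const_indexP => r s; rewrite /sub_index.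
by rewrite -(och_trstr z ll') /=; apply: e.
Defined.

(** The index of the path to be followed. It is well determined when the first multi-index of the
    chain is constant; otherwise [chi] stays at the end of the path, where the choice does not
    matter. *)
Definition tip n q (z : over_chain (C := Delta) n q) (i : 'I_n.+1 -> nat) : nat := sub_index z i ord0 ord0.

Definition glue n q (z : over_chain (C := Delta) n q) (i : 'I_n.+1 -> nat) : F (cn N i) q :=
  match pselect (const_index i) with
  | left _ => sop (mono_const q (ord0 : 'I_1)) (pres F (cn_pr N i ord0) 0 (a (i ord0)))
  | right nc => pres F (wlift nc) q (sop (chi z i) (p (tip z i)))
  end.

(** A simplex of Delta^1 that starts at vertex 1 stays there, and all paths end in the same b. *)
Lemma sop_pathE q (t : mono q 1) (n m : nat) :
  (t ord0 = ord0 -> n = m) -> sop t (p n) = sop t (p m).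
Proof.
have [t0 /(_ t0) ->//|t0 _] := eqVneq (t ord0) ord0.
have t1 l : t l = ord_max.
  have := mono_le t (leq0n l : (ord0 <= l)%N); move: t0; rewrite -val_eqE /=.
  by case: (t ord0) => [[|x] hx] //= _; case: (t l) => [[|[|//]] hy] // _; apply: val_inj.
have -> : t = mono_comp (mono_const 0 ord_max) (mono_const q (ord0 : 'I_1)).
  by apply: eq_mono => l; rewrite t1.
by rewrite !sop_comp !p1.
Qed.

Lemma cn_pr_congr n (i : 'I_n.+1 -> nat) l r : i l = i r -> cn_pr N i l = cn_pr N i r.
Proof. by move=> e; apply: (@f_mono (i l)); rewrite (cn_pr_eq N i l r) e. Qed.

Lemma glue_nat n q r (s : mono r q) (z : over_nerve (C := Delta) n q) i :
  glue (sop s z) i = sop s (glue z i).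
Proof.
rewrite /glue; case: pselect => [h|h]; first by rewrite -sop_comp; apply: sop_eq.
rewrite -sfun_nat -sop_comp; congr (pres F _ _ _).
rewrite (_ : chi (sop s z) i = mono_comp (chi z i) s); last exact: eq_mono.
apply: sop_pathE => /=; case: ifP => // /const_indexP e _.
rewrite /tip /sub_index /=.
by rewrite -(och_trstr z (leq0n (s ord0) : (ord0 <= s ord0)%N)) /=; apply: e.
Qed.

Lemma glue_push (m n : Delta) (u : hom m n) q (z : over_nerve m q) (i : 'I_n.+1 -> nat) :
  glue (over_push u z) i = pres F (cn_op N u i) q (glue z (fun l => i ((u : mono _ _) l))).
Proof.
have opE l : comp (cn_pr N (fun l => i ((u : mono _ _) l)) l) (cn_op N u i) = cn_pr N i ((u : mono _ _) l).
  exact: (@cn_lift_pr _ _ _ _ _ N m (fun l => i ((u : mono _ _) l))).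
rewrite /glue; case: pselect => [h|nc]; case: pselect => [h'|nc'].
- have /const_indexP e := h.
  by rewrite sfun_nat -pres_comp opE (cn_pr_congr (e _ ord0)) (e _ ord0).
- by case: nc'; apply: const_index_comp.
(* The case where gluing takes place: i is nonconstant but its restriction along u is constant. Then
   [chi] is constantly 0, and [p0] identifies the start of the path with the restriction of a chart
   class. *)
- rewrite [in RHS]sfun_nat -[in RHS]pres_comp opE.
  have /const_indexP e := h'.
  have -> : chi (over_push u z) i = mono_comp (mono_const 0 ord0) (mono_const q (ord0 : 'I_1)).
    by apply: eq_mono => l /=; case: const_indexP => // no; case: no => r s; apply: e.
  rewrite sop_comp p0 sfun_nat -pres_comp; congr (sop _ _).
  rewrite /tip /sub_index /= wliftP (e _ ord0).
  rewrite (@cn_pr_congr _ i _ ((u : mono _ _) ord0)) //; exact: e.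
- have -> : wlift nc = comp (wlift nc') (cn_op N u i).
    apply: (@j_mono (i ((u : mono _ _) ord0))).
    by rewrite wliftP comp_assoc (wliftP nc') opE.
  by rewrite pres_comp (_ : chi (over_push u z) i = chi z (fun l => i ((u : mono _ _) l))) //; apply: eq_mono.
Qed.

Lemma cech_glue : exists t : holim (cech_diagram N F) 0,
  forall n (i : 'I_n.+1 -> nat) (z : over_nerve (C := Delta) n 0) (s : std 0 0),
  const_index i -> sval t n 0 (z, s) i = pres F (cn_pr N i ord0) 0 (a (i ord0)).
Proof.
pose T n : smap (sprod (over_nerve (C := Delta) n) (std 0)) (cech_diagram N F n) :=
  @SMap (sprod (over_nerve (C := Delta) n) (std 0)) (cech_diagram N F n)
    (fun q zd i => glue zd.1 i)
    (fun q r s zd => functional_extensionality_dep (fun i => glue_nat s zd.1 i)).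
have TP : holim_cond T.
  by move=> m n u q z d' /=; apply: functional_extensionality_dep => i; apply: glue_push.
exists (exist _ T TP) => n i z s h /=; rewrite /glue; case: pselect => // _.
by rewrite -[RHS]sop_id; apply: sop_eq => l; rewrite !ord1.
Qed.
End CechGlue.

Definition bounded_seq (u : nat -> int) : Prop := exists C : nat, forall n, (`|u n|%N <= C)%N.

Lemma disc_vertex X T (v : smap X (disc T)) n (x : X n) a :
  v 0 (sop (mono_const 0 a) x) = v n x.
Proof. by rewrite sfun_nat. Qed.

(** * Failure of Cech descent from an unbounded family of labels *)

Section NoDescent.
Variables (S : site) (F : psh S) (z : forall U, F U 0)
  (zn : forall U V (f : hom U V), pres F f 0 (z V) = z U).
Let K := loop_psh zn.
Variables (X U W : S) (f : nat -> hom U X) (j : nat -> hom W U).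
Hypotheses (f_mono : forall n (T : S) (u v : hom T U), comp (f n) u = comp (f n) v -> u = v)
  (fj : forall m n, comp (f m) (j m) = comp (f n) (j n))
  (j_mono : forall n (T : S) (u v : hom T W), comp (j n) u = comp (j n) v -> u = v)
  (fj_pullback : forall m n (T : S) (u v : hom T U), m <> n ->
     comp (f m) u = comp (f n) v -> exists2 w, comp (j m) w = u & comp (j n) w = v)
  (f_cov : covering f).
Variables (k : smap (K U) (disc int)) (a : nat -> K U 0) (p : nat -> K W 1) (b : K W 0).
Hypotheses (k_bounded : forall l : K X 0, bounded_seq (fun n => k 0 (pres K (f n) 0 l)))
  (p0 : forall n, sop (mono_const 0 ord0) (p n) = pres K (j n) 0 (a n))
  (p1 : forall n, sop (mono_const 0 ord_max) (p n) = b)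
  (a_unbounded : ~ bounded_seq (fun n => k 0 (a n))).

Lemma no_cech_descent : ~ cech_descent K.
Proof.
case=> F' [h [[F'k hwe] desc]].
have [N] := cech_nerve_exists f_mono fj j_mono fj_pullback.
have [k' hk'] := weak_equiv_disc_ext k (hwe U).
have idE n : forall a b : 'I_1, comp (f n) (idm U) = comp (f n) (idm U) by [].
(* The object that N provides for a single index is only isomorphic to U; [lift] inverts its
   projection. *)
pose lift n : hom U (cn N (fun=> n)) := @cn_lift _ _ _ _ _ N 0 (fun=> n) U (fun=> idm U) (idE n).
have liftE n : comp (cn_pr N (fun=> n) ord0) (lift n) = idm U.
  exact: (@cn_lift_pr _ _ _ _ _ N 0 (fun=> n) U (fun=> idm U)).
(* A point of the homotopy limit is evaluated in cosimplicial degree 0, at the chain of identities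
   of [0]; only the charts themselves are seen there. *)
pose ch q : over_nerve (C := Delta) 0 q :=
  @OverChain Delta 0 q (fun=> 0) (fun=> mono_id 0) (fun _ _ _ => mono_id 0)
    (fun _ _ _ => erefl) (fun _ _ => erefl) (fun _ _ _ _ _ _ => erefl).
pose ev q (t : holim (cech_diagram N F') q) (n : nat) : int :=
  k' q (pres F' (lift n) q (sval t 0 q (ch q, mono_id q) (fun=> n))).
have evN q r (s : mono r q) (t : holim (cech_diagram N F') q) : ev r (sop s t) = ev q t.
  apply: funext => n; rewrite /ev.
  rewrite -[RHS]/(sop s (k' q _)) -sfun_nat -sfun_nat.
  have := sfun_nat (sval t 0) s (ch q, mono_id q).
  move=> /(congr1 (fun g => g (fun=> n))) /= e.
  rewrite -[X in _ = k' r (pres F' (lift n) r X)]e /=.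
  by congr (k' r (pres F' _ r (sval t 0 r (_, _) _))); apply: eq_mono.
pose B : smap (holim (cech_diagram N F')) (disc Prop) :=
  @SMap (holim (cech_diagram N F')) (disc Prop) (fun q t => bounded_seq (ev q t))
    (fun r q s t => congr1 bounded_seq (evN q r s t)).
pose T Y : smap Y (disc Prop) := @SMap Y (disc Prop) (fun _ _ => True) (fun _ _ _ _ => erefl).
have evC q (x : F' X q) n : ev q (cech_map N F' q x) n = k' q (pres F' (f n) q x).
  rewrite /ev /= sop_id -pres_comp; congr (k' q (pres F' _ q x)).
  by rewrite /cn_aug -comp_assoc liftE comp_idr.
have B_on_X : forall q (x : F' X q), B q (cech_map N F' q x) = True.
  pose B' : smap (F' X) (disc Prop) := smap_comp B (cech_map N F').
  apply: (weak_equiv_disc (v := B') (w := T _) (hwe X)) => q l.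
  rewrite -(disc_vertex B' _ ord0) -sfun_nat /=; apply: propext; split=> // _.
  have [C hC] := k_bounded (sop (mono_const 0 ord0) l).
  by exists C => n; rewrite evC -pfun_nat hk'.
have {}B_on : forall q t, B q t = T _ q t.
  by apply: weak_equiv_disc (desc _ _ _ _ f_cov N) _ => q x; rewrite B_on_X.
have [t ht] := @cech_glue _ X U W f j f_mono fj j_mono fj_pullback N F'
  (fun n => h U 0 (a n)) (fun n => h W 1 (p n)) (h W 0 b)
  (fun n => etrans (esym (sfun_nat (h W) _ _))
     (etrans (congr1 (h W 0) (p0 n)) (pfun_nat h (j n) (a n))))
  (fun n => etrans (esym (sfun_nat (h W) _ _)) (congr1 (h W 0) (p1 n))).
apply: a_unbounded.
have : B 0 t by rewrite B_on.
congr bounded_seq; apply: funext => n; rewrite /ev ht; last exact/const_indexP.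
by rewrite -pres_comp liftE pres_id hk'.
Qed.
End NoDescent.

(** * Universal algebras and localizations *)

Section Quotient.
Variables (T : Type) (E : T -> T -> Prop).
Hypotheses (Er : forall x, E x x) (Es : forall x y, E x y -> E y x)
  (Et : forall x y z, E x y -> E y z -> E x z).

(** Classes are predicates, so equality of classes is extensional. The ring axioms below are
    required only up to E, which allows raw expressions and unreduced fractions as
    representatives. *)
Definition quo : Type := {P : T -> Prop | exists x, P = E x}.
Definition cls (x : T) : quo := exist _ (E x) (ex_intro _ x erefl).
Definition rep (u : quo) : T := sval (cid (svalP u)).

Lemma cls_eq x y : E x y -> cls x = cls y.
Proof.
move=> e; apply: eq_exist; apply: funext => w; apply: propext.
by split; apply: Et => //; apply: Es.
Qed.

Lemma cls_inj x y : cls x = cls y -> E x y.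
Proof. by move=> /(congr1 sval) /= ->; apply: Er. Qed.

Lemma repK u : cls (rep u) = u.
Proof. by case: u => P hP; apply: eq_exist; rewrite /rep /=; case: cid => x /= ->. Qed.

Lemma clsP u : exists x, u = cls x.
Proof. by exists (rep u); rewrite repK. Qed.

Lemma rep_cls x : E (rep (cls x)) x.
Proof. by apply: cls_inj; rewrite repK. Qed.

Variables (add mul : T -> T -> T) (opp : T -> T) (zero one : T).
Hypotheses (Eadd : forall x x' y y', E x x' -> E y y' -> E (add x y) (add x' y'))
  (Emul : forall x x' y y', E x x' -> E y y' -> E (mul x y) (mul x' y'))
  (Eopp : forall x x', E x x' -> E (opp x) (opp x')).
Hypotheses (addA : forall x y z, E (add x (add y z)) (add (add x y) z))
  (addC : forall x y, E (add x y) (add y x)) (add0 : forall x, E (add zero x) x)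
  (addN : forall x, E (add (opp x) x) zero)
  (mulA : forall x y z, E (mul x (mul y z)) (mul (mul x y) z))
  (mulC : forall x y, E (mul x y) (mul y x)) (mul1 : forall x, E (mul one x) x)
  (mulD : forall x y z, E (mul (add x y) z) (add (mul x z) (mul y z))).

Definition qadd (u v : quo) := cls (add (rep u) (rep v)).
Definition qmul (u v : quo) := cls (mul (rep u) (rep v)).
Definition qopp (u : quo) := cls (opp (rep u)).

Lemma qaddE x y : qadd (cls x) (cls y) = cls (add x y).
Proof. by apply: cls_eq; apply: Eadd; apply: rep_cls. Qed.
Lemma qmulE x y : qmul (cls x) (cls y) = cls (mul x y).
Proof. by apply: cls_eq; apply: Emul; apply: rep_cls. Qed.
Lemma qoppE x : qopp (cls x) = cls (opp x).
Proof. by apply: cls_eq; apply: Eopp; apply: rep_cls. Qed.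

Definition quo_choice : choiceType := HB.pack quo (gen_eqMixin quo) (gen_choiceMixin quo).

Let qaddA : @associative quo_choice qadd.
Proof.
move=> u v w; have [x ->] := clsP u; have [y ->] := clsP v; have [z ->] := clsP w.
by rewrite !qaddE; apply: cls_eq.
Qed.
Let qaddC : @commutative quo_choice quo_choice qadd.
Proof.
move=> u v; have [x ->] := clsP u; have [y ->] := clsP v.
by rewrite !qaddE; apply: cls_eq.
Qed.
Let qadd0 : @left_id quo_choice quo_choice (cls zero) qadd.
Proof. by move=> u; have [x ->] := clsP u; rewrite qaddE; apply: cls_eq. Qed.
Let qaddN : @left_inverse quo_choice quo_choice quo_choice (cls zero) qopp qadd.
Proof. by move=> u; have [x ->] := clsP u; rewrite qoppE qaddE; apply: cls_eq. Qed.

Definition quo_zmod : zmodType :=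
  HB.pack quo_choice (GRing.isZmodule.Build quo_choice qaddA qaddC qadd0 qaddN).

Let qmulA : @associative quo_zmod qmul.
Proof.
move=> u v w; have [x ->] := clsP u; have [y ->] := clsP v; have [z ->] := clsP w.
by rewrite !qmulE; apply: cls_eq.
Qed.
Let qmulC : @commutative quo_zmod quo_zmod qmul.
Proof.
move=> u v; have [x ->] := clsP u; have [y ->] := clsP v.
by rewrite !qmulE; apply: cls_eq.
Qed.
Let qmul1 : @left_id quo_zmod quo_zmod (cls one) qmul.
Proof. by move=> u; have [x ->] := clsP u; rewrite qmulE; apply: cls_eq. Qed.
Let qmulD : @left_distributive quo_zmod quo_zmod qmul +%R.
Proof.
move=> u v w; have [x ->] := clsP u; have [y ->] := clsP v; have [z ->] := clsP w.
by rewrite /GRing.add /= !(qmulE, qaddE); apply: cls_eq.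
Qed.

Definition quo_ring : comPzRingType :=
  HB.pack quo_zmod (GRing.Zmodule_isComPzRing.Build quo_zmod qmulA qmulC qmul1 qmulD).

End Quotient.

Local Open Scope ring_scope.

Section MorphismBuilders.
Variables (A B : comPzRingType) (f : A -> B).
Hypotheses (fD : forall x y, f (x + y) = f x + f y) (fM : forall x y, f (x * y) = f x * f y)
  (f1 : f 1 = 1).

Lemma build_zmod : zmod_morphism f.
Proof.
move=> x y; apply: (addIr (f y)); by rewrite -fD !subrK.
Qed.

Definition build_rmorph : {rmorphism A -> B} :=
  HB.pack f (GRing.isZmodMorphism.Build A B f build_zmod)
    (GRing.isMonoidMorphism.Build A B f (f1, fM)).
End MorphismBuilders.

Lemma rmorph_eq (A B : comPzRingType) (f g : {rmorphism A -> B}) : f =1 g -> f = g.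
Proof.
case: f g => [f [[fa] [fb]]] [g [[ga] [gb]]] /= /funext e.
case: _ / e ga gb => ga gb.
by rewrite (Prop_irrelevance fa ga) (Prop_irrelevance fb gb).
Qed.

Section Algebras.
Variable k : fieldType.
Implicit Types A B D : kalg k.

Lemma khom_eq A B (f g : khom A B) : (forall a, f a = g a) -> f = g.
Proof.
case: f g => [f fs] [g gs] /= /rmorph_eq e.
by case: _ / e gs => gs; congr KHom; apply: Prop_irrelevance.
Qed.

Section Universal.
Variables (T : Type) (C : forall A, (T -> A) -> Prop).

Inductive expr := EConst of k | EVar of T | EAdd of expr & expr | EMul of expr & expr
  | EOpp of expr.

Fixpoint eval A (p : T -> A) (e : expr) : A :=
  match e with
  | EConst c => kstr A c
  | EVar t => p t
  | EAdd x y => eval p x + eval p y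
  | EMul x y => eval p x * eval p y
  | EOpp x => - eval p x
  end.

Definition eval_eq (e e' : expr) := forall A (p : T -> A), C p -> eval p e = eval p e'.

(* R is the k-algebra of functions on the functor of T-tuples satisfying C:
   polynomial expressions, identified when they agree on all such tuples. *)
Lemma universal_algebra : exists (R : kalg k) (u : T -> R),
  [/\ forall A (p : T -> A), C p -> exists h : khom R A, forall t, h (u t) = p t,
      forall x y : R, (forall A (h : khom R A), C (h \o u) -> h x = h y) -> x = y
    & forall P : R -> Prop, (forall c, P (kstr R c)) -> (forall t, P (u t)) ->
        (forall a b, P a -> P b -> P (a + b)) -> (forall a b, P a -> P b -> P (a * b)) ->
        forall a, P a].
Proof.
have Er e : eval_eq e e by [].
have Es e e' : eval_eq e e' -> eval_eq e' e by move=> h A p /h.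
have Et a b c : eval_eq a b -> eval_eq b c -> eval_eq a c.
  by move=> h h' A p Cp; rewrite h // h'.
have Ea x x' y y' : eval_eq x x' -> eval_eq y y' -> eval_eq (EAdd x y) (EAdd x' y').
  by move=> h h' A p Cp /=; rewrite h // h'.
have Em x x' y y' : eval_eq x x' -> eval_eq y y' -> eval_eq (EMul x y) (EMul x' y').
  by move=> h h' A p Cp /=; rewrite h // h'.
have Eo x x' : eval_eq x x' -> eval_eq (EOpp x) (EOpp x').
  by move=> h A p Cp /=; rewrite h.
have a1 x y z : eval_eq (EAdd x (EAdd y z)) (EAdd (EAdd x y) z) by move=> A p _; apply: addrA.
have a2 x y : eval_eq (EAdd x y) (EAdd y x) by move=> A p _; apply: addrC.
have a3 x : eval_eq (EAdd (EConst 0) x) x by move=> A p _ /=; rewrite rmorph0 add0r.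
have a4 x : eval_eq (EAdd (EOpp x) x) (EConst 0) by move=> A p _ /=; rewrite rmorph0 addNr.
have m1 x y z : eval_eq (EMul x (EMul y z)) (EMul (EMul x y) z) by move=> A p _; apply: mulrA.
have m2 x y : eval_eq (EMul x y) (EMul y x) by move=> A p _; apply: mulrC.
have m3 x : eval_eq (EMul (EConst 1) x) x by move=> A p _ /=; rewrite rmorph1 mul1r.
have m4 x y z : eval_eq (EMul (EAdd x y) z) (EAdd (EMul x z) (EMul y z)).
  by move=> A p _; apply: mulrDl.
pose R0 := quo_ring Er Es Et Ea Em Eo a1 a2 a3 a4 m1 m2 m3 m4.
pose c (e : expr) : R0 := cls eval_eq e.
have cD x y : c (EAdd x y) = c x + c y by exact: esym (qaddE Er Es Et Ea x y).
have cM x y : c (EMul x y) = c x * c y by exact: esym (qmulE Er Es Et Em x y).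
have cN x : c (EOpp x) = - c x by exact: esym (qoppE Er Es Et Eo x).
have cc : forall e e', eval_eq e e' -> c e = c e' by exact: cls_eq.
have cP : forall x : R0, exists e, x = c e by exact: clsP.
have ci : forall e e', c e = c e' -> eval_eq e e' by exact: cls_inj.
pose str x : R0 := c (EConst x).
have strD x y : str (x + y) = str x + str y.
  by rewrite -cD; apply: cc => A p Cp /=; rewrite rmorphD.
have strM x y : str (x * y) = str x * str y.
  by rewrite -cM; apply: cc => A p Cp /=; rewrite rmorphM.
pose R := KAlg (build_rmorph strD strM (erefl : str 1 = 1)).
have lift A (p : T -> A) : C p -> exists h : khom R A, forall e, h (c e) = eval p e.
  move=> Cp; pose h (x : R) : A := eval p (sval (cid (cP x))).
  have hc e : h (c e) = eval p e.
    by rewrite /h; case: cid => e' /= /esym/ci; apply.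
  have hD x y : h (x + y) = h x + h y.
    by have [e ->] := cP x; have [e' ->] := cP y; rewrite -[LHS]/(h (c e + c e')) -cD !hc.
  have hM x y : h (x * y) = h x * h y.
    by have [e ->] := cP x; have [e' ->] := cP y; rewrite -[LHS]/(h (c e * c e')) -cM !hc.
  have h1 : h 1 = 1 by rewrite -[LHS]/(h (c (EConst 1))) hc /= rmorph1.
  have hs x : build_rmorph hD hM h1 (kstr R x) = kstr A x by rewrite -[LHS]/(h (c (EConst x))) hc.
  by exists (KHom hs).
exists R, (fun t => c (EVar t)); split.
- by move=> A p /lift [h hh]; exists h => t; rewrite hh.
- move=> x y; have [e ->] := cP x; have [e' ->] := cP y => h.
  apply: cc => A p Cp; have [g hg] := lift _ _ Cp.
  have pE : (g \o (fun t => c (EVar t)))%FUN = p by apply: funext => t /=; rewrite hg.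
  by rewrite -!hg h // pE.
- move=> P Pc Pu PD PM a; have [e -> {a}] := cP a.
  elim: e => [x|t|x Px y Py|x Px y Py|x Px]; [exact: Pc|exact: Pu| | |].
  + by rewrite cD; apply: PD.
  + by rewrite cM; apply: PM.
  + have -> : c (EOpp x) = c (EConst (-1)) * c x.
      by rewrite -cM; apply: cc => A p Cp /=; rewrite rmorphN rmorph1 mulN1r.
    by apply: PM => //; apply: Pc.
Qed.
End Universal.

End Algebras.

(** * Localization of algebras and gluing of elements over basic open sets *)

Section Localization.
Variable k : fieldType.
Implicit Types A B C D : kalg k.

Lemma localization_exists A (f : A) : exists B (l : khom A B), is_localization l f.
Proof.
(* The pair (a, n) stands for a / f^n; the extra exponent K is needed because f may be a zero
   divisor. *)
pose E (x y : A * nat) : Prop := exists K, f ^+ (K + y.2) * x.1 = f ^+ (K + x.2) * y.1.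
have Er x : E x x by exists 0%N.
have Es x y : E x y -> E y x by case=> K e; exists K.
have Et x y z : E x y -> E y z -> E x z.
  case: x y z => [x i] [y j] [z l] [K /= e1] [L /= e2]; exists (K + L + j)%N => /=.
  rewrite !exprD in e1 e2 *.
  transitivity ((f ^+ L * f ^+ l) * (f ^+ K * f ^+ j * x)); first by ring.
  rewrite e1.
  transitivity ((f ^+ K * f ^+ i) * (f ^+ L * f ^+ l * y)); first by ring.
  rewrite e2; ring.
pose add (x y : A * nat) := (x.1 * f ^+ y.2 + y.1 * f ^+ x.2, (x.2 + y.2)%N).
pose mul (x y : A * nat) := (x.1 * y.1, (x.2 + y.2)%N).
pose opp (x : A * nat) := (- x.1, x.2).
have Ea x x' y y' : E x x' -> E y y' -> E (add x y) (add x' y').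
  case: x x' y y' => [x i] [x' i'] [y j] [y' j'] [K /= e1] [L /= e2]; exists (K + L)%N => /=.
  rewrite !exprD in e1 e2 *.
  transitivity (f ^+ L * f ^+ j * f ^+ j' * (f ^+ K * f ^+ i' * x) +
                f ^+ K * f ^+ i * f ^+ i' * (f ^+ L * f ^+ j' * y)); first by ring.
  rewrite e1 e2; ring.
have Em x x' y y' : E x x' -> E y y' -> E (mul x y) (mul x' y').
  case: x x' y y' => [x i] [x' i'] [y j] [y' j'] [K /= e1] [L /= e2]; exists (K + L)%N => /=.
  rewrite !exprD in e1 e2 *.
  transitivity ((f ^+ K * f ^+ i' * x) * (f ^+ L * f ^+ j' * y)); first by ring.
  rewrite e1 e2; ring.
have Eo x x' : E x x' -> E (opp x) (opp x').
  by case: x x' => [x i] [x' i'] [K /= e]; exists K => /=; rewrite !mulrN e.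
have eqE x y : x.1 = y.1 -> x.2 = y.2 -> E x y by move=> e1 e2; exists 0%N; rewrite e1 e2.
have a1 x y z : E (add x (add y z)) (add (add x y) z).
  by apply: eqE; rewrite /= ?addnA // !exprD; ring.
have a2 x y : E (add x y) (add y x) by apply: eqE; rewrite /= 1?addnC // addrC.
have a3 x : E (add (0, 0%N) x) x by apply: eqE; rewrite /= ?add0n // expr0; ring.
have a4 x : E (add (opp x) x) (0, 0%N) by exists 0%N => /=; ring.
have m1 x y z : E (mul x (mul y z)) (mul (mul x y) z) by apply: eqE; rewrite /= ?addnA ?mulrA.
have m2 x y : E (mul x y) (mul y x) by apply: eqE; rewrite /= 1?addnC // mulrC.
have m3 x : E (mul (1, 0%N) x) x by apply: eqE; rewrite /= ?add0n ?mul1r.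
have m4 x y z : E (mul (add x y) z) (add (mul x z) (mul y z)).
  by exists 0%N => /=; rewrite !exprD; ring.
pose R0 := quo_ring Er Es Et Ea Em Eo a1 a2 a3 a4 m1 m2 m3 m4.
pose c (x : A * nat) : R0 := cls E x.
have cD x y : c (add x y) = c x + c y by exact: esym (qaddE Er Es Et Ea x y).
have cM x y : c (mul x y) = c x * c y by exact: esym (qmulE Er Es Et Em x y).
have cc x y : E x y -> c x = c y by exact: cls_eq.
have cP : forall x : R0, exists e, x = c e by exact: clsP.
have ci x y : c x = c y -> E x y by exact: cls_inj.
pose l a : R0 := c (a, 0%N).
have lD x y : l (x + y) = l x + l y by rewrite -cD; apply: cc; apply: eqE => //=; rewrite expr0 !mulr1.
have lM x y : l (x * y) = l x * l y by rewrite -cM.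
pose lr := build_rmorph lD lM (erefl : l 1 = 1).
pose B := KAlg (lr \o kstr A)%FUN.
exists B, (@KHom k A B lr (fun _ => erefl)); split.
- exists (c (1, 1%N)); rewrite -[LHS]/(c (f, 0%N) * c (1, 1%N)) -cM; apply: cc.
  by exists 0%N => /=; rewrite !add0n expr0 expr1 !mulr1 mul1r.
- move=> b; have [[a n] ->] := cP b; exists n, a.
  have lX m : (lr f : R0) ^+ m = c (f ^+ m, 0%N) by rewrite -rmorphXn.
  rewrite -[LHS]/((lr f : R0) ^+ n * c (a, n)) lX -cM; apply: cc.
  by exists 0%N => /=; rewrite !add0n expr0 mul1r.
- by move=> a /ci [K /= e]; exists K; move: e; rewrite mulr0 addn0.
Qed.

Lemma localization_lift A B C (l : khom A B) f (h : khom A C) :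
  is_localization l f -> (exists b, h f * b = 1) ->
  exists h' : khom B C, forall a, h' (l a) = h a.
Proof.
move=> [[f' ff'] lsurj lker] [g hg].
(* If b = a / f^n, then c is h(a) / h(f)^n; [Pfun] shows that the fraction chosen for b does not
   matter. *)
pose P b c := exists n a, l f ^+ n * b = l a /\ c = h a * g ^+ n.
have Pfun b c c' : P b c -> P b c' -> c = c'.
  move=> [n [a [e ->]]] [n' [a' [e' ->]]].
  have : l (f ^+ n' * a - f ^+ n * a') = 0.
    by rewrite rmorphB !rmorphM !rmorphXn -e -e'; ring.
  move=> /lker [K] eK.
  have : h f ^+ K * (h f ^+ n' * h a - h f ^+ n * h a') = 0.
    by rewrite -!rmorphXn -!rmorphM -rmorphB -rmorphM eK rmorph0.
  move=> /(congr1 (fun x => g ^+ K * g ^+ n * g ^+ n' * x)); rewrite mulr0.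
  have hgn m : g ^+ m * h f ^+ m = 1 by rewrite -exprMn mulrC hg expr1n.
  have -> : g ^+ K * g ^+ n * g ^+ n' * (h f ^+ K * (h f ^+ n' * h a - h f ^+ n * h a')) =
    (g ^+ K * h f ^+ K) * ((g ^+ n' * h f ^+ n') * (h a * g ^+ n) - (g ^+ n * h f ^+ n) * (h a' * g ^+ n')).
    by ring.
  by rewrite !hgn !mul1r => /eqP; rewrite subr_eq0 => /eqP.
have Pex b : exists c, P b c by have [n [a e]] := lsurj b; exists (h a * g ^+ n), n, a.
pose h' b := sval (cid (Pex b)).
have h'E b c : P b c -> h' b = c by rewrite /h'; case: cid => c' /= Pc'; apply: Pfun.
have h'D x y : h' (x + y) = h' x + h' y.
  have [n [a e]] := lsurj x; have [m [b e']] := lsurj y.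
  rewrite (h'E x (h a * g ^+ n)); last by exists n, a.
  rewrite (h'E y (h b * g ^+ m)); last by exists m, b.
  apply: h'E; exists (n + m)%N, (f ^+ m * a + f ^+ n * b).
  rewrite !exprD !rmorphD !rmorphM !rmorphXn -e -e'; split; first by ring.
  have hgn i : g ^+ i * h f ^+ i = 1 by rewrite -exprMn mulrC hg expr1n.
  transitivity ((g ^+ m * h f ^+ m) * (h a * g ^+ n) + (g ^+ n * h f ^+ n) * (h b * g ^+ m)).
    by rewrite !hgn !mul1r.
  by ring.
have h'M x y : h' (x * y) = h' x * h' y.
  have [n [a e]] := lsurj x; have [m [b e']] := lsurj y.
  rewrite (h'E x (h a * g ^+ n)); last by exists n, a.
  rewrite (h'E y (h b * g ^+ m)); last by exists m, b.
  apply: h'E; exists (n + m)%N, (a * b).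
  by rewrite !exprD !rmorphM -e -e'; split; ring.
have h'l a : h' (l a) = h a by apply: h'E; exists 0%N, a; rewrite !expr0 mul1r mulr1.
have h'1 : h' 1 = 1 by rewrite -(rmorph1 l) h'l rmorph1.
have h's c : build_rmorph h'D h'M h'1 (kstr B c) = kstr C c.
  by rewrite -(kfun_str l) /= h'l kfun_str.
by exists (KHom h's).
Qed.

Lemma unit_idealP A n (f : 'I_n -> A) : unit_ideal (fun a => exists i, a = f i) <->
  exists c : 'I_n -> A, \sum_i c i * f i = 1.
Proof.
split=> [[m [s [c [hs e]]]]|[c e]]; last by exists n, f, c; split=> // i; exists i.
have /choice [t ht] := hs.
exists (fun i => \sum_(j | t j == i) c j).
rewrite -e (partition_big t xpredT) //=; apply: eq_bigr => i _.
by rewrite mulr_suml; apply: eq_bigr => j /eqP ji; rewrite ht ji.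
Qed.

(** Generators are replaced by their powers one at a time: if z + y = 1 with z a multiple of f_j,
    then z^m differs from (z + y)^m = 1 by a multiple of y. *)
Lemma unit_idealX A n (f : 'I_n -> A) m : unit_ideal (fun a => exists i, a = f i) ->
  exists c : 'I_n -> A, \sum_i c i * f i ^+ m = 1.
Proof.
move=> /unit_idealP uf.
suff /(_ n (leqnn n)) [c e] : forall j, (j <= n)%N ->
    exists c : 'I_n -> A, \sum_i c i * (if (i < j)%N then f i ^+ m else f i) = 1.
  by exists c; rewrite -e; apply: eq_bigr => i _; rewrite ltn_ord.
elim=> [_|j IH jn]; first exact: uf.
have [c] := IH (ltnW jn); pose i0 := Ordinal jn.
rewrite (bigD1 i0) //= ltnn; set y := \sum_(i < n | _) _ => e.
have ez : (c i0 * f i0 + y) ^+ m - (c i0 * f i0) ^+ m =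
    y * (\sum_(i < m) (c i0 * f i0 + y) ^+ (m.-1 - i) * (c i0 * f i0) ^+ i).
  by rewrite subrXX; congr (_ * _); ring.
exists (fun i => if i == i0 then c i0 ^+ m else c i *
  (\sum_(i < m) (c i0 * f i0 + y) ^+ (m.-1 - i) * (c i0 * f i0) ^+ i)).
rewrite (bigD1 i0) //= eqxx ltnSn.
transitivity ((c i0 * f i0 + y) ^+ m); last by rewrite e expr1n.
rewrite -[RHS](subrK ((c i0 * f i0) ^+ m)) ez addrC exprMn; congr (_ + _).
rewrite /y mulr_suml; apply: eq_bigr => i ne; rewrite (negbTE ne).
have -> : (i < j.+1)%N = (i < j)%N.
  by rewrite ltnS leq_eqVlt -[(i : nat) == j]/(i == i0) (negbTE ne).
by ring.
Qed.

Lemma glue_unique A n (f : 'I_n -> A) (B : 'I_n -> kalg k) (l : forall i, khom A (B i)) :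
  unit_ideal (fun a => exists i, a = f i) -> (forall i, is_localization (l i) (f i)) ->
  forall a b, (forall i, l i a = l i b) -> a = b.
Proof.
move=> uf loc a b e.
have /choice [K hK] : forall i, exists K, f i ^+ K * (a - b) = 0.
  by move=> i; have [_ _ h] := loc i; apply: h; rewrite rmorphB e subrr.
have [c hc] := unit_idealX (\sum_i K i)%N uf.
apply/eqP; rewrite -subr_eq0 -[a - b]mul1r -hc mulr_suml; apply/eqP; apply: big1 => i _.
by rewrite (bigD1 i) //= addnC exprD -!mulrA hK !mulr0.
Qed.

(** The classical argument for the structure sheaf: x_i = a_i / f_i^M with a common exponent M, the
    cross differences are killed by (f_i f_j)^L, and a partition of unity in the f_i^(L + M)
    assembles the a_i. *)
Lemma glue_elements A n (f : 'I_n -> A) (B : 'I_n -> kalg k) (l : forall i, khom A (B i)) :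
  unit_ideal (fun a => exists i, a = f i) -> (forall i, is_localization (l i) (f i)) ->
  forall x : forall i, B i,
  (forall i j D (u : khom (B i) D) (v : khom (B j) D),
     (forall a, u (l i a) = v (l j a)) -> u (x i) = v (x j)) ->
  exists a, forall i, l i a = x i.
Proof.
move=> uf loc x xx.
have /choice [m hm] : forall i, exists m, exists a, l i (f i) ^+ m * x i = l i a.
  by move=> i; have [_ h _] := loc i; have [m [a e]] := h (x i); exists m, a.
pose M := (\sum_i m i)%N.
have /choice [a ha] : forall i, exists a, l i (f i) ^+ M * x i = l i a.
  move=> i; have [a e] := hm i; exists (f i ^+ (\sum_(j | j != i) m j)%N * a).
  by rewrite /M (bigD1 i) //= addnC exprD -mulrA e rmorphM rmorphXn.
have /choice [K hK] : forall ij : 'I_n * 'I_n, exists K,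
    (f ij.1 * f ij.2) ^+ K * (f ij.2 ^+ M * a ij.1 - f ij.1 ^+ M * a ij.2) = 0.
  move=> [i j] /=; have [D [q [[w hw] _ hker]]] := localization_exists (f i * f j).
  have [u hu] : exists u : khom (B i) D, forall a, u (l i a) = q a.
    apply: (localization_lift (h := q) (loc i)); exists (q (f j) * w).
    by rewrite mulrA -rmorphM.
  have [v hv] : exists v : khom (B j) D, forall a, v (l j a) = q a.
    apply: (localization_lift (h := q) (loc j)); exists (q (f i) * w).
    by rewrite mulrA -rmorphM mulrC [f j * _]mulrC -mulrC.
  apply: hker; rewrite rmorphB !rmorphM !rmorphXn -!hu -ha.
  rewrite [u (l i (f j))]hu -hv [u (l i (a j))]hu -[q (a j)]hv -ha.
  rewrite !rmorphM !rmorphXn hu hv (xx i j _ u v) ?hu ?hv; first by ring.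
  by move=> b; rewrite hu hv.
pose L := (\sum_ij K ij)%N.
have hL i j : (f i * f j) ^+ L * (f j ^+ M * a i - f i ^+ M * a j) = 0.
  by rewrite /L (bigD1 (i, j)) //= addnC exprD -mulrA (hK (i, j)) mulr0.
have [c hc] := unit_idealX (L + M) uf.
exists (\sum_j c j * (f j ^+ L * a j)) => i.
have e : f i ^+ (L + M) * (\sum_j c j * (f j ^+ L * a j)) = f i ^+ L * a i.
  rewrite -[RHS]mul1r -hc mulr_sumr mulr_suml; apply: eq_bigr => j _.
  apply/eqP; rewrite -subr_eq0; apply/eqP.
  transitivity (- c j * ((f i * f j) ^+ L * (f j ^+ M * a i - f i ^+ M * a j))).
    by rewrite exprMn !exprD; ring.
  by rewrite hL mulr0.
have [[w hw] _ _] := loc i.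
have hwX N : w ^+ N * l i (f i) ^+ N = 1 by rewrite -exprMn mulrC hw expr1n.
rewrite -[LHS]mul1r -(hwX (L + M)%N) -mulrA -rmorphXn -rmorphM e rmorphM rmorphXn -ha.
by rewrite [_ ^+ L * _]mulrA -exprD mulrA hwX mul1r.
Qed.
End Localization.

(** * The G-scheme X and its charts *)

Section FallingProducts.
Variables (k : fieldType) (A : kalg k).
Hypothesis char0 : [pchar k] =i pred0.

Lemma natr_diff_inv (m n : nat) : m <> n -> exists v : A, (m%:R - n%:R) * v = 1.
Proof.
wlog mn : m n / (n < m)%N.
  move=> hw /eqP mn; move: (mn); rewrite neq_ltn => /orP[nm|nm]; last first.
    by apply: hw => //; apply/eqP.
  have [|v e] := hw n m nm; first by apply/eqP; rewrite eq_sym.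
  by exists (- v); rewrite mulrN -mulNr opprB.
move=> _; rewrite -natrB ?(ltnW mn) //.
have nz : ((m - n)%N%:R : k) != 0.
  by rewrite ((pcharf0P k).1 char0) subn_eq0 -ltnNge.
exists (kstr A ((m - n)%N%:R^-1)).
by rewrite -(rmorph_nat (kstr A)) -rmorphM divff // rmorph1.
Qed.

Definition cprod (Q : pred nat) N (c : A) : A := \prod_(m < N | Q m) (c - m%:R).

Lemma cprod_recr Q N c :
  cprod Q N.+1 c = cprod Q N c * (if Q N then c - N%:R else 1).
Proof. by rewrite /cprod big_mkcond big_ord_recr /= -big_mkcond. Qed.

Lemma cprod_split n N c : (n < N)%N ->
  cprod predT N c = cprod (predC1 n) N c * (c - n%:R).
Proof.
by move=> nN; rewrite /cprod (bigD1 (Ordinal nN)) //= mulrC; congr (_ * _); apply: eq_bigl.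
Qed.

Lemma cprod_diff Q N c b : exists r, cprod Q N c = cprod Q N b + (c - b) * r.
Proof.
elim: N => [|N [r e]]; first by exists 0; rewrite /cprod !big_ord0 mulr0 addr0.
rewrite !cprod_recr e; case: ifP => _; last by exists r; rewrite !mulr1.
exists (cprod Q N b + r * (c - N%:R)); ring.
Qed.

Lemma cprod_inv (Q : pred nat) N n : (forall m, (m < N)%N -> Q m -> m <> n) ->
  exists v, cprod Q N n%:R * v = 1.
Proof.
elim: N => [|N IH] h; first by exists 1; rewrite /cprod big_ord0 mulr1.
have [m mN|v e] := IH; first by apply: h; apply: leq_trans mN _.
rewrite cprod_recr; case: ifP => QN; last by exists v; rewrite mulr1.
have [w ew] := natr_diff_inv (nesym (h N (ltnSn N) QN)).
by exists (v * w); rewrite mulrACA e ew mulr1.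
Qed.

(** Modulo x the product takes its value at n, a product of differences n - m, which are units in
    characteristic 0. *)
Lemma cprod_comax (Q : pred nat) N n (c x : A) : (forall m, (m < N)%N -> Q m -> m <> n) ->
  (exists r, c - n%:R = x * r) -> exists a b, a * x + b * cprod Q N c = 1.
Proof.
move=> h [r er]; have [v ev] := cprod_inv h; have [q eq] := cprod_diff Q N c n%:R.
exists (- v * r * q), v; rewrite eq er; rewrite -[RHS]ev; ring.
Qed.

Lemma comax_inj (x y a b : A) : (exists u v, u * x + v * y = 1) ->
  x * a = x * b -> y * a = y * b -> a = b.
Proof.
move=> [u [v e]] xe ye; rewrite -[a]mul1r -[b]mul1r -e !mulrDl -!mulrA.
by rewrite xe ye.
Qed.

End FallingProducts.

(** * The points of X as a union of affine stages *)

Section InfinitePlane.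
Variables (k : fieldType) (char0 : [pchar k] =i pred0) (S : Type).
Variable d : forall A : kalg k, (S -> A) -> A.
Hypothesis d_nat : forall A B (h : khom A B) s, h (d s) = d (h \o s).
Implicit Types A B : kalg k.

Lemma cprod_nat A B (h : khom A B) Q N c : h (cprod Q N c) = cprod Q N (h c).
Proof. by rewrite rmorph_prod; apply: eq_bigr => m _; rewrite rmorphB rmorph_nat. Qed.

Definition eventually (P : nat -> Prop) := exists N0, forall N, (N0 <= N)%N -> P N.

Lemma eventually2 (P Q R : nat -> Prop) : (forall N, P N -> Q N -> R N) ->
  eventually P -> eventually Q -> eventually R.
Proof.
move=> h [m hm] [n hn]; exists (maxn m n) => N; rewrite geq_max => /andP[mN nN].
exact: h (hm _ mN) (hn _ nN).
Qed.

(* X is the increasing union of the affine schemes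
   X_N = {(s, c, y) | d(s) y = c (c - 1) ... (c - N + 1)}, where X_N is the open
   subscheme of X_{N+1} reached by y |-> y (c - N).  A point is stored as (s, c)
   together with the germ at infinity of the sequence of its coordinates y. *)
Definition stage A (x : (S -> A) * A * (nat -> A)) N : Prop :=
  d x.1.1 * x.2 N = cprod predT N x.1.2 /\ x.2 N.+1 = x.2 N * (x.1.2 - N%:R).

Definition preplane A := {x : (S -> A) * A * (nat -> A) | eventually (stage x)}.

Definition plane_eq A (x y : preplane A) : Prop :=
  (sval x).1 = (sval y).1 /\ eventually (fun N => (sval x).2 N = (sval y).2 N).

Lemma plane_eq_refl A (x : preplane A) : plane_eq x x.
Proof. by split=> //; exists 0%N. Qed.
Lemma plane_eq_sym A (x y : preplane A) : plane_eq x y -> plane_eq y x.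
Proof. by case=> e [N0 h]; split=> //; exists N0 => N /h. Qed.
Lemma plane_eq_trans A (x y z : preplane A) : plane_eq x y -> plane_eq y z -> plane_eq x z.
Proof.
case=> e h [e' h']; split; first by rewrite e.
by apply: eventually2 h h' => N -> ->.
Qed.

Definition plane A := quo (@plane_eq A).

Lemma stage_le A (s : S -> A) c N M (y : A) : (N <= M)%N ->
  d s * y = cprod predT N c -> d s * (y * \prod_(N <= m < M) (c - m%:R)) = cprod predT M c.
Proof.
move=> NM e; rewrite mulrA e /cprod -!(big_mkord predT (fun m => c - m%:R)).
by rewrite -big_cat_nat.
Qed.

Lemma mk_plane_subproof A s c N (y : A) : d s * y = cprod predT N c ->
  eventually (stage (s, c, fun M => y * \prod_(N <= m < M) (c - m%:R))).
Proof.
move=> e; exists N => M NM; split => /=; last by rewrite big_nat_recr //= mulrA.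
exact: stage_le.
Qed.

Definition mk_preplane A s c N (y : A) (e : d s * y = cprod predT N c) : preplane A :=
  exist (fun x => eventually (stage x)) _ (mk_plane_subproof e).

Definition mk_plane A s c N (y : A) (e : d s * y = cprod predT N c) : plane A :=
  cls (@plane_eq A) (mk_preplane e).

(* u is the point (s, c, y) of X_N. *)
Definition rep_at A N s c (y : A) (u : plane A) : Prop := exists e, u = @mk_plane A s c N y e.

Lemma rep_at_intro A N s c (y : A) : d s * y = cprod predT N c -> exists u, rep_at N s c y u.
Proof. by move=> e; exists (mk_plane e), e. Qed.

Lemma rep_at_eqn A N s c (y : A) u : rep_at N s c y u -> d s * y = cprod predT N c.
Proof. by case. Qed.

Lemma rep_at_ex A (u : plane A) : eventually (fun N => exists s c y, rep_at N s c y u).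
Proof.
have [[[[s c] y] [N0 h]] ->] := clsP u; exists N0 => N N0N; exists s, c, (y N).
have [/= e _] := h N N0N; exists e; apply: cls_eq => //.
- exact: plane_eq_sym.
- exact: plane_eq_trans.
split=> //=; exists N => M; elim: M => [|M IH]; first by rewrite leqn0 => /eqP ->; rewrite big_geq ?mulr1.
rewrite leq_eqVlt => /predU1P[->|NM]; first by rewrite big_geq ?mulr1.
have [/= _ ->] := h M (leq_trans N0N NM).
by rewrite IH // big_nat_recr //= mulrA.
Qed.

(** The inclusion of X_N into X_{N+1} is a monomorphism: d(s) y is a unit modulo c - N, so d(s) and
    c - N are comaximal, and d(s) y together with y (c - N) determines y. *)
Lemma rep_at_unique A N s c (y : A) s' c' y' u :
  rep_at N s c y u -> rep_at N s' c' y' u -> [/\ s = s', c = c' & y = y'].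
Proof.
case=> e -> [e' h].
have [/= [es ec] [M hM]] := cls_inj (@plane_eq_refl A) h; case: _ / es in e' h hM *.
case: _ / ec in e' h hM *.
split=> //.
have {hM} : y * \prod_(N <= m < N + M) (c - m%:R) = y' * \prod_(N <= m < N + M) (c - m%:R).
  by have := hM (N + M)%N (leq_addl _ _).
elim: M => [|M IH]; first by rewrite addn0 big_geq // !mulr1.
rewrite addnS !big_nat_recr ?leq_addr //= !mulrA => eq; apply: IH.
set z := \prod_(_ <= _ < _) _ in eq *.
have hz : d s * (y * z) = cprod predT (N + M) c by apply: stage_le => //; apply: leq_addr.
apply: (@comax_inj _ _ (d s) (c - (N + M)%:R)); last by rewrite mulrC eq mulrC.
  have [||a [b uv]] := @cprod_comax k A char0 predT (N + M) (N + M) c (c - (N + M)%:R).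
  - by move=> m mNM _; apply/eqP; rewrite neq_ltn mNM.
  - by exists 1; rewrite mulr1.
  by exists (b * (y * z)), a; rewrite -[RHS]uv -hz; ring.
by rewrite !mulrA e e'.
Qed.

Lemma rep_at_inj A N s c (y : A) u v : rep_at N s c y u -> rep_at N s c y v -> u = v.
Proof. by case=> e -> [e' ->]; rewrite (Prop_irrelevance e e'). Qed.

Lemma rep_at_le A N M s c (y : A) u : (N <= M)%N -> rep_at N s c y u ->
  rep_at M s c (y * \prod_(N <= m < M) (c - m%:R)) u.
Proof.
move=> NM [e ->]; exists (stage_le NM e); apply: cls_eq.
- exact: plane_eq_sym.
- exact: plane_eq_trans.
split=> //=; exists M => L ML.
by rewrite -mulrA -big_cat_nat.
Qed.

Lemma eventually_ge N : eventually (fun M => N <= M)%N.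
Proof. by exists N. Qed.

Section Functoriality.
Variables (A B : kalg k) (h : khom A B).

Lemma preplane_map_subproof (x : preplane A) :
  eventually (stage (h \o (sval x).1.1, h (sval x).1.2, fun N => h ((sval x).2 N))).
Proof.
case: x => [[[s c] y] /= [N0 hx]]; exists N0 => N /hx [/= e1 e2]; split=> /=.
  by rewrite -d_nat -rmorphM e1 cprod_nat.
by rewrite e2 rmorphM rmorphB rmorph_nat.
Qed.

Definition preplane_map (x : preplane A) : preplane B :=
  exist (fun x => eventually (stage x)) _ (preplane_map_subproof x).

Lemma preplane_map_eq x y : plane_eq x y -> plane_eq (preplane_map x) (preplane_map y).
Proof.
case=> /= e [N0 he]; rewrite /plane_eq /= e; split=> //.
by exists N0 => N /he ->.
Qed.

Definition plane_map (u : plane A) : plane B := cls (@plane_eq B) (preplane_map (rep u)).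

Lemma plane_mapE x : plane_map (cls _ x) = cls _ (preplane_map x).
Proof.
apply: cls_eq.
- exact: plane_eq_sym.
- exact: plane_eq_trans.
by apply: preplane_map_eq; apply: rep_cls; apply: plane_eq_refl.
Qed.

Lemma rep_at_map N s c y u : rep_at N s c y u -> rep_at N (h \o s) (h c) (h y) (plane_map u).
Proof.
case=> e ->.
have e' : d (h \o s) * h y = cprod predT N (h c) by rewrite -d_nat -rmorphM e cprod_nat.
exists e'; rewrite plane_mapE; apply: cls_eq.
- exact: plane_eq_sym.
- exact: plane_eq_trans.
split=> //=; exists 0%N => M _.
rewrite rmorphM rmorph_prod; congr (_ * _).
by apply: eq_bigr => m _; rewrite rmorphB rmorph_nat.
Qed.
End Functoriality.

Section Action.
Variables (A : kalg k) (a : S -> S).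
Hypothesis d_inv : forall s : S -> A, d (s \o a) = d s.

Lemma preplane_act_subproof (x : preplane A) :
  eventually (stage ((sval x).1.1 \o a, (sval x).1.2, (sval x).2)).
Proof. by case: x => [[[s c] y] /= [N0 hx]]; exists N0 => N /hx; rewrite /stage /= d_inv. Qed.

Definition preplane_act (x : preplane A) : preplane A :=
  exist (fun x => eventually (stage x)) _ (preplane_act_subproof x).

Definition plane_act (u : plane A) : plane A := cls (@plane_eq A) (preplane_act (rep u)).

Lemma plane_actE x : plane_act (cls _ x) = cls _ (preplane_act x).
Proof.
apply: cls_eq.
- exact: plane_eq_sym.
- exact: plane_eq_trans.
have [/= e h] := rep_cls (@plane_eq_refl A) x.
by rewrite /plane_eq /= e.
Qed.

Lemma rep_at_act N s c y u : rep_at N s c y u -> rep_at N (s \o a) c y (plane_act u).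
Proof.
case=> e ->; have e' : d (s \o a) * y = cprod predT N c by rewrite d_inv.
exists e'; rewrite plane_actE; apply: cls_eq.
- exact: plane_eq_sym.
- exact: plane_eq_trans.
exact: plane_eq_refl.
Qed.
End Action.

End InfinitePlane.

(** * Affine schemes of finite type given by closed conditions on tuples *)

Section AffineFunctors.
Variables (k : fieldType) (T : finType).
Implicit Types A B R : kalg k.
Variable C : forall A, (T -> A) -> Prop.
Hypothesis C_map : forall A B (h : khom A B) p, C p -> C (h \o p).
(** Closed conditions, such as equations between coordinates, have this property: if the maps out of
    A that enforce the condition separate the elements of A, it holds over A. It serves both to glue
    points and to see that the generic tuple is a point. *)
Hypothesis C_local : forall A (p : T -> A),
  (forall a b : A, (forall B (h : khom A B), C (h \o p) -> h a = h b) -> a = b) -> C p.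

Definition aff : kfunctor k.
Proof.
exists (fun A => {p : T -> A | C p})
  (fun A B (h : khom A B) (p : {p : T -> A | C p}) =>
     exist _ (h \o sval p) (C_map h (svalP p))).
- by move=> A [p Cp]; apply: eq_exist.
- by move=> A B D g f [p Cp]; apply: eq_exist.
Defined.

Lemma aff_eq A (p q : aff A) : (forall t, sval p t = sval q t) -> p = q.
Proof. by case: p q => [p hp] [q hq] /= /funext e; apply: eq_exist. Qed.

Lemma aff_sheaf : zariski_sheaf aff.
Proof.
move=> A n f uf B l loc x xx.
have /choice [p hp] : forall t, exists a, forall i, l i a = sval (x i) t.
  move=> t; apply: (glue_elements uf loc) => i j D u v uv.
  exact: (congr1 (fun q => sval q t) (xx i j D u v uv)).
have pE i : l i \o p = sval (x i) by apply: funext => t; apply: hp.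
have Cp : C p.
  apply: C_local => a b ab; apply: (glue_unique uf loc) => i; apply: ab.
  by rewrite pE; apply: (svalP (x i)).
exists (exist _ p Cp); split=> [i|q hq].
  by apply: aff_eq => t; apply: hp.
apply: aff_eq => t; apply: (glue_unique uf loc) => i /=.
by rewrite hp -hq.
Qed.

Lemma aff_represented : exists R u, represented_by (fun A (_ : aff A) => True) (R := R) u /\
  finitely_generated R.
Proof.
have [R [u [lift inj gen]]] := universal_algebra C.
have Cu : C u by apply: C_local => a b h; apply: inj.
exists R, (exist _ u Cu); split; last first.
  exists #|T|, (fun i => u (enum_val i)) => P Pc Pu; apply: gen => // t.
  by rewrite -(enum_rankK t).
split=> // A p _; have [h hh] := lift _ _ (svalP p).
exists h; split=> [|g eg]; first by apply: aff_eq => t; apply: hh.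
apply: khom_eq => a; apply/eqP; rewrite -subr_eq0; apply/eqP.
apply: (gen (fun a => h a - g a = 0)) => {a} [c|t|a b ea eb|a b ea eb].
- by rewrite !kfun_str subrr.
- by rewrite hh -[g (u t)]/(sval (ap aff g (exist _ u Cu)) t) eg subrr.
- by rewrite !rmorphD opprD addrACA ea eb addr0.
- move/eqP: ea; rewrite subr_eq0 => /eqP ea; move/eqP: eb; rewrite subr_eq0 => /eqP eb.
  by rewrite !rmorphM ea eb subrr.
Qed.

Lemma whole_open (X : kfunctor k) : open_subfunctor (fun A (_ : X A) => True).
Proof.
move=> A x; exists (fun=> True) => B h; split=> // _.
exists 1%N, (fun=> 1), (fun=> 1); rewrite big_ord1 mulr1; split=> // _.
by exists 1; rewrite ?rmorph1.
Qed.

Lemma aff_covered : covered_by_affines (@finitely_generated k) aff.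
Proof.
move=> K x _; have [R [u [hu fg]]] := aff_represented.
by exists (fun A _ => True), R, u; split=> //; apply: whole_open.
Qed.

Lemma aff_separated : separated aff.
Proof.
move=> A p q; exists (fun a => exists t, a = sval p t - sval q t) => B h; split.
  move=> e a [t ->]; rewrite rmorphB.
  have := congr1 (fun r => sval r t) e; rewrite /= => ->; exact: subrr.
move=> h0; apply: aff_eq => t /=; apply/eqP; rewrite -subr_eq0 -rmorphB; apply/eqP.
by apply: h0; exists t.
Qed.

End AffineFunctors.

Lemma covered_weaken (k : fieldType) (P : kalg k -> Prop) (X : kfunctor k) :
  covered_by_affines P X -> covered_by_affines (fun=> True) X.
Proof. by move=> h K x /(h K x) [U [R [u [oU rU _ Ux]]]]; exists U, R, u. Qed.

Section AffineActions.
Variables (k : fieldType) (G : finGroupType) (T : finType).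
Variable C : forall A : kalg k, (T -> A) -> Prop.
Hypothesis C_map : forall (A B : kalg k) (h : khom A B) (p : T -> A), C p -> C (h \o p).
Variable b : G -> T -> T.
Hypotheses (b1 : forall x, b 1%g x = x) (bM : forall g h x, b (g * h)%g x = b h (b g x))
  (C_act : forall (A : kalg k) (p : T -> A) g, C p -> C (p \o b g)).

(** The index set carries a right action b, so that precomposition is a left action on points. *)
Definition gaff : gfunctor k G.
Proof.
exists (aff C_map) (fun A g p => exist _ (sval p \o b g) (C_act g (svalP p))).
- by move=> A p; apply: aff_eq => t /=; rewrite b1.
- by move=> A g h p; apply: aff_eq => t /=; rewrite bM.
- by move=> A B f g p; apply: aff_eq.
Defined.

Hypothesis C_local : forall (A : kalg k) (p : T -> A),
  (forall a b : A, (forall B (h : khom A B), C (h \o p) -> h a = h b) -> a = b) -> C p.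
Hypothesis C_smooth : formally_smooth (aff C_map).

Definition gaff_sm : gsm k G.
Proof.
exists gaff.
- split; first exact: aff_sheaf.
  by apply: covered_weaken; apply: aff_covered.
- exact: aff_separated.
- by split; first exact: aff_covered.
Defined.
End AffineActions.

Section Objects.
Variables (k : fieldType) (char0 : [pchar k] =i pred0) (G : finGroupType) (S : finType).
Implicit Types A B : kalg k.
Variable a : G -> S -> S.
Hypotheses (a1 : forall x, a 1%g x = x) (aM : forall g h x, a (g * h)%g x = a h (a g x)).
Variable d : forall A : kalg k, (S -> A) -> A.
Hypotheses (d_nat : forall A B (h : khom A B) s, h (d s) = d (h \o s))
  (d_inv : forall A g (s : S -> A), d (s \o a g) = d s).

Lemma thickening_lift A B (h : khom A B) (T : Type) (p : T -> B) :
  thickening h -> exists q : T -> A, h \o q = p.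
Proof.
move=> [surj _]; have /choice [q hq] : forall t, exists x, h x = p t by move=> t; apply: surj.
by exists q; apply: funext.
Qed.

Definition chart_cond A (_ : option S -> A) : Prop := True.

Lemma chart_smooth : formally_smooth (aff (C := chart_cond) (fun _ _ _ _ c => c)).
Proof.
move=> A B h th [p hp]; have [q hq] := thickening_lift p th.
by exists (exist _ q hp); apply: eq_exist.
Qed.

(* A point of U is a pair (s, y), stored as y = p None and s = p \o Some. *)
Definition chart : gsm k G := @gaff_sm k G _ chart_cond (fun _ _ _ _ c => c)
  (fun g => omap (a g)) (fun x => ltac:(by case: x => //= x; rewrite a1))
  (fun g h x => ltac:(by case: x => //= x; rewrite aM)) (fun _ _ _ c => c)
  (fun _ _ _ => Logic.I) chart_smooth.

(* A point of W is a triple (s, e, c) with d(s) e = 1, stored as c = p None,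
   e = p (Some None) and s = p \o Some \o Some. *)
Definition overlap_cond A (p : option (option S) -> A) : Prop :=
  d (p \o Some \o Some) * p (Some None) = 1.

Lemma overlap_map A B (h : khom A B) (p : option (option S) -> A) :
  overlap_cond p -> overlap_cond (h \o p).
Proof. by rewrite /overlap_cond => e; rewrite -(d_nat h (p \o Some \o Some)) -rmorphM e rmorph1. Qed.

Lemma overlap_local A (p : option (option S) -> A) :
  (forall a b : A, (forall B (h : khom A B), overlap_cond (h \o p) -> h a = h b) -> a = b) ->
  overlap_cond p.
Proof. by move=> h; apply: h => B f; rewrite rmorph1 rmorphM d_nat. Qed.

Lemma overlap_act A (p : option (option S) -> A) g :
  overlap_cond p -> overlap_cond (p \o omap (omap (a g))).
Proof. by rewrite /overlap_cond -(d_inv g). Qed.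

Lemma overlap_smooth : formally_smooth (aff overlap_map).
Proof.
move=> A B h th [p hp]; have [q hq] := thickening_lift p th; have [_ sq0] := th.
case: _ / hq in hp *.
pose x := d (q \o Some \o Some); pose e := q (Some None).
have he : h (x * e - 1) = 0.
  by rewrite rmorphB rmorph1 rmorphM d_nat -[X in _ - X]hp subrr.
(* One Newton step for the inverse of x: since (x e - 1)^2 = 0, the corrected value e (2 - x e) is
   an exact inverse. *)
pose q' t := if t is Some None then e * (2%:R - x * e) else q t.
have hq' : overlap_cond q'.
  have /= := sq0 _ _ he he; rewrite /overlap_cond -[d _]/x /= => e0.
  apply/eqP; rewrite -subr_eq0; apply/eqP; rewrite -[RHS]oppr0 -e0; ring.
exists (exist _ q' hq'); apply: eq_exist => /=; apply: funext => -[[t|]|] //=.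
rewrite rmorphM (_ : h (2%:R - x * e) = 1) ?mulr1 //.
by move/eqP: he; rewrite rmorphB rmorph1 subr_eq0 => /eqP e1; rewrite rmorphB e1 rmorph_nat; ring.
Qed.

Definition overlap : gsm k G := @gaff_sm k G _ overlap_cond overlap_map
  (fun g => omap (omap (a g))) (fun x => ltac:(by case: x => [[x|]|] //=; rewrite a1))
  (fun g h x => ltac:(by case: x => [[x|]|] //=; rewrite aM)) overlap_act
  overlap_local overlap_smooth.
End Objects.

Section Newton.
Variables (k : fieldType) (A : kalg k).
Hypothesis char0 : [pchar k] =i pred0.

Fixpoint cprod_deriv N (c : A) : A :=
  if N is N'.+1 then cprod_deriv N' c * (c - N'%:R) + cprod predT N' c else 0.

Lemma cprod_taylor N (c x : A) : x * x = 0 ->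
  cprod predT N (c + x) = cprod predT N c + x * cprod_deriv N c.
Proof.
move=> x2; elim: N => [|N IH]; first by rewrite /cprod !big_ord0 mulr0 addr0.
rewrite !cprod_recr /= IH.
transitivity (cprod predT N c * (c - N%:R) +
  x * (cprod_deriv N c * (c - N%:R) + cprod predT N c) + x * x * cprod_deriv N c); first by ring.
by rewrite x2 mul0r addr0.
Qed.

(** The roots 0, ..., N - 1 are distinct in characteristic 0. This is the Jacobian criterion behind
    the smoothness of X_N. *)
Lemma cprod_separable N (c : A) :
  exists u v, u * cprod predT N c + v * cprod_deriv N c = 1.
Proof.
elim: N => [|N [u [v e]]]; first by exists 1, 0; rewrite /cprod big_ord0 mul0r addr0 mulr1.
have [||x [y xy]] := @cprod_comax k A char0 predT N N c (c - N%:R).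
- by move=> m mN _; apply/eqP; rewrite neq_ltn mN.
- by exists 1; rewrite mulr1.
rewrite cprod_recr /=; set P := cprod predT N c in e xy *; set D := cprod_deriv N c in e *.
set l := c - N%:R in xy *.
(* Grouping the expansion of (x l + y P)^3 = 1 as l^2 X + P^2 Y shows that l^2 and P^2 are
   comaximal. Both lie in the ideal generated by P l and its derivative D l + P: l^2 = (u l - v) P l
   + v l (D l + P) and P^2 = - D P l + P (D l + P). *)
pose X := x ^+ 3 * l + 3%:R * x ^+ 2 * (y * P).
pose Y := 3%:R * x * y ^+ 2 * l + y ^+ 3 * P.
exists ((u * l - v) * X - D * Y), (v * l * X + P * Y).
transitivity (l ^+ 2 * (u * P + v * D) * X + P ^+ 2 * Y); first by ring.
rewrite e mulr1; transitivity ((x * l + y * P) ^+ 3); first by rewrite /X /Y; ring.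
by rewrite xy expr1n.
Qed.

End Newton.

Lemma unit_ideal_pair (k : fieldType) (A B : kalg k) (h : khom A B) (x y : A) :
  unit_ideal (fun b => exists2 a, a = x \/ a = y & b = h a) <->
  exists u v, u * h x + v * h y = 1.
Proof.
split=> [[n [s [c [hs <-]]]]|[u [v e]]].
  apply: (big_ind (fun z => exists u v, u * h x + v * h y = z)).
  - by exists 0, 0; rewrite !mul0r addr0.
  - move=> _ _ [u [v <-]] [u' [v' <-]]; exists (u + u'), (v + v'); ring.
  - move=> i _; have [a [->|->] ->] := hs i.
      by exists (c i), 0; rewrite mul0r addr0.
    by exists 0, (c i); rewrite mul0r add0r.
exists 2%N, (fun i : 'I_2 => if i == ord0 then h x else h y), (fun i : 'I_2 => if i == ord0 then u else v).
split=> [i|]; last by rewrite big_ord_recl big_ord1.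
by case: eqP => _; [exists x; [left|]|exists y; [right|]].
Qed.

Lemma dep_choice (I : Type) (T : I -> Type) (P : forall i, T i -> Prop) :
  (forall i, exists y, P i y) -> exists f, forall i, P i (f i).
Proof. by move=> h; exists (fun i => sval (cid (h i))) => i; case: cid. Qed.

Lemma eventually_and (P Q : nat -> Prop) :
  eventually P -> eventually Q -> exists N, P N /\ Q N.
Proof.
move=> p q; have [N h] := eventually2 (fun N => @conj (P N) (Q N)) p q.
by exists N; apply: h.
Qed.

Lemma eventually_fin (n : nat) (P : 'I_n -> nat -> Prop) :
  (forall i, eventually (P i)) -> eventually (fun N => forall i, P i N).
Proof.
move=> /choice [b hb]; exists (\max_i b i)%N => N hN i; apply: hb.
by apply: leq_trans hN; apply: leq_bigmax.
Qed.

(** * X as a separated and formally smooth sheaf with G-action *)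

Section Plane.
Variables (k : fieldType) (char0 : [pchar k] =i pred0) (G : finGroupType) (S : finType).
Implicit Types A B : kalg k.
Variable a : G -> S -> S.
Hypotheses (a1 : forall x, a 1%g x = x) (aM : forall g h x, a (g * h)%g x = a h (a g x)).
Variable d : forall A : kalg k, (S -> A) -> A.
Hypotheses (d_nat : forall A B (h : khom A B) s, h (d s) = d (h \o s))
  (d_inv : forall A g (s : S -> A), d (s \o a g) = d s).

Definition plane_kfun : kfunctor k.
Proof.
exists (plane d) (fun A B h => plane_map d_nat h).
- move=> A u; have [N0 /(_ N0 (leqnn _)) [s [c [y h]]]] := rep_at_ex u.
  exact: rep_at_inj (rep_at_map d_nat (khom_id A) h) h.
- move=> A B C g f u; have [N0 /(_ N0 (leqnn _)) [s [c [y h]]]] := rep_at_ex u.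
  exact: rep_at_inj (rep_at_map d_nat (khom_comp g f) h) (rep_at_map d_nat g (rep_at_map d_nat f h)).
Defined.

Definition plane_gfun : gfunctor k G.
Proof.
exists plane_kfun (fun A g => plane_act (d_inv (A := A) g)).
- move=> A u; have [N0 /(_ N0 (leqnn _)) [s [c [y h]]]] := rep_at_ex u.
  apply: rep_at_inj (rep_at_act (d_inv 1%g) h) _.
  by rewrite (_ : s \o a 1%g = s) //; apply: funext => x /=; rewrite a1.
- move=> A g h u; have [N0 /(_ N0 (leqnn _)) [s [c [y hu]]]] := rep_at_ex u.
  apply: rep_at_inj (rep_at_act (d_inv (g * h)%g) hu) _.
  rewrite (_ : s \o a (g * h)%g = (s \o a h) \o a g); last by apply: funext => x /=; rewrite aM.
  exact: rep_at_act (rep_at_act _ hu).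
- move=> A B f g u; have [N0 /(_ N0 (leqnn _)) [s [c [y h]]]] := rep_at_ex u.
  exact: rep_at_inj (rep_at_map d_nat f (rep_at_act (d_inv g) h)) (rep_at_act (d_inv g) (rep_at_map d_nat f h)).
Defined.

(** The covering is finite, so all local points lie in one stage X_N, where the coordinates s, c, y
    are unique and hence glue. *)
Lemma plane_sheaf : zariski_sheaf plane_kfun.
Proof.
move=> A n f uf B l loc x xx.
have [N /(_ N (leqnn N)) /dep_choice [s /dep_choice [c /dep_choice [y hy]]]] :=
  eventually_fin (fun i => rep_at_ex (x i)).
have rep i j D (u : khom (B i) D) (v : khom (B j) D) : (forall a, u (l i a) = v (l j a)) ->
    [/\ u \o s i = v \o s j, u (c i) = v (c j) & u (y i) = v (y j)].
  move=> uv; apply: (rep_at_unique char0 (rep_at_map d_nat u (hy i))).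
  rewrite [plane_map _ _ _](xx i j D u v uv); exact: rep_at_map.
have /choice [s0 hs0] : forall t, exists b, forall i, l i b = s i t.
  move=> t; apply: (glue_elements uf loc) => i j D u v /rep [e _ _].
  exact: (congr1 (fun q => q t) e).
have [c0 hc0] : exists b, forall i, l i b = c i.
  by apply: (glue_elements uf loc) => i j D u v /rep [].
have [y0 hy0] : exists b, forall i, l i b = y i.
  by apply: (glue_elements uf loc) => i j D u v /rep [].
have e0 : d s0 * y0 = cprod predT N c0.
  apply: (glue_unique uf loc) => i; rewrite rmorphM d_nat cprod_nat hc0 hy0.
  by rewrite (_ : l i \o s0 = s i) ?(rep_at_eqn (hy i)) //; apply: funext => t; apply: hs0.
have [u hu] := rep_at_intro e0.
exists u; split=> [i|v hv].
  apply: rep_at_inj (rep_at_map d_nat (l i) hu) _.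
  rewrite hc0 hy0 (_ : l i \o s0 = s i) //; apply: funext => t; exact: hs0.
have [M [[s' [c' [y' h']]] NM]] := eventually_and (rep_at_ex v) (eventually_ge N).
have hu' := rep_at_le NM hu.
have E i : [/\ l i \o s' = l i \o s0, l i c' = l i c0 &
    l i y' = l i (y0 * \prod_(N <= m < M) (c0 - m%:R))].
  apply: (rep_at_unique char0 (rep_at_map d_nat (l i) h')).
  rewrite [plane_map _ _ _]hv.
  suff <- : plane_map d_nat (l i) u = x i by apply: rep_at_map.
  apply: rep_at_inj (rep_at_map d_nat (l i) hu) _.
  rewrite hc0 hy0 (_ : l i \o s0 = s i) //; apply: funext => t; exact: hs0.
apply: rep_at_inj hu' _.
have <- : s' = s0.
  apply: funext => t; apply: (glue_unique uf loc) => i.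
  by have [e _ _] := E i; apply: (congr1 (fun q => q t) e).
have <- : y' = y0 * \prod_(N <= m < M) (c0 - m%:R).
  by apply: (glue_unique uf loc) => i; have [] := E i.
suff <- : c' = c0 by [].
by apply: (glue_unique uf loc) => i; have [] := E i.
Qed.

Lemma plane_separated : separated plane_kfun.
Proof.
move=> A u v; have [N [[s [c [y hu]]] [s' [c' [y' hv]]]]] := eventually_and (rep_at_ex u) (rep_at_ex v).
exists (fun b => [\/ exists t, b = s t - s' t, b = c - c' | b = y - y']) => B h.
have hu' := rep_at_map d_nat h hu; have hv' := rep_at_map d_nat h hv.
split=> [e b|h0].
  move: hu'; rewrite [plane_map _ _ _]e => /(rep_at_unique char0 hv') [es ec ey].
  case=> [[t ->]|->|->]; rewrite rmorphB; apply/eqP; rewrite subr_eq0 eq_sym; apply/eqP => //.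
  exact: (congr1 (fun q => q t) es).
have sub b b' : h (b - b') = 0 -> h b = h b'.
  by rewrite rmorphB => /eqP; rewrite subr_eq0 => /eqP.
apply: rep_at_inj hu' _.
rewrite (sub c c'); last by apply: h0; constructor 2.
rewrite (sub y y'); last by apply: h0; constructor 3.
rewrite (_ : h \o s = h \o s') //; apply: funext => t; apply: sub; apply: h0.
by constructor 1; exists t.
Qed.

Lemma plane_smooth : formally_smooth plane_kfun.
Proof.
move=> A B h th v; have [N /(_ N (leqnn N)) [s' [c' [y' hv]]]] := rep_at_ex v.
have [s hs] := thickening_lift s' th; have [surj sq0] := th.
have [c hc] := surj c'; have [y hy] := surj y'.
pose e := cprod predT N c - d s * y.
have he : h e = 0.
  by rewrite rmorphB rmorphM cprod_nat d_nat hs hc hy (rep_at_eqn hv) subrr.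
have ee : e * e = 0 by apply: sq0.
(* With p P(c) + q P'(c) = 1, the corrections - q e of c and p y e of y remove the error e, all
   terms in e^2 being 0. *)
have [p [q pq]] := cprod_separable char0 N c.
have e0 : d s * (y + p * y * e) = cprod predT N (c + (- q * e)).
  rewrite cprod_taylor; last by rewrite mulrACA ee mulr0.
  have -> : cprod predT N c = d s * y + e by rewrite /e addrC subrK.
  transitivity (d s * y + (p * cprod predT N c + q * cprod_deriv N c) * e
    - q * e * cprod_deriv N c - p * (e * e)); first by rewrite /e; ring.
  by rewrite pq ee; ring.
have [u hu] := rep_at_intro e0; exists u.
apply: rep_at_inj (rep_at_map d_nat h hu) _.
by rewrite !rmorphD !rmorphM he !mulr0 !addr0 hs hc hy.
Qed.
End Plane.

Lemma gmap_eq (k : fieldType) (G : finGroupType) (X Y : gfunctor k G) (f g : gmap X Y) :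
  (forall A (x : X A), f A x = g A x) -> f = g.
Proof.
case: f g => [f hf] [g hg] /= /kmap_eq e.
by case: _ / e hg => hg; congr GMap; apply: Prop_irrelevance.
Qed.

(** * The charts as open subschemes covering X *)

Section Charts.
Variables (k : fieldType) (char0 : [pchar k] =i pred0) (G : finGroupType) (S : finType).
Implicit Types A B : kalg k.
Variable a : G -> S -> S.
Hypotheses (a1 : forall x, a 1%g x = x) (aM : forall g h x, a (g * h)%g x = a h (a g x)).
Variable d : forall A : kalg k, (S -> A) -> A.
Hypotheses (d_nat : forall A B (h : khom A B) s, h (d s) = d (h \o s))
  (d_inv : forall A g (s : S -> A), d (s \o a g) = d s).

Let X := plane_gfun a1 aM d_nat d_inv.
Let U := chart k a1 aM.
Let W := overlap a1 aM d_nat d_inv.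

Lemma chart_eqn n A (s : S -> A) y c : d s * y = c - n%:R ->
  d s * (y * cprod (predC1 n) n.+1 c) = cprod predT n.+1 c.
Proof. by move=> e; rewrite (@cprod_split _ _ n) // mulrA e mulrC. Qed.

Lemma chart_c n A (s : S -> A) (y : A) : d s * y = n%:R + d s * y - n%:R.
Proof. by rewrite addrAC subrr add0r. Qed.

(** The chart sends (s, y) to the point with c = n + d(s) y; in a stage X_N with n < N the last
    coordinate is y times the product of the c - m over m <> n. *)
Definition chart_pt n A (p : U A) : X A := mk_plane (chart_eqn (chart_c n (sval p \o Some) (sval p None))).

Lemma chart_rep n N A (p : U A) s y c : (n < N)%N -> sval p \o Some = s -> sval p None = y ->
  d s * y = c - n%:R -> rep_at N s c (y * cprod (predC1 n) N c) (chart_pt n p).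
Proof.
move=> nN <- <- e; have {e}-> : c = n%:R + d (sval p \o Some) * sval p None by rewrite e addrC subrK.
have h : rep_at n.+1 _ _ _ (chart_pt n p) := ex_intro _ (chart_eqn (chart_c n _ _)) erefl.
have := rep_at_le nN h; set c' := n%:R + _.
suff -> : sval p None * cprod (predC1 n) n.+1 c' * \prod_(n.+1 <= m < N) (c' - m%:R) =
  sval p None * cprod (predC1 n) N c' by [].
elim: N nN {h} => [//|N IH]; rewrite ltnS leq_eqVlt => /predU1P[->|nN].
  by rewrite big_geq // mulr1.
rewrite big_nat_recr //= [in RHS]cprod_recr /= !mulrA IH //.
by rewrite neq_ltn nN orbT.
Qed.

(** The point of X knows d(s) y = c - n and the product of y with the factors c - m for m <> n;
    these two multipliers of y are comaximal. *)
Lemma chart_inj n A (p q : U A) : chart_pt n p = chart_pt n q -> p = q.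
Proof.
move=> e.
have hp := chart_rep (ltnSn n) (erefl (sval p \o Some)) (erefl (sval p None)) (chart_c n _ _).
have hq := chart_rep (ltnSn n) (erefl (sval q \o Some)) (erefl (sval q None)) (chart_c n _ _).
rewrite e in hp; have [es ec ey] := rep_at_unique char0 hp hq.
have ey0 : sval p None = sval q None.
  apply: (@comax_inj _ _ (d (sval q \o Some)) (cprod (predC1 n) n.+1 (n%:R + d (sval q \o Some) * sval q None))).
  - apply: (cprod_comax char0 (n := n)) => [m _ /eqP //|].
    by exists (sval q None); rewrite -chart_c.
  - by have := ec; rewrite es => /addrI.
  - by rewrite mulrC -{1}ec ey mulrC.
by apply: aff_eq => -[t|//]; apply: (congr1 (fun q => q t) es).
Qed.

Definition chart_map (n : nat) : gmap U X.
Proof.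
unshelve eexists.
- exists (fun A => @chart_pt n A) => A B h p q <-.
  have hp := chart_rep (ltnSn n) (erefl (sval p \o Some)) (erefl (sval p None)) (chart_c n _ _).
  apply: rep_at_inj (rep_at_map d_nat h hp) _.
  rewrite rmorphM cprod_nat; apply: chart_rep => //.
  by rewrite rmorphD rmorph_nat rmorphM d_nat -chart_c.
- move=> A g p q <- /=.
  have hp := chart_rep (ltnSn n) (erefl (sval p \o Some)) (erefl (sval p None)) (chart_c n _ _).
  apply: rep_at_inj (rep_at_act (d_inv g) hp) _.
  by apply: chart_rep => //; rewrite d_inv -chart_c.
Defined.

Definition pair_pt A (s : S -> A) (y : A) : U A :=
  exist (fun p => chart_cond p) (fun t => if t is Some x then s x else y) Logic.I.

(** In X_N the locus d(s) = 0 is the disjoint union of its parts c = m with m < N, and the n-th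
    chart omits exactly the parts with m <> n. *)
Lemma chart_imageP n N A s c y (u : X A) : (n < N)%N -> rep_at N s c y u ->
  (exists p : U A, chart_map n A p = u) <->
  exists v w, v * d s + w * cprod (predC1 n) N c = 1.
Proof.
move=> nN hu; split=> [[p ep]|[v [w e]]].
  have hp := chart_rep nN (erefl (sval p \o Some)) (erefl (sval p None)) (chart_c n _ _).
  rewrite /= in ep; rewrite ep in hp; have [es ec _] := rep_at_unique char0 hp hu.
  apply: (cprod_comax char0 (n := n)) => [m _ /eqP //|].
  by exists (sval p None); rewrite -ec -es -chart_c.
pose Q := cprod (predC1 n) N c; rewrite -/Q in e.
have ed : d s * y = Q * (c - n%:R) by rewrite (rep_at_eqn hu) (cprod_split _ nN).
(* The equations d(s) y0 = c - n and Q y0 = y, combined through v d(s) + w Q = 1, force this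
   value. *)
pose y0 := v * (c - n%:R) + w * y.
have e1 : d s * y0 = c - n%:R.
  transitivity ((v * d s + w * Q) * (c - n%:R)); last by rewrite e mul1r.
  by rewrite mulrDl -[w * Q * _]mulrA -ed /y0; ring.
exists (pair_pt s y0) => /=; apply: rep_at_inj hu.
have -> : y = y0 * Q.
  transitivity ((v * d s + w * Q) * y); first by rewrite e mul1r.
  by rewrite /y0 mulrDl -mulrA ed; ring.
exact: chart_rep.
Qed.

Lemma chart_image_open n : open_subfunctor (fun A (u : X A) => exists p : U A, chart_map n A p = u).
Proof.
move=> A u; have [N [[s [c [y hu]]] nN]] := eventually_and (rep_at_ex u) (eventually_ge n.+1).
exists (fun b => b = d s \/ b = cprod (predC1 n) N c) => B h.
rewrite unit_ideal_pair d_nat cprod_nat.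
exact: (chart_imageP nN (rep_at_map d_nat h hu)).
Qed.

(** Over a field either d(s) is invertible and every chart contains the point, or the product of the
    c - m vanishes and c is one of the integers below N. *)
Lemma chart_images_cover (K : kalg k) (u : X K) : is_field K -> exists n p, chart_map n K p = u.
Proof.
move=> [K01 Kinv].
have [N [[s [c [y hu]]] N0]] := eventually_and (rep_at_ex u) (eventually_ge 1).
suff [n nN [v [w e]]] : exists2 n, (n < N)%N & exists v w, v * d s + w * cprod (predC1 n) N c = 1.
  by exists n; apply/(chart_imageP nN hu); exists v, w.
have [d0|/Kinv [b db]] := pselect (d s = 0); last first.
  by exists 0%N => //; exists b, 0; rewrite mul0r addr0 mulrC.
have P0 : cprod predT N c = 0 by rewrite -(rep_at_eqn hu) d0 mul0r.
have [[n [nN ecn]]|no] := pselect (exists n, (n < N)%N /\ c = n%:R).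
  exists n => //; apply: (cprod_comax char0 (n := n)) => [m _ /eqP //|].
  by exists 0; rewrite ecn subrr mulr0.
suff [z cz] : exists z, cprod predT N c * z = 1.
  by case: K01; rewrite -cz P0 mul0r.
elim: N no {hu N0 P0} => [|N IH] no; first by exists 1; rewrite /cprod big_ord0 mulr1.
have [|z ez] := IH; first by case=> n [nN e]; apply: no; exists n; rewrite (leq_trans nN).
have [|b cb] := Kinv (c - N%:R).
  by move/eqP; rewrite subr_eq0 => /eqP e; apply: no; exists N.
by exists (z * b); rewrite cprod_recr /= mulrACA ez cb mulr1.
Qed.

Lemma plane_covered : covered_by_affines (@finitely_generated k) X.
Proof.
move=> K u /(chart_images_cover u) [n [p ep]].
have [R [x [[_ rx] fg]]] := @aff_represented k (option S) (@chart_cond k S) (fun _ _ _ _ c => c) (fun _ _ _ => Logic.I).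
exists (fun A (v : X A) => exists q : U A, chart_map n A q = v), R, (chart_map n R x).
split=> //; [exact: chart_image_open| |by exists p].
split=> [|A v [q <-]]; first by exists x.
have [h [hx hu]] := rx A q Logic.I; exists h; split.
  by rewrite (kmnat (chart_map n) hx).
move=> h' e; apply: hu; apply: chart_inj.
exact: etrans (esym (kmnat (chart_map n) (erefl (ap U h' x)))) e.
Qed.

Definition plane_sm : gsm k G :=
  @GSm k G X (conj (@plane_sheaf _ char0 _ _ d_nat) (covered_weaken plane_covered))
    (@plane_separated _ char0 _ _ d_nat)
    (conj plane_covered (@plane_smooth _ char0 _ _ d_nat)).
End Charts.

(** A lift of the combination has the value 1 + z with z^2 = 0, a unit with inverse 1 - z. *)
Lemma thickening_comax (k : fieldType) (A B : kalg k) (h : khom A B) (x y : A) : thickening h ->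
  (exists u v, u * h x + v * h y = 1) -> exists u v, u * x + v * y = 1.
Proof.
move=> [surj sq0] [u' [v' e]]; have [u eu] := surj u'; have [v ev] := surj v'.
pose z := u * x + v * y - 1.
have hz : h z = 0 by rewrite rmorphB rmorphD !rmorphM rmorph1 eu ev e subrr.
have zz := sq0 _ _ hz hz.
exists (u * (1 - z)), (v * (1 - z)).
transitivity ((1 + z) * (1 - z)); first by rewrite /z; ring.
by transitivity (1 - z * z); [ring | rewrite zz subr0].
Qed.

(** * The charts as an H-Nisnevich covering with overlap W *)

Section Covering.
Variables (k : fieldType) (char0 : [pchar k] =i pred0) (G : finGroupType) (S : finType).
Implicit Types A B : kalg k.
Variable a : G -> S -> S.
Hypotheses (a1 : forall x, a 1%g x = x) (aM : forall g h x, a (g * h)%g x = a h (a g x)).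
Variable d : forall A : kalg k, (S -> A) -> A.
Hypotheses (d_nat : forall A B (h : khom A B) s, h (d s) = d (h \o s))
  (d_inv : forall A g (s : S -> A), d (s \o a g) = d s).

Let X : gsm_cat k G := plane_sm char0 a1 aM d_nat d_inv.
Let U : gsm_cat k G := chart k a1 aM.
Let W : gsm_cat k G := overlap a1 aM d_nat d_inv.
Let f (n : nat) : hom U X := chart_map a1 aM d_nat d_inv n.

Definition overlap_pt (n : nat) A (p : overlap a1 aM d_nat d_inv A) : chart k a1 aM A :=
  exist (fun p => chart_cond p) (fun t => if t is Some x then sval p (Some (Some x))
    else (sval p None - n%:R) * sval p (Some None)) Logic.I.

Definition overlap_map_chart (n : nat) : hom W U.
Proof.
unshelve eexists.
- exists (fun A => @overlap_pt n A) => A B h p q <-.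
  by apply: aff_eq => -[t|] //=; rewrite rmorphM rmorphB rmorph_nat.
- by move=> A g p q <-; apply: aff_eq => -[t|].
Defined.
Let j := overlap_map_chart.

Lemma overlap_pt_inj n A (p q : overlap a1 aM d_nat d_inv A) :
  overlap_pt n p = overlap_pt n q -> p = q.
Proof.
move=> e; have et t := congr1 (fun r => sval r t) e.
have es : sval p \o Some \o Some = sval q \o Some \o Some.
  by apply: funext => t; apply: (et (Some t)).
have hp : d (sval p \o Some \o Some) * sval p (Some None) = 1 := svalP p.
have hq : d (sval q \o Some \o Some) * sval q (Some None) = 1 := svalP q.
have ee : sval p (Some None) = sval q (Some None).
  by rewrite -[LHS]mulr1 -hq -es mulrA [_ * d _]mulrC hp mul1r.
have ec : sval p None = sval q None.
  have := et None; rewrite /= ee => /(congr1 (fun x => x * d (sval q \o Some \o Some))).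
  by rewrite -!mulrA [sval q (Some None) * _]mulrC hq !mulr1 => /addIr.
apply: aff_eq => -[[t|]|] //; exact: (congr1 (fun s => s t) es).
Qed.

Lemma chart_overlap m n A (p : overlap a1 aM d_nat d_inv A) :
  chart_map a1 aM d_nat d_inv m A (overlap_pt m p) = chart_map a1 aM d_nat d_inv n A (overlap_pt n p).
Proof.
pose N := (maxn m n).+1; pose s := sval p \o Some \o Some.
have hp : d s * sval p (Some None) = 1 := svalP p.
have rep l : (l < N)%N -> rep_at N s (sval p None) (sval p (Some None) * cprod predT N (sval p None))
    (chart_map a1 aM d_nat d_inv l A (overlap_pt l p)).
  move=> lN; rewrite (cprod_split _ lN) mulrCA mulrC [_ * (_ - _)]mulrC.
  apply: chart_rep => //=; by rewrite mulrCA hp mulr1.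
by apply: rep_at_inj (rep m _) (rep n _); rewrite ltnS ?leq_maxl ?leq_maxr.
Qed.

(** Comparing c gives d(s) (y - y') = n - m, a unit, so e = (y - y') / (n - m) is the inverse of
    d(s) that a point of W requires. *)
Lemma chart_meet m n A (p q : chart k a1 aM A) : m <> n ->
  chart_map a1 aM d_nat d_inv m A p = chart_map a1 aM d_nat d_inv n A q ->
  exists w, overlap_pt m w = p /\ overlap_pt n w = q.
Proof.
move=> mn e; pose N := (maxn m n).+1.
have hp : rep_at N _ _ _ (chart_map a1 aM d_nat d_inv m A p) :=
  chart_rep d_nat d_inv (N := N) (leq_maxl m n) (erefl (sval p \o Some)) (erefl (sval p None)) (chart_c _ m _ _).
have hq : rep_at N _ _ _ (chart_map a1 aM d_nat d_inv n A q) :=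
  chart_rep d_nat d_inv (N := N) (leq_maxr m n) (erefl (sval q \o Some)) (erefl (sval q None)) (chart_c _ n _ _).
rewrite e in hp; have [es ec _] := rep_at_unique char0 hp hq.
have [v nmv] := natr_diff_inv A char0 (nesym mn).
pose s := sval p \o Some; pose c := m%:R + d s * sval p None.
have key : d s * (sval p None - sval q None) = n%:R - m%:R.
  have : c = n%:R + d s * sval q None by rewrite /c ec /s es.
  by rewrite /c mulrBr => /eqP; rewrite -subr_eq0 => /eqP e0; apply/eqP; rewrite -subr_eq0 -[X in _ == X]e0; apply/eqP; ring.
pose w (t : option (option S)) : A :=
  match t with Some (Some x) => s x | Some None => (sval p None - sval q None) * v | None => c end.
have hw : overlap_cond d w by rewrite /overlap_cond mulrA key.
exists (exist _ w hw); split; apply: aff_eq => -[t|] //=.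
- transitivity (d s * (sval p None - sval q None) * v * sval p None); first by rewrite /c; ring.
  by rewrite key nmv mul1r.
- exact: (congr1 (fun s => s t) es).
- have -> : c - n%:R = d s * sval q None by rewrite /c ec /s es addrAC subrr add0r.
  transitivity (d s * (sval p None - sval q None) * v * sval q None); first by ring.
  by rewrite key nmv mul1r.
Qed.

Lemma chart_pt_ap n A B (h : khom A B) (p : chart k a1 aM A) :
  chart_map a1 aM d_nat d_inv n B (ap (chart k a1 aM) h p) =
  ap (plane_gfun a1 aM d_nat d_inv) h (chart_map a1 aM d_nat d_inv n A p).
Proof. exact: esym (kmnat (chart_map a1 aM d_nat d_inv n) erefl). Qed.

Lemma chart_pt_act n A g (p : chart k a1 aM A) :
  chart_map a1 aM d_nat d_inv n A (act (chart k a1 aM) g p) =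
  act (plane_gfun a1 aM d_nat d_inv) g (chart_map a1 aM d_nat d_inv n A p).
Proof. exact: esym (gm_act (chart_map a1 aM d_nat d_inv n) erefl). Qed.

(** A chart is an equivariant open immersion. Points over a thickening therefore lift uniquely, and
    by uniqueness the lift of an H-fixed point is H-fixed. Residue fields do not change because
    charts are monomorphisms. *)
Lemma chart_hnis_covering : @hnis_covering k G X nat (fun=> U) f.
Proof.
move=> H; split=> [n|K [u hu] ru].
  move=> A B h th [p hp] [u hu] /(congr1 sval) e.
  have {}e : ap (plane_gfun a1 aM d_nat d_inv) h u = chart_map a1 aM d_nat d_inv n B p := e.
  have [N [[s [c [y hr]]] nN]] := eventually_and (rep_at_ex u) (eventually_ge n.+1).
  have hr' := rep_at_map d_nat h hr.
  have [q hq] : exists q, chart_map a1 aM d_nat d_inv n A q = u.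
    apply/(@chart_imageP k char0 G S a a1 aM d d_nat d_inv _ _ _ _ _ _ _ nN hr).
    apply: (thickening_comax th); rewrite d_nat cprod_nat.
    apply/(@chart_imageP k char0 G S a a1 aM d d_nat d_inv _ _ _ _ _ _ _ nN hr').
    by exists p; apply: esym e.
  have inj A' := @chart_inj k char0 G S a a1 aM d d_nat d_inv n A'.
  have qH : fixed_cond (X := chart k a1 aM) H q.
    move=> g gH; apply: inj; apply: etrans (chart_pt_act n g q) _.
    by rewrite hq; apply: etrans (hu g gH) (esym hq).
  exists (exist _ q qH); split.
    split; apply: eq_exist; first exact: hq.
    by apply: inj; apply: etrans (chart_pt_ap n h q) _; rewrite hq.
  move=> [q' hq'] [/(congr1 sval) e' _]; apply: eq_exist.
  by apply: inj; apply: etrans hq (esym e').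
have [fK uni] := ru.
have [n [p ep]] := @chart_images_cover k char0 G S a a1 aM d d_nat d_inv K u fK.
have inj A' := @chart_inj k char0 G S a a1 aM d d_nat d_inv n A'.
have pH : fixed_cond (X := chart k a1 aM) H p.
  move=> g gH; apply: inj; apply: etrans (chart_pt_act n g p) _.
  by rewrite ep; apply: etrans (hu g gH) (esym ep).
exists n, (exist _ p pH); split; last by apply: eq_exist.
split=> // L [q hq] fL [M [v [w [fM /(congr1 sval) e]]]].
have {}e : ap (chart k a1 aM) v p = ap (chart k a1 aM) w q := e.
pose fH := fixed_map (chart_map a1 aM d_nat d_inv n) H.
have [|h [/(congr1 sval) hh hun]] := uni L (fH L (exist _ q hq)) fL.
  exists M, v, w; split=> //; apply: eq_exist.
  transitivity (chart_map a1 aM d_nat d_inv n M (ap (chart k a1 aM) v p)).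
    by rewrite chart_pt_ap ep.
  by rewrite e chart_pt_ap.
have {}hh : ap (plane_gfun a1 aM d_nat d_inv) h u = chart_map a1 aM d_nat d_inv n L q := hh.
exists h; split=> [|h' /(congr1 sval) e'].
  apply: eq_exist; apply: inj; apply: etrans (chart_pt_ap n h p) _.
  by rewrite ep hh.
have {}e' : ap (chart k a1 aM) h' p = q := e'.
apply: hun; apply: eq_exist; apply: etrans (_ : chart_map a1 aM d_nat d_inv n L q = _) => //.
by rewrite -e' chart_pt_ap ep.
Qed.

Lemma chart_map_mono n (T : gsm_cat k G) (u v : hom T U) : comp (f n) u = comp (f n) v -> u = v.
Proof.
move=> e; apply: gmap_eq => A x; apply: (@chart_inj k char0 G S a a1 aM d d_nat d_inv n).
exact: (congr1 (fun g : gmap T X => g A x) e).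
Qed.

Lemma overlap_map_mono n (T : gsm_cat k G) (u v : hom T W) : comp (j n) u = comp (j n) v -> u = v.
Proof.
move=> e; apply: gmap_eq => A x; apply: (@overlap_pt_inj n).
exact: (congr1 (fun g : gmap T U => g A x) e).
Qed.

Lemma chart_overlap_comp m n : comp (f m) (j m) = comp (f n) (j n).
Proof. by apply: gmap_eq => A x; apply: chart_overlap. Qed.

Lemma chart_pullback m n (T : gsm_cat k G) (u v : hom T U) : m <> n ->
  comp (f m) u = comp (f n) v -> exists2 w, comp (j m) w = u & comp (j n) w = v.
Proof.
move=> mn e.
have hw A (x : T A) : exists w, overlap_pt m w = u A x /\ overlap_pt n w = v A x.
  by apply: chart_meet => //; apply: (congr1 (fun g : gmap T X => g A x) e).
pose w A (x : T A) := sval (cid (hw A x)).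
have wm A (x : T A) : overlap_pt m (w A x) = u A x by rewrite /w; case: cid => z /= [].
have wn A (x : T A) : overlap_pt n (w A x) = v A x by rewrite /w; case: cid => z /= [].
have w_nat A B (h : khom A B) (x : T A) (y : T B) : ap T h x = y -> ap W h (w A x) = w B y.
  move=> hxy; apply: (@overlap_pt_inj m).
  by rewrite wm -(kmnat u hxy) -wm -[LHS](kmnat (j m) (erefl (ap W h (w A x)))).
have w_act A g (x y : T A) : act T g x = y -> act W g (w A x) = w A y.
  move=> gxy; apply: (@overlap_pt_inj m).
  by rewrite wm -(gm_act u gxy) -wm -[LHS](gm_act (j m) (erefl (act W g (w A x)))).
pose wk := @KMap k T W w w_nat.
by exists (@GMap k G T W wk w_act); apply: gmap_eq => A x; [apply: wm | apply: wn].
Qed.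
End Covering.

(** * Ranks and fixed dimensions of bundles *)

Section LinearBuilder.
Variables (R : comPzRingType) (V W : lmodType R) (f : V -> W).
Hypotheses (fD : forall u v, f (u + v) = f u + f v) (fZ : forall a u, f (a *: u) = a *: f u).

Lemma build_linear_subproof : linear f.
Proof. by move=> a u v; rewrite fD fZ. Qed.

Definition build_linear : {linear V -> W} := HB.pack f (GRing.isLinear.Build R V W *:%R f build_linear_subproof).
End LinearBuilder.

Section Dimension.
Variable L : fieldType.
Implicit Types V W : lmodType L.

(** Fibres of bundles are bare modules without a chosen basis, so the dimension of a subspace is
    expressed by a linear parametrization. *)
Definition has_dim V (S : V -> Prop) (r : nat) : Prop :=
  exists2 j : {linear 'rV[L]_r -> V}, injective j & forall v, S v <-> exists t, j t = v.

Lemma linear_sum_row V n (f : {linear 'rV[L]_n -> V}) t : f t = \sum_i t ord0 i *: f (delta_mx ord0 i).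
Proof. by rewrite {1}(row_sum_delta t) linear_sum; apply: eq_bigr => i _; rewrite linearZ. Qed.

Lemma has_dim_factor V r s (f : {linear 'rV[L]_r -> V}) (j : {linear 'rV[L]_s -> V}) :
  (forall t, exists u, j u = f t) -> exists M : 'M[L]_(r, s), forall t, j (t *m M) = f t.
Proof.
move=> h; have /choice [g hg] : forall i : 'I_r, exists u, j u = f (delta_mx ord0 i) by move=> i; apply: h.
exists (\matrix_(i < r) g i) => t; rewrite (linear_sum_row f) mulmx_sum_row linear_sum.
by apply: eq_bigr => i _; rewrite linearZ rowK hg.
Qed.

Lemma mulmx_inj_free r s (M : 'M[L]_(r, s)) : (forall t : 'rV_r, t *m M = 0 -> t = 0) <-> row_free M.
Proof.
rewrite -kermx_eq0; split=> [h|/eqP k0 t tM].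
  apply/eqP/row_matrixP => i; rewrite row0; apply: h.
  by rewrite -row_mul mulmx_ker row0.
by have : (t <= kermx M)%MS by [rewrite sub_kermx tM]; rewrite k0 submx0 => /eqP.
Qed.

Lemma has_dim_le V (S S' : V -> Prop) r r' : (forall v, S v -> S' v) ->
  has_dim S r -> has_dim S' r' -> (r <= r')%N.
Proof.
move=> SS' [j ji jS] [j' ji' jS'].
have [t|M hM] := @has_dim_factor _ _ _ j j'; first by apply/jS'/SS'/jS; exists t.
have : row_free M.
  apply/mulmx_inj_free => t tM; apply: ji; by rewrite -hM tM !linear0.
by move=> /eqP <-; apply: rank_leq_col.
Qed.

Lemma has_dim_unique V (S : V -> Prop) r r' : has_dim S r -> has_dim S r' -> r = r'.
Proof. by move=> h h'; apply/eqP; rewrite eqn_leq !(@has_dim_le V S S). Qed.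

(** A maximal independent family in S exists because its size is at most r'; a vector of S outside
    its span could be added to it. *)
Lemma has_dim_sub V (S S' : V -> Prop) r' : has_dim S' r' -> (forall v, S v -> S' v) ->
  S 0 -> (forall a u v, S u -> S v -> S (a *: u + v)) -> exists2 r, has_dim S r & (r <= r')%N.
Proof.
move=> [j ji jS'] SS' S0 Slin.
pose Q n := `[< exists2 M : 'M[L]_(n, r'), row_free M & forall i, S (j (row i M)) >].
have Q0 : exists n, Q n.
  exists 0%N; apply/asboolP; exists 0; last by case.
  by rewrite /row_free mxrank0.
have Qle n : Q n -> (n <= r')%N.
  by move=> /asboolP [M Mf _]; have := rank_leq_col M; rewrite (eqP Mf).
have [r /asboolP [M Mf MS] Mmax] := ex_maxnP Q0 Qle; exists r; last by apply: Qle; apply/asboolP; exists M.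
have MS' t : S (j (t *m M)).
  rewrite mulmx_sum_row linear_sum; elim/big_rec: _ => // i v _ Sv.
  by rewrite linearZ; apply: Slin.
exists (j \o mulmxr M)%FUN => [t t' /ji /eqP|v].
  rewrite -subr_eq0 -mulmxBl => /eqP /(proj2 (mulmx_inj_free M) Mf) /eqP.
  by rewrite subr_eq0 => /eqP.
split=> [Sv|[t <-]]; last exact: MS'.
have [w ew] := proj1 (jS' v) (SS' v Sv).
suff /submxP [t et] : (w <= M)%MS by exists t; rewrite /= -et.
apply: contrapT => /negP nw; have := Mmax (1 + r)%N; rewrite add1n ltnn -{1}add1n => /(_ _)/negP; apply.
apply/asboolP; exists (col_mx w M).
  apply/mulmx_inj_free => t; rewrite -[t]hsubmxK mul_row_col.
  set x := lsubmx t; set y := rsubmx t; rewrite (mx11_scalar x) mul_scalar_mx => e.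
  have x0 : x 0 0 = 0.
    apply/eqP/negP => /negP xn0; apply: (negP nw); apply/submxP; exists (- (x 0 0)^-1 *: y).
    apply: (scalerI xn0); rewrite -scalemxAl scalerA mulrN mulfV // scaleN1r.
    by apply/eqP; rewrite -addr_eq0 e.
  move: e; rewrite x0 scale0r add0r => /(proj2 (mulmx_inj_free M) Mf) ->.
  by rewrite raddf0 row_mx0.
move=> i; rewrite -[i]splitK; case: (split i) => l /=.
  by rewrite rowKu (_ : row l w = w) ?ew //; apply/rowP => c; rewrite mxE ord1.
by rewrite rowKd.
by [].
Qed.

(** Lifts of a basis of S' define a section [sg] of p, which splits S into the kernel and a copy of
    S'. *)
Lemma has_dim_kernel V W (S : V -> Prop) (S' : W -> Prop) (p : {linear V -> W}) a b c :
  (forall x y, S x -> S y -> S (x + y)) -> (forall l x, S x -> S (l *: x)) -> S 0 ->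
  (forall v, S v -> S' (p v)) -> (forall w, S' w -> exists2 v, S v & p v = w) ->
  has_dim (fun v => S v /\ p v = 0) a -> has_dim S b -> has_dim S' c -> b = (a + c)%N.
Proof.
move=> SD SZ S0 pS pS' [j ji jS] Sb [j' ji' jS'].
have /choice [s hs] : forall l : 'I_c, exists v, S v /\ p v = j' (delta_mx ord0 l).
  by move=> l; have [|v] := pS' (j' (delta_mx ord0 l)); [apply/jS'; eexists | exists v].
pose sg (t : 'rV[L]_c) := \sum_l t ord0 l *: s l.
have sgS t : S (sg t).
  by apply: (big_ind S) => // l _; apply: SZ; case: (hs l).
have psg t : p (sg t) = j' t.
  rewrite linear_sum_row linear_sum; apply: eq_bigr => l _.
  by rewrite linearZ; case: (hs l) => _ ->.
pose f (t : 'rV[L]_(a + c)) := j (lsubmx t) + sg (rsubmx t).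
have sgD x y : sg (x + y) = sg x + sg y.
  by rewrite -big_split; apply: eq_bigr => l _; rewrite mxE scalerDl.
have sgZ l x : sg (l *: x) = l *: sg x.
  by rewrite scaler_sumr; apply: eq_bigr => m _; rewrite mxE scalerA.
have fD x y : f (x + y) = f x + f y.
  by rewrite /f !linearD sgD addrACA.
have fZ l x : f (l *: x) = l *: f x.
  by rewrite /f !linearZ sgZ scalerDr.
have jk t : S (j t) /\ p (j t) = 0 by apply/jS; exists t.
apply: (has_dim_unique Sb); exists (build_linear fD fZ) => [x y /= e|v].
  have er : rsubmx x = rsubmx y.
    by apply: ji'; have := congr1 p e; rewrite /f !linearD !(proj2 (jk _)) !add0r !psg.
  have el : lsubmx x = lsubmx y by apply/ji; move: e; rewrite /f er => /addIr.
  by rewrite -[x]hsubmxK el er hsubmxK.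
split=> [Sv|[t <-] /=]; last by apply: SD => //; case: (jk (lsubmx t)).
have [t et] := proj1 (jS' _) (pS _ Sv).
have [|t' et'] := proj1 (jS (v - sg t)) _.
  by split; [apply: SD => //; rewrite -scaleN1r; apply: SZ | rewrite linearB psg et subrr].
by exists (row_mx t' t) => /=; rewrite /f row_mxKl row_mxKr et' subrK.
Qed.

Lemma has_dim_bij V W (S : V -> Prop) (S' : W -> Prop) (f : {linear V -> W}) r :
  (forall u v, S u -> S v -> f u = f v -> u = v) -> (forall w, S' w <-> exists2 v, S v & f v = w) ->
  has_dim S r -> has_dim S' r.
Proof.
move=> fi fS [j ji jS]; have Sj t : S (j t) by apply/jS; exists t.
exists (f \o j)%FUN => [x y /(fi _ _ (Sj x) (Sj y)) /ji //|w].
split=> [/fS [v /jS [t <-] <-]|[t <-]]; first by exists t.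
by apply/fS; exists (j t).
Qed.

End Dimension.

Section Restriction.
Variables (A B : comPzRingType) (h : {rmorphism A -> B}) (E : lmodType B).

Definition restr_zmod : zmodType := E.
Definition restr_scale (a : A) (e : restr_zmod) : restr_zmod := h a *: (e : E).

Lemma restr_scaleA a b v : restr_scale a (restr_scale b v) = restr_scale (a * b) v.
Proof. by rewrite /restr_scale scalerA rmorphM. Qed.
Lemma restr_scale1 : left_id 1 restr_scale.
Proof. by move=> v; rewrite /restr_scale rmorph1 scale1r. Qed.
Lemma restr_scaleDr : right_distributive restr_scale +%R.
Proof. by move=> a u v; rewrite /restr_scale scalerDr. Qed.
Lemma restr_scaleDl v : {morph restr_scale^~ v : a b / a + b}.
Proof. by move=> a b; rewrite /restr_scale rmorphD scalerDl. Qed.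

(** Restriction of scalars turns maps semilinear over h into linear ones, so that the universal
    property of a base change to B applies to targets defined over a field. *)
Definition restr : lmodType A := HB.pack restr_zmod
  (GRing.Zmodule_isLmodule.Build A restr_zmod restr_scaleA restr_scale1 restr_scaleDr restr_scaleDl).
End Restriction.

Section FiberRank.
Variables (k : fieldType) (L : fieldType) (iota : {rmorphism k -> L}).
Let K : kalg k := KAlg iota.

(** The point h factors through the localization at f, where V becomes free. The universal
    properties of u and w then provide mutually inverse maps [psi] and [chi] between E and L^r. *)
Lemma fiber_free (R B : kalg k) (V : lmodType R) (l : khom R B) (f : R) r (u : V -> 'rV[B]_r)
    (h : khom R K) (E : lmodType K) (w : V -> E) :
  is_localization l f -> base_change l u -> base_change h w -> h f <> 0 ->
  has_dim (fun _ : (E : lmodType L) => True) r.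
Proof.
move=> loc [[uD uZ] uu] [[wD wZ] wu] hf.
have [h' hh'] : exists h' : khom B K, forall a, h' (l a) = h a.
  by apply: (localization_lift loc); exists (h f)^-1; apply: divff; apply/eqP.
pose h'r : {rmorphism B -> L} := h'.
have [v hv vu] : exists2 v : {linear 'rV[B]_r -> restr h'r E}, (forall m, v (u m) = w m) &
    forall v' : {linear 'rV[B]_r -> restr h'r E}, (forall m, v' (u m) = w m) -> forall n, v' n = v n.
  apply: uu; split=> [m m'|a m]; first exact: wD.
  by rewrite wZ -hh'.
have [psi hpsi psiu] : exists2 psi : {linear E -> ('rV[L]_r : lmodType K)},
    (forall m, psi (w m) = map_mx h'r (u m)) & forall psi' : {linear E -> ('rV[L]_r : lmodType K)},
    (forall m, psi' (w m) = map_mx h'r (u m)) -> forall n, psi' n = psi n.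
  apply: wu; split=> [m m'|a m]; first by rewrite uD map_mxD.
  by rewrite uZ map_mxZ hh'.
pose chi (t : 'rV[L]_r) : E := \sum_i t ord0 i *: (v (delta_mx ord0 i) : E).
have chiD s t : chi (s + t) = chi s + chi t.
  by rewrite -big_split; apply: eq_bigr => i _; rewrite mxE scalerDl.
have chiZ a t : chi (a *: t) = a *: chi t.
  by rewrite scaler_sumr; apply: eq_bigr => i _; rewrite mxE scalerA.
have chih b : chi (map_mx h'r b) = v b.
  rewrite [in RHS](row_sum_delta b) linear_sum; apply: eq_bigr => i _.
  by rewrite linearZ mxE.
have psiv b : psi (v b) = map_mx h'r b.
  have fD x y : psi (v (x + y)) = psi (v x) + psi (v y).
    by rewrite linearD; exact: (linearD psi (v x : E) (v y : E)).
  have fZ a x : psi (v (a *: x)) = (a *: (psi (v x) : restr h'r _) : restr h'r 'rV[L]_r).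
    by rewrite linearZ; exact: (linearZ_LR psi (h'r a : K) (v x : E)).
  have gD x y : map_mx h'r (x + y : 'rV_r) = map_mx h'r x + map_mx h'r y by exact: map_mxD.
  have gZ a (x : 'rV_r) : map_mx h'r (a *: x) =
    (a *: (map_mx h'r x : restr h'r 'rV[L]_r) : restr h'r 'rV[L]_r) by exact: map_mxZ.
  have [|p _ pu] := uu (restr h'r 'rV[L]_r) (fun m => map_mx h'r (u m)).
    split=> [m m'|a m]; first by rewrite uD map_mxD.
    by rewrite uZ map_mxZ.
  have e1 := pu (@build_linear B 'rV[B]_r (restr h'r 'rV[L]_r) (fun x => map_mx h'r x) gD gZ).
  have e2 := pu (@build_linear B 'rV[B]_r (restr h'r 'rV[L]_r) (fun x => psi (v x)) fD fZ).
  have /= -> := e2 _ b; last by move=> m /=; rewrite hv hpsi.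
  by rewrite -e1.
have psichi t : psi (chi t) = t.
  rewrite linear_sum [RHS]row_sum_delta; apply: eq_bigr => i _.
  by rewrite linearZ /= psiv map_delta_mx.
have chipsi e : chi (psi e) = e.
  have fD x y : chi (psi (x + y)) = chi (psi x) + chi (psi y) by rewrite linearD chiD.
  have fZ a x : chi (psi (a *: x)) = a *: chi (psi x) by rewrite linearZ chiZ.
  have [|p _ pu] := wu E w; first by split.
  rewrite -[RHS]/(idfun e) -[LHS]/(build_linear fD fZ e) (pu (build_linear fD fZ)) ?(pu idfun) // => m /=.
  by rewrite hpsi chih hv.
exists (build_linear chiD chiZ) => [x y /= e|e]; first by rewrite -(psichi x) e psichi.
by split=> // _; exists (psi e) => /=.
Qed.
End FiberRank.

Section RankConstant.
Variable k : fieldType.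

(** Some f_i is nonzero at h1, because the f_i generate the unit ideal. It is also nonzero at the
    injective h2, so both fibres come from the same free module. *)
Lemma fiber_rank (L1 L2 : fieldType) (iota1 : {rmorphism k -> L1}) (iota2 : {rmorphism k -> L2})
    (R : kalg k) (V : lmodType R)
    (h1 : khom R (KAlg iota1)) (E1 : lmodType (KAlg iota1)) (w1 : V -> E1)
    (h2 : khom R (KAlg iota2)) (E2 : lmodType (KAlg iota2)) (w2 : V -> E2) :
  module_locally_free V -> base_change h1 w1 -> base_change h2 w2 ->
  (forall f, h2 f = 0 -> f = 0) ->
  exists r, has_dim (fun _ : (E1 : lmodType L1) => True) r /\
            has_dim (fun _ : (E2 : lmodType L2) => True) r.
Proof.
move=> [n [f [[m [s [c [sf sc1]]]] free]]] bc1 bc2 inj2.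
have [i hi] : exists i, h1 (f i) <> 0.
  apply: contrapT => no; have := congr1 h1 sc1; rewrite rmorph1 rmorph_sum big1.
    by move/esym/eqP; rewrite oner_eq0.
  move=> j _; rewrite rmorphM; have [i ->] := sf j.
  have -> : h1 (f i) = 0 by apply: contrapT => hi; apply: no; exists i.
  by rewrite mulr0.
have hi2 : h2 (f i) <> 0 by move=> /inj2 e; apply: hi; rewrite e rmorph0.
have [B [l [loc [r [u bu]]]]] := free i; exists r.
by split; [apply: (fiber_free loc bu bc1) | apply: (fiber_free loc bu bc2)].
Qed.

Definition scalars : kalg k := KAlg (idfun : {rmorphism k -> k}).
Definition line : kalg k := KAlg (polyC : {rmorphism k -> {poly k}}).

Lemma line_eval_str (a c : k) : horner_eval a (kstr line c) = kstr scalars c.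
Proof. exact: hornerC. Qed.

Definition line_eval (a : k) : khom line scalars :=
  @KHom k line scalars (horner_eval a : {rmorphism {poly k} -> k}) (line_eval_str a).

Definition line_generic : kalg k :=
  KAlg ((@tofrac {poly k} \o polyC)%FUN : {rmorphism k -> {fraction {poly k}}}).

Definition line_to_generic : khom line line_generic :=
  @KHom k line line_generic (@tofrac {poly k} : {rmorphism {poly k} -> {fraction {poly k}}})
    (fun _ => erefl).

Variables (X : kfunctor k) (M : qcoh X).
Hypothesis M_free : forall A (x : X A), module_locally_free (M A x).

Definition fiber_dim (x : X scalars) r := has_dim (fun _ : (M scalars x : lmodType k) => True) r.

Lemma fiber_dim_exists x : exists r, fiber_dim x r.
Proof.
have bc := res_base_change M (ap_id x).
by have [//|r [h _]] := fiber_rank (M_free x) bc bc; exists r.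
Qed.

(** The ranks at a and b both equal the rank at the generic point of the line, where no nonzero
    polynomial vanishes. *)
Lemma fiber_dim_path (g : X line) (a b : k) :
  exists r, fiber_dim (ap X (line_eval a) g) r /\ fiber_dim (ap X (line_eval b) g) r.
Proof.
have bc := res_base_change M (erefl (ap X line_to_generic g)).
have inj (f : line) : line_to_generic f = 0 -> f = 0 by move=> /eqP; rewrite tofrac_eq0 => /eqP.
have [r [ha ga]] := fiber_rank (M_free g) (res_base_change M (erefl (ap X (line_eval a) g))) bc inj.
have [r' [hb gb]] := fiber_rank (M_free g) (res_base_change M (erefl (ap X (line_eval b) g))) bc inj.
by exists r; split=> //; rewrite (has_dim_unique ga gb).
Qed.

End RankConstant.

(** * Fixed vectors at a fixed point and the label of a morphism of QP(G,X) *)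

Section FixedDimension.
Variables (k : fieldType) (char0 : [pchar k] =i pred0) (G : finGroupType).
Variables (X : gfunctor k G) (x : X (scalars k)).
Hypothesis x_fixed : forall g, act X g x = x.

Definition fixed_vec (M : bundle X) : (M (scalars k) x : lmodType k) -> Prop :=
  fun v => forall g (e : act X g x = x), phi M e v = v.
Arguments fixed_vec : clear implicits.

Lemma fixed_vec_lin M a u v : fixed_vec M u -> fixed_vec M v -> fixed_vec M (a *: u + v).
Proof. by move=> hu hv g e; rewrite linearP hu hv. Qed.

Lemma fixed_vec0 M : fixed_vec M 0.
Proof. by move=> g e; rewrite linear0. Qed.

Lemma fixed_dim_subproof M : exists r, has_dim (fixed_vec M) r.
Proof.
have [r hr] := fiber_dim_exists (@bundle_free _ _ _ M) x.
by have [//|||r' h _] := @has_dim_sub _ _ (fixed_vec M) _ r hr; [exact: fixed_vec0|exact: fixed_vec_lin|exists r'].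
Qed.

Definition fixed_dim M : nat := sval (cid (fixed_dim_subproof M)).

Lemma fixed_dimP M : has_dim (fixed_vec M) (fixed_dim M).
Proof. exact: (svalP (cid (fixed_dim_subproof M))). Qed.

Lemma fixed_dim_le (M : bundle X) r : fiber_dim M x r -> (fixed_dim M <= r)%N.
Proof. by apply: has_dim_le (fixed_dimP M). Qed.

Lemma bmor_fixed (M N : bundle X) (u : bmor M N) v : fixed_vec M v -> fixed_vec N (u _ x v).
Proof. by move=> hv g e; rewrite -bf_phi hv. Qed.

(** The Reynolds operator: it makes the passage to G-fixed vectors exact. *)
Definition average (M : bundle X) (v : M (scalars k) x) : M (scalars k) x :=
  (#|G|%:R^-1 : k) *: \sum_g phi M (x_fixed g) v.

Lemma average_fixed (M : bundle X) v : fixed_vec M (average v).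
Proof.
move=> h e; rewrite linearZ linear_sum; congr (_ *: _).
rewrite [RHS](reindex_inj (mulIg h)); apply: eq_bigr => g _.
exact: phi_cocycle.
Qed.

Lemma card_neq0 : (#|G|%:R : k) != 0.
Proof. by rewrite (pcharf0P _).1 // -lt0n; apply/card_gt0P; exists 1%g. Qed.

Lemma scale_card (V : lmodType k) (t : V) : (#|G|%:R^-1 : k) *: (t *+ #|G|) = t.
Proof. by rewrite -scaler_nat scalerA mulVf ?scale1r // card_neq0. Qed.

Lemma fixed_lift (M N : bundle X) (u : bmor M N) : (forall t, exists s, u _ x s = t) ->
  forall t, fixed_vec N t -> exists2 s, fixed_vec M s & u _ x s = t.
Proof.
move=> us t ht; have [s hs] := us t; exists (average s); first exact: average_fixed.
rewrite linearZ linear_sum (eq_bigr (fun=> t)) => [|g _]; last by rewrite bf_phi hs ht.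
by rewrite sumr_const; exact: (scale_card (V := N (scalars k) x) t).
Qed.

Lemma fixed_dim_kernel (M N : bundle X) (u : bmor M N) : (forall t, exists s, u _ x s = t) ->
  exists2 r, has_dim (fun v : (M (scalars k) x : lmodType k) => fixed_vec M v /\ u _ x v = 0) r &
             fixed_dim M = (r + fixed_dim N)%N.
Proof.
move=> us.
have [|||r hr _] := @has_dim_sub _ _ (fun v : (M (scalars k) x : lmodType k) => fixed_vec M v /\ u _ x v = 0) _ _ (fixed_dimP M).
- by move=> v [].
- by split; [apply: fixed_vec0 | rewrite linear0].
- move=> a v w [hv uv] [hw uw]; split; first exact: fixed_vec_lin.
  by rewrite linearP uv uw scaler0 addr0.
exists r => //; apply: (has_dim_kernel (p := u _ x) _ _ _ _ _ hr (fixed_dimP M) (fixed_dimP N)).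
- by move=> v w hv hw; rewrite -[v]scale1r; apply: fixed_vec_lin.
- by move=> a v hv; rewrite -[_ *: _]addr0; apply: fixed_vec_lin => //; apply: fixed_vec0.
- exact: fixed_vec0.
- by move=> v; apply: bmor_fixed.
- exact: fixed_lift.
Qed.

(** By exactness of fixed vectors this is the fixed dimension of the kernel of apex -> M. Kernels
    add up under composition, so the label is a functor from QP(G,X) to the group Z; on loops it
    induces the homomorphism from K_0. *)
Definition span_label (M N : bundle X) (s : span M N) : int :=
  (fixed_dim (apex s))%:Z - (fixed_dim M)%:Z.

Lemma span_iso_label (M N : bundle X) (s t : span M N) : span_iso s t -> span_label s = span_label t.
Proof.
move=> [u hu]; congr (_%:Z - _); have [[v uv vu] _ _] := hu _ x.
have us w : exists z, u _ x z = w by exists (v w).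
apply: (has_dim_unique _ (fixed_dimP (apex t))).
apply: (has_dim_bij (f := u _ x) _ _ (fixed_dimP (apex s))) => [y z _ _ e|w].
  by rewrite -(uv y) e uv.
split=> [|[z hz <-]]; [exact: fixed_lift | exact: bmor_fixed].
Qed.

Definition qmor_label (M N : bundle X) (S : qmor M N) : int := span_label (sval (cid (svalP S))).

Lemma qmor_labelE (M N : bundle X) (S : qmor M N) s : sval S s -> qmor_label S = span_label s.
Proof.
rewrite /qmor_label; case: cid => t /= et; rewrite et => ts.
exact: span_iso_label.
Qed.

Lemma epi_surj (M N : bundle X) (u : bmor M N) : adm_epi u -> forall t, exists s, u _ x s = t.
Proof. by case=> K [i h] t; have [_ hu _] := h _ x; apply: hu. Qed.

(** In the fibre product square b maps the kernel of a isomorphically to the kernel of [sq t], and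
    so do the fixed vectors in them. *)
Lemma qmor_label_comp (M N P : bundle X) (T : qmor N P) (S : qmor M N) (R : qmor M P) :
  qmor_comp T S R -> qmor_label R = qmor_label S + qmor_label T.
Proof.
case=> s [t [r [hs ht hr [a [b h]]]]].
rewrite (qmor_labelE hs) (qmor_labelE ht) (qmor_labelE hr) /span_label.
have [ab pb _ _] := h _ x.
have as_ m : exists l, a _ x l = m.
  have [n hn] := epi_surj (sq_adm t) (si s _ x m).
  by have [l [[<- _] _]] := pb m n (esym hn); exists l.
have [c hc ->] := fixed_dim_kernel as_.
have [d hd ->] := fixed_dim_kernel (epi_surj (sq_adm t)).
suff -> : c = d by rewrite !PoszD; ring.
apply: has_dim_unique hd; apply: (has_dim_bij (f := b _ x) _ _ hc) => [y z [_ ay] [_ az] e|w].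
  have [|l [_ lu]] := pb 0 (b _ x y); first by rewrite -ay ab.
  by rewrite -(lu y) // -(lu z).
split=> [[hw w0]|[z [hz az] <-]]; last by split; [apply: bmor_fixed | rewrite -ab az linear0].
have [|l [[al bl] lu]] := pb 0 w; first by rewrite w0 linear0.
exists l => //; split=> // g e; apply/esym/lu.
by rewrite !bf_phi al bl linear0 hw.
Qed.

End FixedDimension.

(** * The label as a map from BQP to the nerve of a group *)

Section NerveLabel.
Variables (k : fieldType) (char0 : [pchar k] =i pred0) (G : finGroupType).

Lemma pull_fixed_dim (X Y : gfunctor k G) (f : gmap Y X) (y : Y (scalars k)) (M : bundle X) :
  (forall g, act Y g y = y) -> fixed_dim y (pull f M) = fixed_dim (f _ y) M.
Proof.
move=> yf; apply: has_dim_unique (fixed_dimP (f _ y) M).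
suff <- : fixed_vec (x := y) (M := pull f M) = fixed_vec (x := f _ y) (M := M) by exact: fixed_dimP.
apply: funext => v; apply: propext; split=> h g e; last exact: h.
by rewrite -[RHS](h g (yf g)) /=; congr (phi M _ v); apply: Prop_irrelevance.
Qed.

Lemma pull_qmor_label (X Y : gfunctor k G) (f : gmap Y X) (y : Y (scalars k)) (M N : bundle X) (S : qmor M N) :
  (forall g, act Y g y = y) -> qmor_label y (pull_qmor f S) = qmor_label (f _ y) S.
Proof.
move=> yf; have [s es] := svalP S; have Ss : sval S s by rewrite es; apply: span_iso_refl.
have xf g : act X g (f _ y) = f _ y by apply: gm_act.
rewrite (qmor_labelE char0 xf Ss) (@qmor_labelE _ char0 _ _ _ yf _ _ _ (pull_span f s)).
  by rewrite /span_label /= !pull_fixed_dim.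
by exists s => //; apply: span_iso_refl.
Qed.

Section Label.
Variables (X : gfunctor k G) (I : Type) (x : I -> X (scalars k)).
Hypothesis x_fixed : forall i g, act X g (x i) = x i.

(** A potential relative to the initial vertex of the chain: differences of potentials are a cocycle
    by construction, and additivity identifies them with the labels of the arrows. *)
Definition vertex_label n (c : qchain X n) (a : 'I_n.+1) (i : I) : int :=
  qmor_label (x i) (qarr c (leq0n a : (@ord0 n <= a)%N)).

Definition chain_label n (c : qchain X n) (a b : 'I_n.+1) (i : I) : int :=
  vertex_label c b i - vertex_label c a i.

Lemma chain_labelE n (c : qchain X n) (a b : 'I_n.+1) (ab : (a <= b)%N) i :
  chain_label c a b i = qmor_label (x i) (qarr c ab).
Proof.
rewrite /chain_label /vertex_label.
by rewrite (qmor_label_comp char0 (x_fixed i) (qarr_comp c (leq0n a : (@ord0 n <= a)%N) ab (leq0n b))); ring.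
Qed.

Lemma chain_label_cocycle n (c : qchain X n) : cocycle (chain_label c).
Proof. by move=> p q r i; rewrite /chain_label; ring. Qed.

Lemma chain_label_sop m n (t : mono m n) (c : qchain X n) a b i :
  chain_label (sop (s := BQP_obj X) t c) a b i = chain_label c (t a) (t b) i.
Proof.
wlog ab : a b / (a <= b)%N => [hw|]; last by rewrite (chain_labelE c (mono_le t ab)) (chain_labelE _ ab).
have [ab|/ltnW ba] := leqP a b; first exact: hw.
by rewrite (cocycle_opp b a _ (chain_label_cocycle _)) hw // -cocycle_opp //; apply: chain_label_cocycle.
Qed.

Variable S : (I -> int) -> Prop.
Hypothesis label_in : forall n (c : qchain X n) a b, S (chain_label c a b).

Definition nerve_label : smap (BQP_obj X) (abnerve S).
Proof.
exists (fun n (c : BQP_obj X n) => abcell (chain_label_cocycle c) (label_in c)).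
by move=> m n t c; apply: abnerve_eq => a b i; apply: chain_label_sop.
Defined.
End Label.

End NerveLabel.

(** * Labels of loops *)

Section Loops.
Variable Z : sset.

Lemma loop_of_cond (z : Z 0) (a : Z 1) : (forall i : 'I_2, sop (mono_const 0 i) a = z) ->
  loop_cond z (@SMap (sprod (std 0) (std 1)) Z (fun m x => sop (x.2 : mono m 1) a)
    (fun m n t x => sop_comp (x.2 : mono n 1) t a)).
Proof. by move=> az m x e /=; rewrite -(az e) -sop_comp; apply: sop_eq. Qed.

Definition loop_of (z : Z 0) (a : Z 1) (az : forall i : 'I_2, sop (mono_const 0 i) a = z) : loops z 0 :=
  exist (loop_cond z (n:=0)) _ (loop_of_cond az).

(** The collapse Delta^1 x Delta^1 -> Delta^2 that sends the side y = 0 to vertex 0, the side y = 1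
    to the edge 12, and the sides x = 0 and x = 1 to the edges 01 and 02. It turns a triangle with
    two constant sides into a path of loops. *)
Definition square_fun m (x y : mono m 1) (i : 'I_m.+1) : 'I_3 :=
  inord (y i * (1 + x i)).

Lemma square_mono_le m (x y : mono m 1) (i j : 'I_m.+1) : (i <= j)%N -> (square_fun x y i <= square_fun x y j)%N.
Proof.
move=> ij; have := mono_le x ij; have := mono_le y ij; rewrite /square_fun.
move: (ltn_ord (x i)) (ltn_ord (x j)) (ltn_ord (y i)) (ltn_ord (y j)).
case: (val (y i)) => [|[|//]]; case: (val (y j)) => [|[|//]] *;
  by rewrite !inordK ?mul0n ?mul1n //; lia.
Qed.

Definition square m (x y : mono m 1) : mono m 2 := Mono (@square_mono_le m x y).

Lemma loop_null (z : Z 0) (a : Z 1) az bz :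
  tri a (sop (mono_const 1 ord0) z) (sop (mono_const 1 ord0) z) ->
  exists p : loops z 1, sop (mono_const 0 ord0) p = @loop_of z a az /\
    sop (mono_const 0 ord_max) p = @loop_of z (sop (mono_const 1 ord0) z) bz.
Proof.
move=> [s [s2 s0 s1]].
have sqN m n (t : mono m n) (x : sprod (std 1) (std 1) n) :
    sop (square (sop t x).1 (sop t x).2) s = sop t (sop (square x.1 x.2) s).
  by rewrite -sop_comp; apply: sop_eq.
pose l := SMap sqN.
have e01 m (y : mono m 1) : sop (square (mono_const m ord0) y) s = sop y a.
  rewrite -s2 -sop_comp; apply: sop_eq => i; apply: val_inj.
  by rewrite /= /square_fun !inordK /bump /=; have := ltn_ord (y i); lia.
have e02 m (y : mono m 1) : sop (square (mono_const m ord_max) y) s = sop (mono_const m ord0) z.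
  transitivity (sop y (sop (mono_const 1 ord0) z)); last by rewrite -sop_comp; apply: sop_eq.
  rewrite -s1 -sop_comp; apply: sop_eq => i; apply: val_inj.
  by rewrite /= /square_fun !inordK /bump /=; have := ltn_ord (y i); lia.
have e12 m (x : mono m 1) : sop (square x (mono_const m ord_max)) s = sop (mono_const m ord0) z.
  transitivity (sop x (sop (mono_const 1 ord0) z)); last by rewrite -sop_comp; apply: sop_eq.
  rewrite -s0 -sop_comp; apply: sop_eq => i; apply: val_inj.
  by rewrite /= /square_fun !inordK /bump /=; have := ltn_ord (x i); lia.
have lz : loop_cond z l.
  move=> m x e /=; case: (unliftP ord_max e) => [e' ->|->]; last exact: e12.
  rewrite -(az ord0) -sop_comp -e01; apply: sop_eq => i; apply: val_inj => /=.
  by rewrite /square_fun /= ord1 /= !mul0n.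
exists (exist (loop_cond z (n:=1)) _ lz); split; apply: eq_exist; apply: smap_eq => m [x y] /=.
  by rewrite -e01; apply: sop_eq.
transitivity (sop (mono_const m ord0) z); last by rewrite -sop_comp; apply: sop_eq.
by rewrite -(e02 m y); apply: sop_eq.
Qed.

Lemma tri_label I (S : (I -> int) -> Prop) (g : smap Z (abnerve S)) (a b c : Z 1) i : tri a b c ->
  sval (g 1 c) ord0 ord_max i = sval (g 1 a) ord0 ord_max i + sval (g 1 b) ord0 ord_max i.
Proof.
case=> s [<- <- <-]; rewrite /dface !sfun_nat /=.
have e1 : lift (inord 2) ord0 = lift (inord 1) ord0 :> 'I_3 by apply: val_inj; rewrite /= /bump !inordK.
have e2 : lift (inord 2) ord_max = lift (inord 0) ord0 :> 'I_3 by apply: val_inj; rewrite /= /bump !inordK.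
have e3 : lift (inord 1) ord_max = lift (inord 0) ord_max :> 'I_3 by apply: val_inj; rewrite /= /bump !inordK.
by rewrite e1 e2 e3; case: (svalP (g 2 s)) => fc _; apply: fc.
Qed.

End Loops.

Lemma subgroup_all I : subgroup_pred (fun _ : I -> int => True).
Proof. by []. Qed.

Lemma subgroup_bounded : subgroup_pred bounded_seq.
Proof.
split=> [|u v [C hC] [D hD]]; first by exists 0%N.
by exists (C + D)%N => n; move: (hC n) (hD n); lia.
Qed.

(* A coboundary does not change the labels of loops, so these can be computed
   from any labelling that agrees with the given one up to homotopy. *)
Lemma loop_label_bounded (BX BU FX FU : sset) (hX : smap BX FX) (hU : smap BU FU)
    (fB : nat -> smap BX BU) (fF : nat -> smap FX FU)
    (LX : smap BX (abnerve bounded_seq)) (LU : smap BU (abnerve (fun _ : unit -> int => True)))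
    (g : smap FU (abnerve (fun _ : unit -> int => True))) (c : BU 0 -> unit -> int) (z : FX 0) :
  weak_equiv hX -> (forall n m (x : BX m), fF n m (hX m x) = hU m (fB n m x)) ->
  (forall n m (x : BX m) a b, sval (LX m x) a b n = sval (LU m (fB n m x)) a b tt) ->
  (forall m (x : BU m) a b i, sval (g m (hU m x)) a b i =
      sval (LU m x) a b i + c (sop (mono_const 0 b) x) i - c (sop (mono_const 0 a) x) i) ->
  forall l : loops z 0, bounded_seq (fun n =>
    sval (g 1 (fF n 1 (sval l 1 (mono_const 1 ord0, mono_id 1)))) ord0 ord_max tt).
Proof.
move=> hwe hF hL hg l.
have [gX [cX hgX]] := weak_equiv_label LX subgroup_bounded hwe.
(* The two labellings are compared in the nerve of all sequences, since the coboundary between them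
   is not known to be bounded in n. *)
pose T := fun _ : nat -> int => True.
have fc m (x : FX m) : cocycle (fun a b n => sval (g m (fF n m x)) a b tt).
  by move=> p q r n; case: (svalP (g m (fF n m x))) => h _; apply: h.
have fN m p (t : mono m p) (x : FX p) :
    abcell (S := T) (fc m (sop t x)) (fun _ _ => Logic.I) = sop t (abcell (fc p x) (fun _ _ => Logic.I)).
  by apply: abnerve_eq => p' q n; rewrite /= !sfun_nat.
pose A : smap FX (abnerve T) := SMap fN.
have gN m p (t : mono m p) (x : FX p) :
    abcell (S := T) (proj1 (svalP (gX m (sop t x)))) (fun _ _ => Logic.I) =
    sop t (abcell (proj1 (svalP (gX p x))) (fun _ _ => Logic.I)).
  by apply: abnerve_eq => p' q n; rewrite /= !sfun_nat.
pose B : smap FX (abnerve T) := SMap gN.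
have [_ inj] := hwe _ (abnerve_kan (subgroup_all nat)).
have [|cc hcc] := homotopic_coboundary (inj A B _).
  apply: (coboundary_homotopic (c := fun x n => cX x n - c (fB n 0 x) tt)) => m x p q n.
  by rewrite /= hF hg hgX hL !sfun_nat; ring.
have [C hC] := (svalP (gX 1 (sval l 1 (mono_const 1 ord0, mono_id 1)))).2 ord0 ord_max.
exists C => n; have := hcc 1 (sval l 1 (mono_const 1 ord0, mono_id 1)) ord0 ord_max n.
have e (i : 'I_2) : sop (mono_const 0 i) (sval l 1 (mono_const 1 ord0, mono_id 1)) = z.
  rewrite -sfun_nat -[RHS]sop_id -[mono_id 0](_ : mono_const 0 ord0 = _); last first.
    by apply: eq_mono => j; rewrite !ord1.
  rewrite -(svalP l 0 (mono_const 0 ord0) i); congr (sval l 0 (_, _)); exact: eq_mono.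
by rewrite !e addrK /= => <-.
Qed.

Section BoundedLabel.
Variables (k : fieldType) (char0 : [pchar k] =i pred0) (G : finGroupType).
Variables (X : gfunctor k G) (x : nat -> X (scalars k)) (w : X (scalars k)) (g : nat -> X (line k)) (a b : k).
Hypotheses (x_fixed : forall n h, act X h (x n) = x n)
  (g_start : forall n, ap X (line_eval a) (g n) = x n) (g_end : forall n, ap X (line_eval b) (g n) = w).

(* The points x n all lie on curves through w, so the rank at w bounds the
   fixed dimensions at all of them. *)
Lemma fixed_dim_bounded (M : bundle X) : exists r, forall n, (fixed_dim (x n) M <= r)%N.
Proof.
have [r hr] := fiber_dim_exists (@bundle_free _ _ _ M) w; exists r => n.
have [r' [h0]] := fiber_dim_path (@bundle_free _ _ _ M) (g n) a b.
rewrite g_end => h1; rewrite -(has_dim_unique h1 hr); apply: fixed_dim_le.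
by rewrite -g_start.
Qed.

Lemma chain_label_bounded n (c : qchain X n) p q : bounded_seq (chain_label x c p q).
Proof.
wlog pq : p q / (p <= q)%N => [hw|].
  have [pq|/ltnW qp] := leqP p q; first exact: hw.
  have [C hC] := hw _ _ qp; exists C => i.
  by rewrite (cocycle_opp q p _ (chain_label_cocycle x c)) abszN.
have [s es] := svalP (qarr c pq); have Ss : sval (qarr c pq) s by rewrite es; apply: span_iso_refl.
have [r1 h1] := fixed_dim_bounded (apex s); have [r2 h2] := fixed_dim_bounded (qo c p).
exists (r1 + r2)%N => i; rewrite (chain_labelE char0 x_fixed c pq) (qmor_labelE char0 (x_fixed i) Ss).
by move: (h1 i) (h2 i); rewrite /span_label; lia.
Qed.
End BoundedLabel.

(** * Edges and triangles of BQP *)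

Section Edges.
Variables (k : fieldType) (G : finGroupType).
Implicit Types X Y : gfunctor k G.

(** Arrows are packed with their end points, so that chains can be compared before their objects are
    identified. *)
Definition qarrow X := {p : bundle X * bundle X & qmor p.1 p.2}.
Definition mk_arrow X (M N : bundle X) (S : qmor M N) : qarrow X :=
  existT (fun p : bundle X * bundle X => qmor p.1 p.2) (M, N) S.

Lemma mk_arrow_inj X (M N : bundle X) (S T : qmor M N) : mk_arrow S = mk_arrow T -> S = T.
Proof.
move=> e; have := projT2_eq e; by rewrite [projT1_eq e](Prop_irrelevance _ erefl).
Qed.

Lemma qchain_ext X n (c c' : qchain X n) :
  (forall i j e, mk_arrow (@qarr _ _ _ _ c i j e) = mk_arrow (@qarr _ _ _ _ c' i j e)) -> c = c'.
Proof.
case: c c' => [o q h1 h2] [o' q' h1' h2'] /= e.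
have eo : o = o' by apply: funext => i; have := congr1 (fun s : qarrow X => (projT1 s).1) (e i i (leqnn i)).
case: _ / eo q' h1' h2' e => q' h1' h2' e.
by apply: qchain_eq => i j le; apply: mk_arrow_inj.
Qed.

Definition arrow X (c : qchain X 1) : qarrow X :=
  mk_arrow (qarr c (leq0n _ : (@ord0 1 <= @ord_max 1)%N)).

Lemma edge_ext X (c c' : qchain X 1) : arrow c = arrow c' -> c = c'.
Proof.
move=> e; have e0 : qo c ord0 = qo c' ord0 := congr1 (fun s : qarrow X => (projT1 s).1) e.
have e1 : qo c ord_max = qo c' ord_max := congr1 (fun s : qarrow X => (projT1 s).2) e.
have diag (i : 'I_2) (le : (i <= i)%N) : qo c i = qo c' i -> mk_arrow (qarr c le) = mk_arrow (qarr c' le).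
  by rewrite !qarr_id => ->.
apply: qchain_ext => i j.
have [->|->] : i = ord0 \/ i = ord_max by case: i => [[|[|//]] ?]; [left|right]; apply: val_inj.
  have [->|->] : j = ord0 \/ j = ord_max by case: j => [[|[|//]] ?]; [left|right]; apply: val_inj.
    by move=> le; apply: diag.
  by move=> le; rewrite (Prop_irrelevance le (leq0n _)).
have [->|->] : j = ord0 \/ j = ord_max by case: j => [[|[|//]] ?]; [left|right]; apply: val_inj.
  by [].
by move=> le; apply: diag.
Qed.

Lemma vertex_ext X (c c' : qchain X 0) : qo c ord0 = qo c' ord0 -> c = c'.
Proof.
move=> e; apply: qchain_ext => i j; rewrite !ord1 => le.
by rewrite !qarr_id e.
Qed.

Lemma qmor_idl X (M N : bundle X) (S : qmor M N) : qmor_comp (qmor_id N) S S.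
Proof.
have [s es] := svalP S; have Ss : sval S s by rewrite es; apply: span_iso_refl.
exists s, (span_id N), s; split=> //; first exact: span_iso_refl.
exists (bmor_id _), (si s) => A x; split=> // m n mn.
by exists m; split=> // l [].
Qed.

Lemma qmor_idr X (M N : bundle X) (S : qmor M N) : qmor_comp S (qmor_id M) S.
Proof.
have [s es] := svalP S; have Ss : sval S s by rewrite es; apply: span_iso_refl.
exists (span_id M), s, s; split=> //; first exact: span_iso_refl.
exists (sq s), (bmor_id _) => A x; split=> // m n mn.
by exists n; split=> // l [].
Qed.

Section Triangle.
Variables (X : gfunctor k G) (M N P : bundle X) (S : qmor M N) (T : qmor N P) (R : qmor M P).
Hypothesis STR : qmor_comp T S R.

(** Indexing by natural numbers lets the dependent match compute; every index from 2 on stands for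
    vertex 2. *)
Definition tri_ob (a : nat) : bundle X := if a is a'.+1 then if a' is 0 then N else P else M.

Definition tri_arr (a b : nat) : (a <= b)%N -> qmor (tri_ob a) (tri_ob b) :=
  match a, b return (a <= b)%N -> qmor (tri_ob a) (tri_ob b) with
  | 0, 0 => fun _ => qmor_id M
  | 0, 1 => fun _ => S
  | 0, _.+2 => fun _ => R
  | 1, 0 => fun e => False_rect _ (Bool.diff_false_true e)
  | 1, 1 => fun _ => qmor_id N
  | 1, _.+2 => fun _ => T
  | _.+2, 0 => fun e => False_rect _ (Bool.diff_false_true e)
  | _.+2, 1 => fun e => False_rect _ (Bool.diff_false_true e)
  | _.+2, _.+2 => fun _ => qmor_id P
  end%N.

Lemma tri_arr_id a (e : (a <= a)%N) : tri_arr e = qmor_id (tri_ob a).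
Proof. by move: a e => [|[|a]] e. Qed.

Lemma tri_arr_comp a b c (e1 : (a <= b)%N) (e2 : (b <= c)%N) (e3 : (a <= c)%N) :
  qmor_comp (tri_arr e2) (tri_arr e1) (tri_arr e3).
Proof.
by move: a b c e1 e2 e3 => [|[|a]] [|[|b]] [|[|c]] //= *; first [exact: qmor_idl | exact: qmor_idr | exact: STR].
Qed.

Definition triangle : BQP_obj X 2 :=
  @QChain _ _ X 2 (fun i => tri_ob i) (fun i j => @tri_arr i j)
    (fun i => @tri_arr_id i) (fun i j l => @tri_arr_comp i j l).

Lemma arrow_triangle (t : mono 1 2) a b (ab : (a <= b)%N) : t ord0 = a :> nat -> t ord_max = b :> nat ->
  arrow (sop t triangle) = mk_arrow (tri_arr ab).
Proof. 
rewrite /arrow /=; set e := mono_le _ _; move: e => /=; move: (t ord0 : nat) (t ord_max : nat) => a' b' e ea eb.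
by subst a' b'; rewrite (Prop_irrelevance e ab).
Qed.
End Triangle.

(** The edge is cut out of the triangle S, id, S, so that a single table of arrows serves for edges
    and triangles. *)
Definition edge X (M N : bundle X) (S : qmor M N) : BQP_obj X 1 := dface 2 (triangle (qmor_idl S)).

Lemma arrow_edge X (M N : bundle X) (S : qmor M N) : arrow (edge S) = mk_arrow S.
Proof. by apply: (@arrow_triangle _ _ _ _ _ _ _ _ _ 0 1 isT); rewrite /= /bump !inordK. Qed.

Lemma edgeP X (M N : bundle X) (S : qmor M N) (c : BQP_obj X 1) : arrow c = mk_arrow S -> c = edge S.
Proof. by move=> e; apply: edge_ext; rewrite e arrow_edge. Qed.

Lemma tri_edge X (M N P : bundle X) (S : qmor M N) (T : qmor N P) (R : qmor M P) :
  qmor_comp T S R -> tri (edge S) (edge T) (edge R).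
Proof.
move=> STR; exists (triangle STR); split; apply: edgeP.
- by apply: (@arrow_triangle _ _ _ _ _ _ _ _ _ 0 1 isT); rewrite /= /bump !inordK.
- by apply: (@arrow_triangle _ _ _ _ _ _ _ _ _ 1 2 isT); rewrite /= /bump !inordK.
- by apply: (@arrow_triangle _ _ _ _ _ _ _ _ _ 0 2 isT); rewrite /= /bump !inordK.
Qed.

Lemma pull_edge X Y (f : gmap X Y) (M N : bundle Y) (S : qmor M N) :
  pull_nerve f 1 (edge S) = edge (pull_qmor f S).
Proof.
apply: edgeP; have := arrow_edge S.
by move=> /(congr1 (fun s : qarrow Y => mk_arrow (pull_qmor f (projT2 s)))).
Qed.

Lemma edge_source_ob X (M N : bundle X) (S : qmor M N) (c : qchain X 0) : qo c ord0 = M -> dface 1 (edge S) = c.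
Proof.
move=> eM; rewrite dface_source; apply: vertex_ext; rewrite eM.
exact: (congr1 (fun s : qarrow X => (projT1 s).1) (arrow_edge S)).
Qed.

Lemma edge_target X (M N N' : bundle X) (S : qmor M N) (S' : qmor N' N) : dface 0 (edge S) = dface 0 (edge S').
Proof.
rewrite !dface_target; apply: vertex_ext.
transitivity N; first exact: (congr1 (fun s : qarrow X => (projT1 s).2) (arrow_edge S)).
by apply/esym; exact: (congr1 (fun s : qarrow X => (projT1 s).2) (arrow_edge S')).
Qed.

Lemma edge_label X (I : Type) (x : I -> X (scalars k)) (M N : bundle X) (S : qmor M N) i :
  [pchar k] =i pred0 -> (forall i g, act X g (x i) = x i) ->
  chain_label x (edge S) ord0 ord_max i = qmor_label (x i) S.
Proof.
move=> char0 xf; rewrite (chain_labelE char0 xf _ (leq0n _ : (@ord0 1 <= @ord_max 1)%N)).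
exact: (congr1 (fun s : qarrow X => qmor_label (x i) (projT2 s)) (arrow_edge S)).
Qed.

End Edges.

Section ZeroEdges.
Variables (k : fieldType) (G : finGroupType).
Implicit Types X Y : gfunctor k G.

Lemma from_zero_mono X (M : bundle X) : adm_mono (from_zero M).
Proof.
exists M, (bmor_id M) => A x; split=> [s t _|t|s] /=.
- by rewrite (thinmx0 s) (thinmx0 t).
- by exists t.
- by split=> [->|[_ <-]]; first exists 0.
Qed.

Lemma to_zero_epi X (M : bundle X) : adm_epi (to_zero M).
Proof.
exists M, (bmor_id M) => A x; split=> [//|t|s]; first by exists 0; rewrite (thinmx0 t).
by split=> // _; exists s.
Qed.

Definition span_of X (M N : bundle X) (s : span M N) : qmor M N := exist _ (span_iso s) (ex_intro _ s erefl).

Lemma pull_span_of X Y (f : gmap X Y) (M N : bundle Y) (s : span M N) (t : span (pull f M) (pull f N)) :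
  span_iso (pull_span f s) = span_iso t -> pull_qmor f (span_of s) = span_of t.
Proof. by move=> e; apply: qmor_eq; rewrite /= pull_classE. Qed.

(* The two standard morphisms 0 -> M of the Q-construction, whose difference is
   the loop representing the class of M in K_0. *)
Definition zero_sub X (M : bundle X) : qmor (zero_bundle X) M :=
  span_of (Span (bmor_id_epi (zero_bundle X)) (from_zero_mono M)).

Definition zero_quot X (M : bundle X) : qmor (zero_bundle X) M :=
  span_of (Span (to_zero_epi M) (bmor_id_mono M)).

Lemma pull_zero_sub X Y (f : gmap X Y) (M : bundle Y) : pull_qmor f (zero_sub M) = zero_sub (pull f M).
Proof.
apply: pull_span_of; apply: funext => t; apply: propext; split.
- by case=> u hu; exists u.
- by case=> u hu; exists u.
Qed.

Lemma pull_zero_quot X Y (f : gmap X Y) (M : bundle Y) : pull_qmor f (zero_quot M) = zero_quot (pull f M).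
Proof.
apply: pull_span_of; apply: funext => t; apply: propext; split.
- by case=> u hu; exists u.
- by case=> u hu; exists u.
Qed.

Definition bmor_inverse X (M N : bundle X) (u : bmor M N) (v : forall A (x : X A), {linear N A x -> M A x})
  (uv : forall A (x : X A) n, u A x (v A x n) = n) (vu : forall A (x : X A) m, v A x (u A x m) = m) :
  bmor N M.
Proof.
exists v => [A B h x y e s|A g x y e s].
- by rewrite -{1}[s]uv -bf_res vu.
- by rewrite -{1}[s]uv -bf_phi vu.
Defined.

Section Iso.
Variables (X : gfunctor k G) (M N : bundle X) (u : bmor M N) (v : bmor N M).
Hypotheses (uv : forall A (x : X A) n, u A x (v A x n) = n) (vu : forall A (x : X A) m, v A x (u A x m) = m).

Lemma iso_mono : adm_mono u.
Proof.
exists (zero_bundle X), (to_zero N) => A x; split=> [|t|s]; first by move=> s t e; rewrite -(vu s) e vu.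
  by exists 0; rewrite (thinmx0 t).
by split=> // _; exists (v A x s).
Qed.

Definition iso_qmor : qmor M N := span_of (Span (bmor_id_epi M) iso_mono).

(** Together with [zero_quot_iso] this makes an isomorphism M -> N the edge t that [tri_difference]
    needs between the standard edges of M and of N. *)
Lemma zero_sub_iso : qmor_comp iso_qmor (zero_sub M) (zero_sub N).
Proof.
eexists; eexists; eexists; split; try exact: span_iso_refl.
exists (bmor_id _), (from_zero M) => A x; split=> //= [m n <-|m]; last by rewrite linear0.
by exists m; split=> // l [].
Qed.

Lemma zero_quot_iso : qmor_comp iso_qmor (zero_quot M) (zero_quot N).
Proof.
eexists; eexists; eexists; split; try exact: span_iso_refl.
exists v, v => A x; split=> //= [m n <-|m]; last by rewrite uv.
by exists (u A x m); split=> [|l [<- _]]; rewrite ?vu ?uv.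
Qed.
End Iso.

Section ZeroLabels.
Variables (X : gfunctor k G) (x : X (scalars k)) (char0 : [pchar k] =i pred0) (x_fixed : forall g, act X g x = x).

Lemma fixed_dim_zero : fixed_dim x (zero_bundle X) = 0%N.
Proof.
apply: has_dim_unique (fixed_dimP x (zero_bundle X)) _.
exists (idfun : {linear 'rV[k]_0 -> 'rV[k]_0}) => // v; split=> [_|[t <-] g e //].
by exists v.
Qed.

Lemma zero_sub_label (M : bundle X) : qmor_label x (zero_sub M) = 0.
Proof.
rewrite (@qmor_labelE _ char0 _ _ _ x_fixed _ _ (zero_sub M) _ (span_iso_refl _)).
by rewrite /span_label /= fixed_dim_zero.
Qed.

Lemma zero_quot_label (M : bundle X) : qmor_label x (zero_quot M) = (fixed_dim x M)%:Z.
Proof.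
rewrite (@qmor_labelE _ char0 _ _ _ x_fixed _ _ (zero_quot M) _ (span_iso_refl _)).
by rewrite /span_label /= fixed_dim_zero subr0.
Qed.
End ZeroLabels.

End ZeroEdges.

(** * The bundles P and Q *)

Section PermutationBundle.
Variables (k : fieldType) (G : finGroupType) (X : gfunctor k G) (m n : nat).
Variable r : G -> 'I_n -> 'I_n.
Hypotheses (r1 : forall j, r 1%g j = j) (rM : forall g h j, r (g * h)%g j = r g (r h j)).

Lemma matrix_base_change (A B : kalg k) (h : khom A B) :
  @base_change k A B h 'M[A]_(m, n) 'M[B]_(m, n) (map_mx h).
Proof.
split; first by split=> [u v|a u]; [apply: map_mxD | apply: map_mxZ].
move=> P w [wD wZ].
have w0 : w 0 = 0 by have := wZ 0 0; rewrite scaler0 rmorph0 scale0r.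
pose f (N : 'M[B]_(m, n)) : P := \sum_i \sum_j N i j *: w (delta_mx i j).
have fD u v : f (u + v) = f u + f v.
  rewrite -big_split; apply: eq_bigr => i _; rewrite -big_split; apply: eq_bigr => j _.
  by rewrite mxE scalerDl.
have fZ a u : f (a *: u) = a *: f u.
  rewrite scaler_sumr; apply: eq_bigr => i _; rewrite scaler_sumr; apply: eq_bigr => j _.
  by rewrite mxE scalerA.
exists (build_linear fD fZ) => [N|v' hv' N] /=.
  rewrite {2}(matrix_sum_delta N) (big_morph w wD w0); apply: eq_bigr => i _.
  by rewrite (big_morph w wD w0); apply: eq_bigr => j _; rewrite wZ mxE.
rewrite {1}(matrix_sum_delta N) linear_sum; apply: eq_bigr => i _.
rewrite linear_sum; apply: eq_bigr => j _; rewrite linearZ -hv'; congr (_ *: v' _).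
by apply/matrixP => p q; rewrite !mxE rmorph_nat.
Qed.

Definition matrix_qcoh : qcoh X.
Proof.
apply: (@QCoh k X (fun A _ => ('M[A]_(m, n) : lmodType A)) (fun A B h x y e => map_mx h)).
- by move=> *; apply: matrix_base_change.
- by move=> A x e s; apply/matrixP => i j; rewrite mxE.
- by move=> A B C g f x y z e1 e2 e3 s; apply/matrixP => i j; rewrite !mxE.
Defined.

(** The structure map goes from the fibre at g x to the fibre at x, hence [r g] and not its
    inverse. *)
Definition col_reindex (A : kalg k) (g : G) (v : 'M[A]_(m, n)) : 'M[A]_(m, n) := \matrix_(i, j) v i (r g j).

Lemma col_reindexD (A : kalg k) g (u v : 'M[A]_(m, n)) : col_reindex g (u + v) = col_reindex g u + col_reindex g v.
Proof. by apply/matrixP => i j; rewrite !mxE. Qed.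

Lemma col_reindexZ (A : kalg k) g a (v : 'M[A]_(m, n)) : col_reindex g (a *: v) = a *: col_reindex g v.
Proof. by apply/matrixP => i j; rewrite !mxE. Qed.

Definition matrix_gqcoh : gqcoh X.
Proof.
exists matrix_qcoh (fun A g x y e => build_linear (@col_reindexD A g) (@col_reindexZ A g)).
- move=> A g x y e; exists (col_reindex g^-1) => v; apply/matrixP => i j; rewrite !mxE -rM.
    by rewrite mulgV r1.
  by rewrite mulVg r1.
- by move=> A B h g x y x' y' e e' ex ey s; apply/matrixP => i j; rewrite !mxE.
- by move=> A g h x y z e1 e2 e3 s; apply/matrixP => i j; rewrite !mxE rM.
Defined.

Lemma matrix_free (A : kalg k) : @module_locally_free k A 'M[A]_(m, n).
Proof.
exists 1%N, (fun _ => 1); split.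
  exists 1%N, (fun _ => 1), (fun _ => 1); split; first by move=> _; exists ord0.
  by rewrite big_ord1 mulr1.
move=> _; exists A, (khom_id A); split.
  split.
  - by exists 1; rewrite mulr1.
  - by move=> b; exists 0%N, b; rewrite mul1r.
  - by move=> a e; exists 0%N; rewrite mul1r.
exists (m * n)%N, (fun v => mxvec v); split; first by split=> [u v|a v]; rewrite ?linearD ?linearZ.
move=> P w [wD wZ].
have fD (u v : 'rV[A]_(m * n)) : w (vec_mx (u + v)) = w (vec_mx u) + w (vec_mx v) by rewrite linearD wD.
have fZ a (v : 'rV[A]_(m * n)) : w (vec_mx (a *: v)) = a *: w (vec_mx v) by rewrite linearZ wZ.
exists (build_linear fD fZ) => [v /=|v' hv' v]; first by rewrite mxvecK.
by rewrite -[in LHS](vec_mxK v) hv'.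
Qed.

Definition matrix_bundle : bundle X := @Bundle _ _ X matrix_gqcoh (fun A _ => matrix_free A).

End PermutationBundle.

Section GenericMatrix.
Variables (k : fieldType) (char0 : [pchar k] =i pred0) (G : finGroupType).
Notation n := #|G|.
Notation S := ('I_n * 'I_n)%type.

Definition regular (g : G) (j : 'I_n) : 'I_n := enum_rank (g * enum_val j)%g.

Lemma regular1 j : regular 1%g j = j.
Proof. by rewrite /regular mul1g enum_valK. Qed.

Lemma regularM g h j : regular (g * h)%g j = regular g (regular h j).
Proof. by rewrite /regular enum_rankK mulgA. Qed.

Lemma regularK g : cancel (regular g) (regular g^-1%g).
Proof. by move=> j; rewrite -regularM mulVg regular1. Qed.

Lemma regular_transitive i j : exists g, regular g i = j.
Proof. by exists (enum_val j * (enum_val i)^-1)%g; rewrite /regular mulgKV enum_valK. Qed.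

Definition row_act (g : G) (x : S) : S := (regular g^-1%g x.1, x.2).

Lemma row_act1 x : row_act 1%g x = x.
Proof. by case: x => i j; rewrite /row_act /= invg1 regular1. Qed.

Lemma row_actM g h x : row_act (g * h)%g x = row_act h (row_act g x).
Proof. by rewrite /row_act /= invMg regularM. Qed.

Definition coord_mx (A : kalg k) (s : S -> A) : 'M[A]_n := \matrix_(i, j) s (i, j).

Lemma coord_mx_act (A : kalg k) g (s : S -> A) :
  coord_mx (s \o row_act g) = row_perm (perm (can_inj (regularK g^-1%g))) (coord_mx s).
Proof. by apply/matrixP => i j; rewrite !mxE permE. Qed.

(* A row permutation changes the determinant by a sign only. *)
Definition disc_det (A : kalg k) (s : S -> A) : A := \det (coord_mx s) ^+ 2.

Lemma disc_det_nat (A B : kalg k) (h : khom A B) s : h (disc_det s) = disc_det (h \o s).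
Proof.
by rewrite /disc_det rmorphXn -det_map_mx; congr (\det _ ^+ 2); apply/matrixP => i j; rewrite !mxE.
Qed.

Lemma disc_det_act (A : kalg k) g (s : S -> A) : disc_det (s \o row_act g) = disc_det s.
Proof. by rewrite /disc_det coord_mx_act row_permE det_mulmx det_perm exprMn sqrr_sign mul1r. Qed.

Let X := plane_sm char0 row_act1 row_actM disc_det_nat disc_det_act.
Let U := chart k row_act1 row_actM.
Let W := overlap row_act1 row_actM disc_det_nat disc_det_act.
Let j m : gmap W U := overlap_map_chart row_act1 row_actM disc_det_nat disc_det_act m.
Let f m : gmap U X := chart_map row_act1 row_actM disc_det_nat disc_det_act m.

Definition reg_bundle m : bundle U := matrix_bundle U m regular1 regularM.
Definition triv_bundle m : bundle U :=
  matrix_bundle U m (r := fun _ (i : 'I_n) => i) (fun _ => erefl) (fun _ _ _ => erefl).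

(* The generic matrix s intertwines the row permutation on coordinates with the
   permutation of columns of v, so right multiplication by it is equivariant. *)
Definition generic_iso l m : bmor (pull (j l) (reg_bundle m)) (pull (j l) (triv_bundle m)).
Proof.
exists (fun A (x : W A) => (mulmxr (coord_mx (sval x \o Some \o Some)) : {linear 'M[A]_(m, n) -> 'M[A]_(m, n)})).
- move=> A B h x y e v /=; case: y / e; rewrite map_mxM; congr (_ *m _).
  by apply/matrixP => p q; rewrite !mxE.
- move=> A g x y e; case: y / e => v; apply/matrixP => p q; rewrite !mxE /=.
  rewrite [RHS](reindex_inj (can_inj (regularK g))); apply: eq_bigr => l' _.
  by rewrite !mxE /= /row_act /= regularK.
Defined.

(** From det(s)^2 e = 1 the inverse of det(s) is e det(s), which multiplies the adjugate. *)
Definition generic_inv (A : kalg k) (x : W A) : 'M[A]_n :=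
  let M := coord_mx (sval x \o Some \o Some) in (sval x (Some None) * \det M) *: \adj M.

Lemma generic_invP (A : kalg k) (x : W A) : let M := coord_mx (sval x \o Some \o Some) in
  M *m generic_inv x = 1%:M /\ generic_inv x *m M = 1%:M.
Proof.
move=> M; have e : disc_det (sval x \o Some \o Some) * sval x (Some None) = 1 := svalP x.
have e1 : sval x (Some None) * \det M * \det M = 1 by rewrite -e /disc_det -/M; ring.
by rewrite /generic_inv -/M -scalemxAr -scalemxAl mul_mx_adj mul_adj_mx !scale_scalar_mx e1.
Qed.

Definition generic_iso_inv l m : bmor (pull (j l) (triv_bundle m)) (pull (j l) (reg_bundle m)).
Proof.
apply: (@bmor_inverse _ _ _ _ _ (generic_iso l m) (fun A (x : W A) => (mulmxr (generic_inv x) : {linear 'M[A]_(m, n) -> 'M[A]_(m, n)}))) => A x v /=.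
- by rewrite -mulmxA (generic_invP x).2 mulmx1.
- by rewrite -mulmxA (generic_invP x).1 mulmx1.
Defined.

Definition origin : U (scalars k) := pair_pt row_act1 row_actM (A := scalars k) (fun _ : S => 0) 0.

Lemma origin_fixed g : act U g origin = origin.
Proof. by apply: aff_eq => -[x|]. Qed.

(** The regular permutation is transitive on columns, so a fixed matrix is constant along each
    row. *)
Lemma reg_bundle_dim m : fixed_dim origin (reg_bundle m) = m.
Proof.
have n0 : (0 < n)%N by apply/card_gt0P; exists 1%g.
apply: has_dim_unique (fixed_dimP origin (reg_bundle m)) _.
pose F (t : 'rV[k]_m) : 'M[k]_(m, n) := \matrix_(i, _) t 0 i.
have FD u v : F (u + v) = F u + F v by apply/matrixP => i i'; rewrite !mxE.
have FZ a v : F (a *: v) = a *: F v by apply/matrixP => i i'; rewrite !mxE.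
exists (build_linear FD FZ) => [u v e|v].
  apply/rowP => i; have := congr1 (fun M : 'M_(m, n) => M i (Ordinal n0)) e.
  by rewrite /= !mxE.
split=> [hv|[t <-] g e]; last by apply/matrixP => i i'; rewrite !mxE.
exists (\row_i (v : 'M[k]_(m, n)) i (Ordinal n0)); apply/matrixP => i i'; rewrite !mxE.
have [g <-] := regular_transitive (Ordinal n0) i'.
by have := congr1 (fun M : 'M[k]_(m, n) => M i (Ordinal n0)) (hv g (origin_fixed g)); rewrite /= mxE.
Qed.

Lemma triv_bundle_dim m : fixed_dim origin (triv_bundle m) = (m * n)%N.
Proof.
apply: has_dim_unique (fixed_dimP origin (triv_bundle m)) _.
exists (vec_mx : {linear 'rV[k]_(m * n) -> 'M[k]_(m, n)}) => [|v]; first exact: can_inj vec_mxK.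
split=> [_|_ g e]; first by exists (mxvec (v : 'M[k]_(m, n))); apply: mxvecK.
by apply/matrixP => i i'; rewrite !mxE.
Qed.

Definition diagonal (A : kalg k) (t : A) (x : S) : A := if x.1 == x.2 then t else 0.

Lemma disc_det_diagonal (A : kalg k) : disc_det (@diagonal A 1) = 1.
Proof.
rewrite /disc_det (_ : coord_mx _ = 1%:M) ?det1 ?expr1n //.
by apply/matrixP => p q; rewrite !mxE /diagonal /=; case: eqP.
Qed.

(** At t = 0 this is the origin. At t = 1 it has s = 1 and y = -m, so c = m + d(s) y = 0 for every
    m, and all these curves end in the same point of X. *)
Definition path_pt m : U (line k) :=
  pair_pt row_act1 row_actM (@diagonal (line k) 'X) (- m%:R * 'X).

Definition common_fun (x : option (option S)) : scalars k :=
  match x with Some (Some x) => diagonal 1 x | Some None => 1 | None => 0 end.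

Lemma common_cond : overlap_cond disc_det (A := scalars k) common_fun.
Proof.
rewrite /overlap_cond [common_fun (Some None)]/(1 : scalars k) mulr1.
exact: disc_det_diagonal.
Qed.

Definition common_pt : W (scalars k) := exist (@overlap_cond _ _ disc_det (scalars k)) common_fun common_cond.

Lemma path_start m : ap X (line_eval 0) (f m (line k) (path_pt m)) = f m _ origin.
Proof.
apply: (kmnat (f m)); apply: aff_eq => -[[p q]|] /=.
  by rewrite /diagonal /=; case: eqP => _; rewrite ?rmorph0 //= /horner_eval hornerX.
by rewrite /horner_eval hornerM hornerX mulr0.
Qed.

Lemma path_end m : ap X (line_eval 1) (f m (line k) (path_pt m)) = f 0 _ (j 0 _ common_pt).
Proof.
rewrite [RHS](chart_overlap 0 m common_pt); apply: (kmnat (f m)); apply: aff_eq => -[[p q]|] /=.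
  by rewrite /diagonal /=; case: eqP => _; rewrite ?rmorph0 //= /horner_eval hornerX.
by rewrite /horner_eval hornerM hornerX hornerN -polyC_natr hornerC sub0r !mulr1.
Qed.
End GenericMatrix.

(** * The classes [P_m] - [Q_m] as loops in the fibrant replacement *)

Section Classes.
Variables (k : fieldType) (char0 : [pchar k] =i pred0) (G : finGroupType).
Variables (F : psh (gsm_cat k G)) (h : psh_map (BQP k G) F) (fib : fibrant_replacement h).
Notation n := #|G|.

Let X : gsm_cat k G := plane_sm char0 (@row_act1 G) (@row_actM G) (@disc_det_nat k G) (@disc_det_act k G).
Let U : gsm_cat k G := chart k (@row_act1 G) (@row_actM G).
Let W : gsm_cat k G := overlap (@row_act1 G) (@row_actM G) (@disc_det_nat k G) (@disc_det_act k G).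
Let j l : hom W U := overlap_map_chart (@row_act1 G) (@row_actM G) (@disc_det_nat k G) (@disc_det_act k G) l.
Let f l : hom U X := chart_map (@row_act1 G) (@row_actM G) (@disc_det_nat k G) (@disc_det_act k G) l.

Definition origin_label : smap (BQP k G U) (abnerve (fun _ : unit -> int => True)) :=
  @nerve_label k char0 G U unit (fun _ => origin k G) (fun _ => @origin_fixed k G) (fun _ => True)
    (fun _ _ _ _ => Logic.I).

Variables (g : smap (F U) (abnerve (fun _ : unit -> int => True))) (c : BQP k G U 0 -> unit -> int).
Hypothesis gE : forall m (x : BQP k G U m) a b i, sval (g m (h U m x)) a b i =
      sval (origin_label m x) a b i + c (sop (mono_const 0 b) x) i - c (sop (mono_const 0 a) x) i.

Definition label (a : F U 1) : int := sval (g 1 a) ord0 ord_max tt.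

(** The loop goes out along the quotient edge and returns along the sub edge. Both edges have the
    same end points, so the correction c cancels from its label. *)
Lemma bundle_class (M : bundle U) : exists a : F U 1,
  [/\ tri a (h U 1 (edge (zero_sub M))) (h U 1 (edge (zero_quot M))),
      dface 1 a = zero_pt h U, dface 0 a = zero_pt h U & label a = (fixed_dim (origin k G) M)%:Z].
Proof.
have src (T : qmor (zero_bundle U) M) : dface 1 (edge T) = zero_chain U.
  exact: edge_source_ob.
have tgt : dface 0 (edge (zero_sub M)) = dface 0 (edge (zero_quot M)) by apply: edge_target.
have [|a [ta a1 a0]] := tri_fill (fib.1 U) (b := h U 1 (edge (zero_sub M))) (c := h U 1 (edge (zero_quot M))).
  by rewrite /dface -!sfun_nat -![sop _ _]/(dface 0 _) tgt.
exists a; split=> //.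
- by rewrite a1 /dface -sfun_nat -[sop _ _]/(dface 1 _) src.
- by rewrite a0 /dface -sfun_nat -[sop _ _]/(dface 1 _) src.
have := tri_label g tt ta; rewrite -[sval (g 1 a) _ _ _]/(label a) !gE.
rewrite -!dface_source -!dface_target !src tgt.
rewrite [sval _ _ _ _](edge_label _ tt char0 (fun _ => @origin_fixed k G)).
rewrite [X in _ = _ + (X + _ - _)](edge_label _ tt char0 (fun _ => @origin_fixed k G)).
rewrite (zero_sub_label char0 (@origin_fixed k G)) (zero_quot_label char0 (@origin_fixed k G)).
by rewrite add0r -addrA => /addIr.
Qed.

Lemma difference_class m : exists a : F U 1,
  [/\ forall i, sop (mono_const 0 i) a = zero_pt h U,
      label a = m%:Z - (m * n)%N%:Z &
      forall l, tri (pres F (j l) 1 a) (sop (mono_const 1 ord0) (zero_pt h W))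
                    (sop (mono_const 1 ord0) (zero_pt h W))].
Proof.
have [aP [tP P1 P0 lP]] := bundle_class (reg_bundle k G m).
have [aQ [tQ Q1 Q0 lQ]] := bundle_class (triv_bundle k G m).
have [|a [ta a1 a0]] := tri_fill (fib.1 U) (b := aQ) (c := aP); first by rewrite P0 Q0.
exists a; split.
- move=> i; case: (unliftP ord_max i) => [i' ->|->]; last by rewrite -dface_target a0 Q1.
  rewrite (_ : lift _ _ = ord0) -?dface_source ?a1 ?P1 //.
  by apply: val_inj; rewrite ord1.
- have := tri_label g tt ta; rewrite -![sval (g 1 _) _ _ _]/(label _) lP lQ.
  by rewrite reg_bundle_dim triv_bundle_dim => ->; rewrite addrK.
move=> l.
pose u := @generic_iso k G l m; pose v := @generic_iso_inv k G l m.
have uv A (x : W A) y : u A x (v A x y) = y.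
  by rewrite /= -mulmxA (generic_invP x).2 mulmx1.
have vu A (x : W A) y : v A x (u A x y) = y.
  by rewrite /= -mulmxA (generic_invP x).1 mulmx1.
have jE (M : bundle U) (S : qmor (zero_bundle U) M) (S' : qmor (zero_bundle W) (pull (j l) M)) :
    pull_qmor (j l) S = S' -> pres F (j l) 1 (h U 1 (edge S)) = h W 1 (edge S').
  by move=> <-; rewrite -pfun_nat; congr (h W 1 _); apply: pull_edge.
have := tri_map (pres F (j l)) ta.
have := tri_map (pres F (j l)) tP; rewrite (jE _ _ _ (pull_zero_sub (j l) _)) (jE _ _ _ (pull_zero_quot (j l) _)).
have := tri_map (pres F (j l)) tQ; rewrite (jE _ _ _ (pull_zero_sub (j l) _)) (jE _ _ _ (pull_zero_quot (j l) _)).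
move=> t1 t2 t3.
have := tri_difference (fib.1 W) t2 t1 t3 (tri_map (h W) (tri_edge (zero_sub_iso uv vu)))
  (tri_map (h W) (tri_edge (zero_quot_iso uv vu))).
rewrite (_ : dface 1 _ = zero_pt h W) //.
by rewrite /dface -sfun_nat; congr (h W 0 _); apply: edge_source_ob.
Qed.

Lemma plane_label_bounded m (x : qchain X m) p q :
  bounded_seq (chain_label (fun l => f l _ (origin k G)) x p q).
Proof.
apply: (chain_label_bounded char0 (a := 0) (b := 1) (w := f 0 _ (j 0 _ (common_pt k G)))
  (g := fun l => f l _ (path_pt k G l))) => [l y|l|l].
- by apply: gm_act; apply: origin_fixed.
- exact: path_start.
- exact: path_end.
Qed.

Lemma label_bounded (l : loops (zero_pt h X) 0) :
  bounded_seq (fun i => label (pres F (f i) 1 (sval l 1 (mono_const 1 ord0, mono_id 1)))).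
Proof.
have xf i y : act X y (f i _ (origin k G)) = f i _ (origin k G).
  by apply: gm_act; apply: origin_fixed.
apply: (loop_label_bounded (hU := h U) (fB := fun i => pres (BQP k G) (f i)) (fF := fun i => pres F (f i))
  (LX := nerve_label char0 xf (@plane_label_bounded)) (fib.2 X) _ _ gE).
- by move=> i m x; rewrite -pfun_nat.
- move=> i m x p q; congr (_ - _); apply/esym/(pull_qmor_label char0 (f i)); exact: origin_fixed.
Qed.
End Classes.

Theorem proposition5p3 (k : fieldType) (char0 : [pchar k]%R =i pred0)
    (G : finGroupType) (nontrivial : (1 < #|{: G}|)%N)
    (F : psh (gsm_cat k G)) (h : psh_map (BQP k G) F)
    (fib : fibrant_replacement h) :
  ~ @cech_descent (hnis_site k G) (equivariant_K h).
Proof.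
have [g [c gE]] := weak_equiv_label (origin_label char0 G) (subgroup_all unit) (fib.2 _).
have [kk hkk] := loop_label (zero_pt h _) g.
have /choice [a ha] := difference_class fib gE.
have az m (i : 'I_2) : sop (mono_const 0 i) (a m) = zero_pt h _ by case: (ha m).
pose U : gsm_cat k G := chart k (@row_act1 G) (@row_actM G).
pose W : gsm_cat k G := overlap (@row_act1 G) (@row_actM G) (@disc_det_nat k G) (@disc_det_act k G).
pose j l : hom W U := overlap_map_chart (@row_act1 G) (@row_actM G) (@disc_det_nat k G) (@disc_det_act k G) l.
have bz (i : 'I_2) : sop (mono_const 0 i) (sop (mono_const 1 ord0) (zero_pt h W)) = zero_pt h W.
  by rewrite -sop_comp -[RHS]sop_id; apply: sop_eq => i'; rewrite !ord1.
have jz m (i : 'I_2) : sop (mono_const 0 i) (pres F (j m) 1 (a m)) = zero_pt h W.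
  by rewrite -sfun_nat az zero_pt_nat.
have /choice [p hp] m : exists p : loops (zero_pt h W) 1,
    sop (mono_const 0 ord0) p = loop_of (jz m) /\ sop (mono_const 0 ord_max) p = loop_of bz.
  by apply: loop_null; case: (ha m) => _ _; apply.
have evN r q (s : mono r q) (l : loops (zero_pt h U) q) : kk r (sop s l) tt = kk q l tt.
  by rewrite sfun_nat.
pose K : smap (loops (zero_pt h U)) (disc int) :=
  @SMap (loops (zero_pt h U)) (disc int) (fun q l => kk q l tt) evN.
pose X : gsm_cat k G := plane_sm char0 (@row_act1 G) (@row_actM G) (@disc_det_nat k G) (@disc_det_act k G).
pose f l : hom U X := chart_map (@row_act1 G) (@row_actM G) (@disc_det_nat k G) (@disc_det_act k G) l.
have fm l : forall (T : gsm_cat k G) (u v : hom T U), comp (f l) u = comp (f l) v -> u = v.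
  exact: chart_map_mono.
have jm l : forall (T : gsm_cat k G) (u v : hom T W), comp (j l) u = comp (j l) v -> u = v.
  exact: overlap_map_mono.
have fj : forall m n, comp (f m) (j m) = comp (f n) (j n).
  exact: chart_overlap_comp.
have fjp : forall m n (T : gsm_cat k G) (u v : hom T U), m <> n ->
     comp (f m) u = comp (f n) v -> exists2 w, comp (j m) w = u & comp (j n) w = v.
  exact: chart_pullback.
have fc : @covering (hnis_site k G) X nat (fun=> U) f.
  exact: chart_hnis_covering.
apply: (@no_cech_descent (hnis_site k G) F (zero_pt h) (@zero_pt_nat _ _ _ h) X U W f j
  fm fj jm fjp fc K (fun m => loop_of (az m)) p (loop_of bz)).
- move=> l.
  have := label_bounded fib gE l.
  by congr bounded_seq; apply: funext => i; rewrite /= hkk.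
- move=> m; rewrite (hp m).1; apply: eq_exist; apply: smap_eq => q x /=.
  by rewrite sfun_nat.
- by move=> m; case: (hp m).
(* At m = C + 1 the label m - m n has absolute value m (n - 1), which exceeds C because n > 1. *)
move=> [C hC]; have := hC C.+1; rewrite /= hkk /= sop_id.
have [_ /= + _] := ha C.+1; rewrite /label => ->.
by move: nontrivial; rewrite -cardsT cardsT; nia.
Qed.
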